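(* Let $\mathfrak a$ be a fractional ideal of $K$ and $m\in\mathbb N$. For $s\in\mathbb C$ with $\operatorname{Re}(s)>1$ we have $$\int_{X(\mathfrak a)}\Phi(\mathfrak a,m,s,z)\,\omega^2=\frac{2\operatorname{vol}(T(\mathfrak a,m))}{s(s-1)}.$$
   Context: $K\subset\mathbb R$ is a real quadratic field of discriminant $D$ ($\sqrt D>0$), $\mathcal O_K$ its ring of integers, $x\mapsto x'$ conjugation (applied entrywise to matrices), $\mathfrak d=\sqrt D\,\mathcal O_K$; ideals are nonzero fractional ideals, $N(\mathfrak a)>0$ the ideal norm. $\mathbb H$ is the upper half plane, $z=(z_1,z_2)=(x_1+iy_1,x_2+iy_2)\in\mathbb H^2$. $\Gamma_{\mathfrak a}=\begin{pmatrix}\mathcal O_K&\mathfrak a^{-1}\\ \mathfrak a&\mathcal O_K\end{pmatrix}\cap\mathrm{SL}_2(K)$ acts on $\mathbb H^2$ by $Mz=(Mz_1,M'z_2)$, and $X(\mathfrak a)=\Gamma_{\mathfrak a}\backslash\mathbb H^2$. The Kähler form is $\omega=\eta_1+\eta_2$ with $\eta_j=\frac1{4\pi}\frac{dx_jdy_j}{y_j^2}$. $L(\mathfrak a)^\vee=\{\begin{pmatrix}a&\lambda'\\ \lambda&b\end{pmatrix}: a\in N(\mathfrak a)^{-1}\mathbb Z,\ b\in\mathbb Z,\ \lambda\in N(\mathfrak a)^{-1}\mathfrak a\mathfrak d^{-1}\}$, on which $\Gamma_{\mathfrak a}$ acts by $M.A=MA(M')^{\top}$. For $A=\begin{pmatrix}a&\lambda'\\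 \lambda&b\end{pmatrix}$ with $\det A\ne0$, $g(A,z)=\frac{|bz_1z_2-\lambda z_1-\lambda'z_2+a|^2}{4y_1y_2\det(A)}$ and $T_A=\{z\in\mathbb H^2:bz_1z_2-\lambda z_1-\lambda'z_2+a=0\}$. $T(\mathfrak a,m)=\sum_{A\in L(\mathfrak a)^\vee/\{\pm1\},\ \det A=m/(N(\mathfrak a)D)}T_A$, a $\Gamma_{\mathfrak a}$-invariant divisor, also viewed as a divisor on $X(\mathfrak a)$. With $Q_{s-1}(x)=\int_0^\infty(x+\sqrt{x^2-1}\cosh t)^{-s}dt$ ($x>1$) the Legendre function of the second kind, $\Phi(\mathfrak a,m,s,z)=\sum_{A\in L(\mathfrak a)^\vee,\ \det A=m/(N(\mathfrak a)D)}Q_{s-1}(1+2g(A,z))$ for $\operatorname{Re}(s)>1$, $z\in\mathbb H^2\setminus T(\mathfrak a,m)$; this is $\Gamma_{\mathfrak a}$-invariant in $z$. Volume of $T(\mathfrak a,m)$: $\operatorname{vol}(T(\mathfrak a,m))=\sum_{A}\operatorname{vol}(T_A)=\sum_A\operatorname{vol}(\Gamma_{\mathfrak a,\pm A}'\backslash\mathbb H)$ with respect to the pullback of the Kähler form $\omega$. The sum is over the finite set of $A\in\Gamma_{\mathfrak a}\backslash L(\mathfrak a)^\vee/\{\pm1\}$ with $\det A=m/(N(\mathfrak a)D)$, and $\Gamma'_{\mathfrak a,\pm A}=\{M':M\in\Gamma_{\mathfrak a},\ M.A\in\{\pm A\}\}$.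
   Formalization: The volume of each quotient by Γ'_{a,±A} is taken with respect to η = dx dy/(4πy²) on the second half plane; the pullback of ω along the parametrization of T_A is 2η, and with that volume the stated identity would be off by a factor 2. *)

(* Defs.v *)
From HB Require Import structures.
From mathcomp Require Import all_boot all_order all_algebra all_field.
From mathcomp Require Import finmap complex.
From mathcomp Require Import all_classical all_reals all_analysis.
From mathcomp Require Import measurable_realfun.

Set Implicit Arguments.
Unset Strict Implicit.
Unset Printing Implicit Defensive.
Import Order.TTheory GRing.Theory Num.Theory.
Import numFieldNormedType.Exports.

Local Open Scope classical_set_scope.
Local Open Scope ring_scope.
Local Open Scope complex_scope.

(* The measure with density [f] with respect to [mu]. *)
Section density.
Context d (T : measurableType d) (R : realType).
Variables (mu : {measure set T -> \bar R}) (f : T -> R).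
Variables (f0 : forall x, 0 <= f x) (mf : measurable_fun setT f).

Definition density_measure of (forall x, 0 <= f x) & measurable_fun setT f :=
  fun B : set T => (\int[mu]_(x in B) (f x)%:E)%E.

Local Notation nu := (density_measure f0 mf).

Let nu0 : nu set0 = 0%E.
Proof. by rewrite /density_measure integral_set0. Qed.

Let nu_ge0 B : (0 <= nu B)%E.
Proof. by apply: integral_ge0 => x _; rewrite lee_fin. Qed.

Let nu_sigma_additive : semi_sigma_additive nu.
Proof.
move=> F mF tF mUF; rewrite /density_measure ge0_integral_bigcup//.
- by apply: is_cvg_ereal_nneg_natsum => k _; apply: integral_ge0 => x _; rewrite lee_fin.
- exact/measurable_EFinP/measurable_funTS.
- by move=> x _; rewrite lee_fin.
Qed.

HB.instance Definition _ :=
  isMeasure.Build _ _ _ (density_measure f0 mf) nu0 nu_ge0 nu_sigma_additive.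

End density.

(* The quotient of a measure space by the fibres of a map [p], for instance
   by the orbits of a group: [p x] is then the orbit of [x].  [B] is
   measurable iff [p @^-1` B] is, and the measure of [B] is the supremum of
   the measures of the measurable parts of [p @^-1` B] that meet each fibre
   at most once.  For a countable group with a measurable strict fundamental
   domain [F] this is the measure of [F `&` p @^-1` B]. *)
Section quotient_measure.
Context d (T : measurableType d) (R : realType) (Y : pointedType).
Variables (mu : {measure set T -> \bar R}) (p : T -> Y).

Definition quotient_space : measurableType _ :=
  g_sigma_algebraType (image_set_system setT p (@measurable d T)).

Definition partial_section (B : set Y) : set (set T) :=
  [set E | [/\ measurable E, E `<=` p @^-1` B & set_inj E p]].

Definition quotient_measure (B : set quotient_space) : \bar R :=
  ereal_sup [set mu E | E in partial_section B].

Let measurable_quotient (B : set quotient_space) :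
  measurable B -> measurable (p @^-1` B).
Proof.
have sA : sigma_algebra [set: Y] (image_set_system setT p (@measurable d T)).
  by apply: sigma_algebra_image; exact: sigma_algebra_measurable.
by move=> /(_ _ (conj sA (@subset_refl _ _))); rewrite /image_set_system/= setTI.
Qed.

Let quotient_measure0 : quotient_measure set0 = 0%E.
Proof.
rewrite /quotient_measure (_ : [set _ | _ in _] = [set 0%E]) ?ereal_sup1//.
apply/seteqP; split => [_ [E [_ + _] <-]|_ ->] /=.
  by rewrite preimage_set0 subset0 => ->; rewrite measure0.
by exists set0; [split => //; move=> x y; rewrite inE|rewrite measure0].
Qed.

Let quotient_measure_ge0 B : (0 <= quotient_measure B)%E.
Proof.
apply: ereal_sup_ubound; exists set0; last by rewrite measure0.
by split => //; move=> x y; rewrite inE.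
Qed.

Let quotient_measureU (A B : set quotient_space) : [disjoint A & B]%classic ->
  (quotient_measure A + quotient_measure B <= quotient_measure (A `|` B))%E.
Proof.
move=> /disj_setPS AB0.
have key E E' : partial_section A E -> partial_section B E' ->
    (mu E + mu E' <= quotient_measure (A `|` B))%E.
  move=> [mE EA iE] [mE' EB iE'].
  have EE' : E `&` E' = set0.
    by rewrite -subset0 => x [/EA Ax /EB Bx]; exact: (AB0 (p x)).
  rewrite -measureU//; apply: ereal_sup_ubound; exists (E `|` E') => //; split.
  - exact: measurableU.
  - by move=> x [/EA|/EB] ?; [left|right].
  - move=> x y; rewrite !inE => -[Ex|E'x] [Ey|E'y] pxy.
    + by apply: iE => //; rewrite inE.
    + by case: (AB0 (p x)); split; [exact: EA|rewrite pxy; exact: EB].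
    + by case: (AB0 (p x)); split; [rewrite pxy; exact: EA|exact: EB].
    + by apply: iE' => //; rewrite inE.
have [qoo|qoo] := eqVneq (quotient_measure (A `|` B)) +oo%E.
  by rewrite qoo leey.
have qfin : quotient_measure (A `|` B) \is a fin_num.
  by rewrite ge0_fin_numE// ltey.
have key2 E' : partial_section B E' ->
    (quotient_measure A + mu E' <= quotient_measure (A `|` B))%E.
  move=> BE'; have E'fin : mu E' \is a fin_num.
    rewrite ge0_fin_numE// (le_lt_trans _ (_ : quotient_measure (A `|` B) < +oo)%E)//.
      apply: le_trans (key set0 E' _ BE'); first by rewrite measure0 add0e.
      by split => //; move=> x y; rewrite inE.
    by rewrite ltey.
  rewrite -leeBrDr//; apply: ge_ereal_sup => _ [E AE <-].
  by rewrite leeBrDr//; exact: key.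
have Afin : quotient_measure A \is a fin_num.
  rewrite ge0_fin_numE// (le_lt_trans _ (_ : quotient_measure (A `|` B) < +oo)%E)//.
    apply: le_trans (key2 set0 _); first by rewrite measure0 adde0.
    by split => //; move=> x y; rewrite inE.
  by rewrite ltey.
rewrite addeC -leeBrDr//; apply: ge_ereal_sup => _ [E BE <-].
by rewrite leeBrDr// addeC; exact: key2.
Qed.

Let quotient_measure_sigma_additive : semi_sigma_additive quotient_measure.
Proof.
move=> F mF tF mUF.
have le_qm (A B : set quotient_space) : A `<=` B ->
    (quotient_measure A <= quotient_measure B)%E.
  move=> AB; apply: ereal_sup_le => _ [E [mE EA iE] <-]; exists E => //.
  by split => // x /EA /AB.
suff -> : quotient_measure (\bigcup_n F n) =
          (\sum_(0 <= i <oo) quotient_measure (F i))%E.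
  by apply: is_cvg_nneseries => n _ _; exact: quotient_measure_ge0.
apply/eqP; rewrite eq_le; apply/andP; split.
- apply: ge_ereal_sup => _ [E [mE EF iE] <-].
  have mEF i : measurable (E `&` p @^-1` F i).
    by apply: measurableI => //; exact: measurable_quotient.
  have -> : E = \bigcup_i (E `&` p @^-1` F i).
    by rewrite -setI_bigcupr -preimage_bigcup; apply/esym/setIidPl.
  rewrite measure_semi_bigcup//; last 2 first.
  + move=> i j _ _ [x [[_ /= Fi] [_ /= Fj]]]; apply: tF => //.
    by exists (p x).
  + exact: bigcupT_measurable.
  apply: lee_nneseries => // i _; apply: ereal_sup_ubound.
  exists (E `&` p @^-1` F i) => //; split => //.
  by move=> x y; rewrite !inE => -[Ex _] [Ey _]; apply: iE; rewrite inE.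
- apply: lime_le.
    by apply: is_cvg_nneseries => n _ _; exact: quotient_measure_ge0.
  apply: nearW => n.
  suff : (\sum_(0 <= i < n) quotient_measure (F i) <=
          quotient_measure (\big[setU/set0]_(0 <= i < n) F i))%E.
    move=> /le_trans; apply; apply: le_qm.
    by rewrite big_mkord; exact: bigsetU_bigcup.
  elim: n => [|n IHn]; first by rewrite !big_geq// quotient_measure0.
  rewrite !big_nat_recr//=; apply: le_trans (leeD2r _ IHn) _.
  apply: quotient_measureU; rewrite disj_set2E big_mkord big_distrl/=.
  apply/eqP; apply: big1 => i _.
  apply: contrapT => /eqP/set0P ne; have := tF i n Logic.I Logic.I ne.
  by move=> iE; have := ltn_ord i; rewrite iE ltnn.
Qed.

HB.instance Definition _ := isMeasure.Build _ _ _ quotient_measure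
  quotient_measure0 quotient_measure_ge0 quotient_measure_sigma_additive.

End quotient_measure.

Arguments quotient_measure {d T R Y} mu p B : rename.

Section complex_calculus.
Variable R : realType.
Implicit Types s w : R[i].

Definition cintegrable d (T : measurableType d) (mu : {measure set T -> \bar R})
    (D : set T) (f : T -> R[i]) :=
  mu.-integrable D (EFin \o (fun x => complex.Re (f x))) /\
  mu.-integrable D (EFin \o (fun x => complex.Im (f x))).

Definition cintegral d (T : measurableType d) (mu : {measure set T -> \bar R})
    (D : set T) (f : T -> R[i]) : R[i] :=
  (\int[mu]_(x in D) complex.Re (f x)) +i* (\int[mu]_(x in D) complex.Im (f x)).

(* Unconditional sums; meaningful for absolutely summable families. *)
Definition rsum (I : choiceType) (D : set I) (f : I -> R) : R :=
  fine (esum D (EFin \o f)^\+ - esum D (EFin \o f)^\-)%E.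

Definition csum (I : choiceType) (D : set I) (f : I -> R[i]) : R[i] :=
  rsum D (fun i => complex.Re (f i)) +i* rsum D (fun i => complex.Im (f i)).

(* [x ^ s = exp (s * ln x)] for real [x > 0] *)
Definition cpow (x : R) s : R[i] :=
  (expR (complex.Re s * ln x) * cos (complex.Im s * ln x)) +i*
  (expR (complex.Re s * ln x) * sin (complex.Im s * ln x)).

Definition cosh (t : R) : R := (expR t + expR (- t)) / 2.

(* [legendreQ s x] is Q_{s-1}(x). *)
Definition legendreQ s (x : R) : R[i] :=
  cintegral lebesgue_measure `]0, +oo[
    (fun t : R => cpow (x + Num.sqrt (x ^+ 2 - 1) * cosh t) (- s)).

End complex_calculus.

Section half_plane.
Variable R : realType.
Local Notation RR := (measurableTypeR R).

(* The pair (x, y) stands for the complex number x + iy. *)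
Definition toC (p : RR * RR) : R[i] := p.1 +i* p.2.
Definition ofC (w : R[i]) : RR * RR := (complex.Re w, complex.Im w).

Definition HH : set (RR * RR) := [set p | 0 < (p.2 : R)].
Definition HH2 : set ((RR * RR) * (RR * RR)) := HH `*` HH.

Definition moebius (M : 'M[R]_2) (p : RR * RR) : RR * RR :=
  ofC (((M 0 0)%:C * toC p + (M 0 1)%:C) / ((M 1 0)%:C * toC p + (M 1 1)%:C)).

Definition lebesgue2 : set (RR * RR) -> \bar R :=
  (@lebesgue_measure R \x @lebesgue_measure R)%E.

HB.instance Definition _ := Measure.on lebesgue2.

Lemma lebesgue2_sigma_finite : sigma_finite setT lebesgue2.
Proof.
have /sigma_finiteP[F [TF ndF Foo]] := sigma_finiteT (@lebesgue_measure R).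
exists (fun n => F n `*` F n).
  rewrite -setXTT predeqE => -[x y]; split => // _.
  have [n _ Fnx] : (\bigcup_n F n) x by rewrite -TF.
  have [k _ Fky] : (\bigcup_n F n) y by rewrite -TF.
  exists (maxn n k) => //; split => /=.
    by move: x Fnx; exact/subsetPset/ndF/leq_maxl.
  by move: y Fky; exact/subsetPset/ndF/leq_maxr.
move=> k; have [mF ?] := Foo k.
split; first exact: measurableX.
by rewrite /lebesgue2 [ltLHS]product_measure1E// lte_mul_pinfty// ge0_fin_numE.
Qed.

HB.instance Definition _ :=
  Measure_isSigmaFinite.Build _ _ _ lebesgue2 lebesgue2_sigma_finite.

(* The density of eta = dx dy / (4 pi y^2). *)
Definition eta_density (p : RR * RR) : R := (4 * pi * (p.2 : R) ^+ 2)^-1.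

Lemma eta_density_ge0 p : 0 <= eta_density p.
Proof. by rewrite invr_ge0 mulr_ge0 ?sqr_ge0// mulr_ge0// pi_ge0. Qed.

Lemma measurable_eta_density : measurable_fun setT eta_density.
Proof.
rewrite (_ : eta_density = fun p => (4 * pi * (p.2 : R) ^+ 2) `^ (-1)).
  apply: (measurableT_comp (measurable_powR _)).
  by apply: measurable_funM => //; apply: measurable_funX; exact: measurable_snd.
by apply/funext => p; rewrite powR_inv1// mulr_ge0 ?sqr_ge0// mulr_ge0// pi_ge0.
Qed.

Definition eta : {measure set (RR * RR) -> \bar R} :=
  density_measure lebesgue2 eta_density_ge0 measurable_eta_density.

(* omega ^ 2 = (eta_1 + eta_2) ^ 2 = 2 eta_1 /\ eta_2 *)
Definition omega2_density (z : (RR * RR) * (RR * RR)) : R :=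
  2 * (eta_density z.1 * eta_density z.2).

Lemma omega2_density_ge0 z : 0 <= omega2_density z.
Proof. by rewrite mulr_ge0// mulr_ge0// eta_density_ge0. Qed.

Lemma measurable_omega2_density : measurable_fun setT omega2_density.
Proof.
apply: measurable_funM => //; apply: measurable_funM.
  exact: measurableT_comp measurable_eta_density measurable_fst.
exact: measurableT_comp measurable_eta_density measurable_snd.
Qed.

Definition omega2 : {measure set ((RR * RR) * (RR * RR)) -> \bar R} :=
  density_measure (lebesgue2 \x lebesgue2)%E
    omega2_density_ge0 measurable_omega2_density.

(* [G] acts on the upper half plane through [moebius].  This is the volume of
   the quotient of the upper half plane by [G] with respect to eta. *)
Definition orbitH (G : set 'M[R]_2) (p : RR * RR) : set (RR * RR) :=
  [set moebius M p | M in G].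

Definition vol_quotient (G : set 'M[R]_2) : \bar R :=
  quotient_measure eta (orbitH G) (orbitH G @` HH).

End half_plane.

(* [K] is a quadratic extension of the rationals, [iota] its embedding into the
   reals, [conj] its nontrivial automorphism, and [D] its discriminant. *)
Section hilbert_modular.
Variables (R : realType) (K : fieldExtType rat).
Variables (iota : {rmorphism K -> R}) (conj : {rmorphism K -> K}) (D : int).
Implicit Types (I J a : set K) (A M : 'M[K]_2) (m : nat) (s : R[i]).
Local Notation RR := (measurableTypeR R).
Local Notation H2T := ((RR * RR) * (RR * RR))%type.

Definition OK : set K := [set x | integralOver (fun n : int => n%:~R : K) x].

Definition integral_basis (b1 b2 : K) :=
  [/\ OK b1, OK b2,
      forall x, OK x -> exists i j : int, x = b1 *~ i + b2 *~ j
    & forall i j : int, b1 *~ i + b2 *~ j = 0 -> i = 0 /\ j = 0].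

Definition is_discriminant :=
  exists b1 b2 : K, integral_basis b1 b2 /\
    D%:~R = (b1 * conj b2 - b2 * conj b1) ^+ 2.

Definition fractional_ideal I :=
  [/\ exists2 x, I x & x != 0,
      forall x y, I x -> I y -> I (x - y),
      forall c x, OK c -> I x -> I (c * x)
    & exists2 c, c != 0 & forall x, I x -> OK (c * x)].

Definition idealM I J : set K :=
  [set x | exists2 u : seq (K * K), (forall q, q \in u -> I q.1 /\ J q.2) &
    x = \sum_(q <- u) q.1 * q.2].

Definition idealV I : set K := [set x | forall y, I y -> OK (x * y)].

Definition cosets I J : set (set K) := [set [set x + y | y in J] | x in I].

(* The index of the additive group [J] in the additive group [I], when
   [J `<=` I] and the index is finite. *)
Definition index_of I J : nat := #|` fset_set (cosets I J)|.

(* The norm of a fractional ideal as the generalized index of [I] in [OK]; for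
   [I `<=` OK] the denominator is 1 and this is the cardinal of [OK / I]. *)
Definition ideal_norm I : rat :=
  (index_of OK (OK `&` I))%:R / (index_of I (OK `&` I))%:R.

(* sqrt(D) OK *)
Definition different : set K :=
  [set x | exists2 y, OK y & iota x = Num.sqrt (D%:~R) * iota y].

Definition Gamma a : set 'M[K]_2 :=
  [set M : 'M[K]_2 | [/\ OK (M 0 0), idealV a (M 0 1), a (M 1 0), OK (M 1 1)
             & \det M = 1]].

Definition real_mx M : 'M[R]_2 := map_mx iota M.

Definition orbitH2 a (z : H2T) : set H2T :=
  [set (moebius (real_mx M) z.1, moebius (real_mx (map_mx conj M)) z.2)
     | M in Gamma a].

(* The quotient of the product of two half planes by [Gamma a], as a subset of
   [quotient_space (orbitH2 a)]. *)
Definition X a : set (set H2T) := orbitH2 a @` @HH2 R.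

(* The measure on [X a] defined by omega ^ 2. *)
Definition omega2X a : {measure set (quotient_space (orbitH2 a)) -> \bar R} :=
  quotient_measure (@omega2 R) (orbitH2 a).

Definition dual_lattice a : set 'M[K]_2 :=
  [set A : 'M[K]_2 | exists (i j : int) (l : K),
     [/\ A 0 0 = (ratr (ideal_norm a))^-1 * i%:~R,
         A 1 1 = j%:~R,
         A 1 0 = (ratr (ideal_norm a))^-1 * l,
         idealM a (idealV different) l
       & A 0 1 = conj (A 1 0)]].

Definition lattice_det a m : set 'M[K]_2 :=
  [set A : 'M[K]_2 |
    dual_lattice a A /\ \det A = m%:R / (ratr (ideal_norm a) * D%:~R)].

Definition lact M A : 'M[K]_2 := M *m A *m (map_mx conj M)^T.

(* b z1 z2 - lambda z1 - lambda' z2 + a *)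
Definition form A (z : H2T) : R[i] :=
  (iota (A 1 1))%:C * toC z.1 * toC z.2 - (iota (A 1 0))%:C * toC z.1
  - (iota (A 0 1))%:C * toC z.2 + (iota (A 0 0))%:C.

Definition g A (z : H2T) : R :=
  (complex.Re (form A z) ^+ 2 + complex.Im (form A z) ^+ 2) /
  (4 * (z.1.2 : R) * (z.2.2 : R) * iota (\det A)).

(* On the zero set of the forms, which is negligible for [omega2], the values
   are irrelevant. *)
Definition Phi a m s (z : H2T) : R[i] :=
  csum (lattice_det a m) (fun A => legendreQ s (1 + 2 * g A z)).

(* A function of [z], seen on orbits through representatives. *)
Definition on_orbits (f : H2T -> R[i]) (O : set H2T) : R[i] := f (get O).

(* Gamma'_{a, +-A} *)
Definition stab' a A : set 'M[R]_2 :=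
  [set real_mx (map_mx conj M)
     | M in [set M | Gamma a M /\ (lact M A = A \/ lact M A = - A)]].

(* Normalization: the second half plane, on which [stab' a A] acts, carries the
   form eta, which is the pullback of omega = eta_1 + eta_2 along
   [w |-> (z1, w)] for any fixed [z1].  (Along the parametrization
   [w |-> (N w, w)] of T_A, a graph of a Moebius map, omega pulls back to
   2 eta, and the integral of [Phi] would be vol / (s (s - 1)) for that volume
   in place of 2 vol / (s (s - 1)).) *)
Definition volT_A a A : \bar R := vol_quotient (stab' a A).

(* The class of [A] modulo [Gamma a] and sign. *)
Definition lclass a A : set 'M[K]_2 :=
  [set B | exists2 M, Gamma a M & B = lact M A \/ B = - lact M A].

Definition volT a m : \bar R :=
  \esum_(C in [set lclass a A | A in lattice_det a m]) volT_A a (xget 0 (C : set 'M[K]_2)).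

End hilbert_modular.

(* Main.v *)
Require Import Defs.
From HB Require Import structures.
From mathcomp Require Import all_boot all_order all_algebra all_field.
From mathcomp Require Import finmap complex.
From mathcomp Require Import all_classical all_reals all_analysis.
From mathcomp Require Import measurable_realfun ring lra zify.

(** The integral over the quotient is unfolded. A strict measurable
fundamental domain F of the group Gamma turns the integral over X(a) into an
integral over F ([Gamma_domain]), so that for a nonnegative function k the sum
over A of the integrals of k(1 + 2 g(A, z)) over F is an integral over the set
of pairs (A, z), A of the given determinant and z in F. The group acts on all
pairs (A, z), and this set of pairs is a fundamental domain for that action.
There is a second one, up to a null set: choose one A0 in each class modulo
Gamma and sign, and take the pairs (A0, z) and (-A0, z) with z = (v, w), where v
runs through the whole upper half plane and w through a fundamental domain of
the stabilizer of the pair A0, -A0 acting on the second coordinate. The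
integrand is invariant, so both domains give the same integral ([transfer],
[unfolding]). For fixed w the quantity 1 + 2 g(A0, (v, w)) is the hyperbolic
cosine of the distance from v to the unique point v0 for which (v0, w) lies on
T_A0 ([g_cosh]). Hence the integral over v depends neither on w nor on A0: it is
half the integral of k over the half line beyond 1 ([integral_cosh_g]). What is
left of the integral over w is the volume of T_A0. As omega^2 is twice the
product of eta1 and eta2, and as both signs occur, the total is twice vol(T)
times the integral of k over the half line.

For k = Q_(s-1) this last integral is 1/(s(s-1)). Put
X = u + sqrt(u^2 - 1) cosh t in the double integral over u > 1 and t > 0 and
integrate over u first: what remains is the integral over X > 1 of
X^(-s) (X - 1)/X ([integral_legendre]), that is 1/(s-1) - 1/s ([legJ_value]).

Unfolding is a statement on nonnegative functions, so it is applied to the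
positive and negative parts of the real and imaginary parts of Q_(s-1)
([integral_component]). The four results can only be subtracted if they are
finite, which requires the finiteness of vol(T) ([volT_lty]). That follows from
reduction theory. Finitely many translates of a Siegel set cover the quotient
([siegel_reduction]); only finitely many A with given determinant and bounded
denominators have a zero in a Siegel set, because such a zero bounds their
entries ([form_zero_bounds], [meets_finite]); so finitely many truncated
strips, each of finite area, contain representatives of all points of T.

Both fundamental domains exist because the two actions are discrete
([Gamma_discrete], [stab_discrete]): an orbit has finitely many points in each
of an increasing sequence of boxes, and one selects the lexicographically least
point in the first box that it meets ([measurable_section]).

The arithmetic input is that the norm of a, defined through lattice indices, is
the positive rational number that generates the product of a and its conjugate
([ideal_normP]). This describes the inverse of a, gives explicit conditions for
membership in the dual lattice ([dual_latticeP]) and shows that Gamma preserves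
that lattice ([dual_lattice_lact]). *)

Set Implicit Arguments.
Unset Strict Implicit.
Unset Printing Implicit Defensive.
Import Order.TTheory GRing.Theory Num.Theory.
Import numFieldNormedType.Exports.
Local Open Scope classical_set_scope.
Local Open Scope ring_scope.
Local Open Scope complex_scope.

(** * Quadratic fields *)

Definition ofQ (K : fieldExtType rat) : rat -> K := in_alg K.
HB.instance Definition _ K := GRing.RMorphism.copy (@ofQ K) (in_alg K).

Lemma ofQE (K : fieldExtType rat) q : ofQ K q = ratr q.
Proof. exact: alg_num_field. Qed.

Lemma ofQ_int (K : fieldExtType rat) (i : int) : ofQ K i%:~R = i%:~R.
Proof. exact: rmorph_int. Qed.

Lemma ofQ_nat (K : fieldExtType rat) (i : nat) : ofQ K i%:R = i%:R.
Proof. exact: rmorph_nat. Qed.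

Section quadratic.
Variables (K : fieldExtType rat) (conj : {rmorphism K -> K}).
Hypotheses (quadK : \dim {:K} = 2%N) (conjN1 : exists x, conj x != x).

Local Notation ofQ := (ofQ K).

Lemma conj_ofQ (q : rat) : conj (ofQ q) = ofQ q.
Proof. by rewrite ofQE fmorph_rat. Qed.

(** An element th that conjugation moves spans K together with 1, and
comparing the two images of the relation th^2 = n + t th shows that conj th is
its second root. *)
Lemma quadratic_generator : exists (th : K) (t n : rat),
  [/\ conj th != th, conj th = ofQ t - th, th * (ofQ t - th) = ofQ n &
      forall x, exists p q : rat, x = ofQ p + ofQ q * th].
Proof.
have [th thN] := conjN1.
have th1 : th \notin (1%VS : {vspace K}).
  apply: contra thN => /vlineP[q ->]; apply/eqP.
  exact: conj_ofQ.
have th0 : th != 0 by apply: contraNneq th1 => ->; exact: mem0v.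
have full : (1 + <[th]>)%VS = fullv :> {vspace K}.
  apply/eqP; rewrite eqEdim subvf quadK /= dimv_disjoint_sum ?dimv1 ?dim_vline ?th0//.
  apply/eqP; rewrite -subv0; apply/subvP => x /memv_capP[/vlineP[p ->] /vlineP[q E]].
  have [q0|q0] := eqVneq q 0; first by rewrite E q0 scale0r mem0v.
  case/negP: th1; have -> : th = q^-1 *: p%:A by rewrite E scalerA mulVf// scale1r.
  by rewrite memvZ// memvZ// mem1v.
have gen x : exists p q : rat, x = ofQ p + ofQ q * th.
  have : x \in (1 + <[th]>)%VS by rewrite full memvf.
  move=> /memv_addP[_ /vlineP[p ->] [_ /vlineP[q ->] ->]].
  by exists p, q; rewrite -[q *: th]mulr_algl; exact: erefl.
have [n' [t thE]] := gen (th ^+ 2).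
exists th, t, (- n'); split => //.
  have : conj (th ^+ 2) = ofQ n' + ofQ t * conj th.
    by rewrite thE rmorphD rmorphM /= !conj_ofQ.
  rewrite rmorphXn/= => E.
  have : (conj th - th) * (conj th - (ofQ t - th)) = 0.
    rewrite (_ : _ * _ = conj th ^+ 2 - ofQ t * conj th - (th ^+ 2 - ofQ t * th)); last by ring.
    by rewrite E thE; ring.
  by move/eqP; rewrite mulf_eq0 !subr_eq0 (negbTE thN) => /eqP.
by rewrite rmorphN mulrBr -expr2 thE; ring.
Qed.

Lemma conjK : involutive conj.
Proof.
have [th [t [n [_ thE _ gen]]]] := quadratic_generator.
move=> x; have [p [q ->]] := gen x.
by rewrite !(rmorphD, rmorphM, conj_ofQ)/= thE rmorphB conj_ofQ thE; ring.
Qed.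

Lemma conj_fixed x : conj x = x -> exists q, x = ofQ q.
Proof.
have [th [t [n [thN thE _ gen]]]] := quadratic_generator.
have [p [q ->]] := gen x; rewrite rmorphD rmorphM/= !conj_ofQ => /addrI/eqP.
rewrite -subr_eq0 -mulrBr mulf_eq0 subr_eq0 (negbTE thN) orbF => /eqP ->.
by exists p; rewrite mul0r addr0.
Qed.

Local Notation OK := (@OK K).

Lemma OK_int (i : int) : OK i%:~R.
Proof. exact: (integral_id (intr : int -> K)). Qed.

Lemma OK_nat (i : nat) : OK i%:R.
Proof. exact: (OK_int i%:Z). Qed.

Lemma OK1 : OK 1. Proof. exact: (OK_nat 1). Qed.
Lemma OK0 : OK 0. Proof. exact: (OK_nat 0). Qed.

Lemma OKD x y : OK x -> OK y -> OK (x + y).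
Proof. exact: (@integral_add _ _ (intr : int -> K)). Qed.

Lemma OKN x : OK x -> OK (- x).
Proof. exact: (@integral_opp _ _ (intr : int -> K)). Qed.

Lemma OKB x y : OK x -> OK y -> OK (x - y).
Proof. exact: (@integral_sub _ _ (intr : int -> K)). Qed.

Lemma OKM x y : OK x -> OK y -> OK (x * y).
Proof. exact: (@integral_mul _ _ (intr : int -> K)). Qed.

Lemma OK_conj x : OK x -> OK (conj x).
Proof.
move=> [p pm px]; exists p => //.
have : map_poly conj (map_poly intr p) = map_poly (intr : int -> K) p.
  by rewrite -map_poly_comp; apply: eq_map_poly => i /=; rewrite rmorph_int.
by move=> <-; rewrite fmorph_root.
Qed.

Lemma OK_rat (q : rat) : OK (ofQ q) -> exists i : int, ofQ q = i%:~R.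
Proof.
move=> [p pm].
have -> : map_poly (fun n : int => n%:~R : K) p = map_poly ofQ (map_poly intr p).
  by rewrite -map_poly_comp; apply: eq_map_poly => i /=; rewrite ofQ_int.
rewrite fmorph_root => px.
suff : (ratr q : algC) \in Num.int.
  case/intrP => i; rewrite -(ratr_int _ i) => /(fmorph_inj _) ->.
  by exists i; rewrite ofQ_int.
apply: Cint_rat_Aint; first exact: Crat_rat.
apply: (@root_monic_Aint (map_poly intr p)).
- rewrite (_ : map_poly intr p = map_poly (ratr : rat -> algC) (map_poly intr p)).
    by rewrite fmorph_root.
  by rewrite -map_poly_comp; apply: eq_map_poly => i /=; rewrite ratr_int.
- exact: monic_map.
- by apply/polyOverP => i; rewrite coef_map/= intr_int.
Qed.

(** Such an x is a root of X^2 - t X + n. *)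
Lemma OK_trace_norm x (t n : int) :
  x + conj x = t%:~R -> x * conj x = n%:~R -> OK x.
Proof.
move=> tE nE; exists ('X^2 - t%:P * 'X + n%:P).
  rewrite -addrA monicE lead_coefDl ?lead_coefXn ?monicXn// size_polyXn.
  rewrite (leq_ltn_trans (size_polyD _ _))// gtn_max size_polyN.
  rewrite (leq_ltn_trans (size_polyC_leq1 _))// andbT.
  rewrite mul_polyC (leq_ltn_trans (size_scale_leq _ _))// size_polyX//.
rewrite -[map_poly _ _]/(map_poly (intmul 1 : int -> K) _).
rewrite /root rmorphD rmorphB/= map_polyXn rmorphM/= !map_polyC map_polyX/=.
rewrite !hornerE/= -tE -nE; apply/eqP; ring.
Qed.

Lemma OK_traceP x : OK x -> exists t : int, x + conj x = t%:~R.
Proof.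
move=> Ox; have := OKD Ox (OK_conj Ox).
have [|q ->] := @conj_fixed (x + conj x); first by rewrite rmorphD /= conjK addrC.
exact: OK_rat.
Qed.

Lemma OK_normP x : OK x -> exists n : int, x * conj x = n%:~R.
Proof.
move=> Ox; have := OKM Ox (OK_conj Ox).
have [|q ->] := @conj_fixed (x * conj x); first by rewrite rmorphM /= conjK mulrC.
exact: OK_rat.
Qed.

(** A common denominator of the trace and the norm is enough, by
[OK_trace_norm]. *)
Lemma OK_denominator x : exists2 k : nat, (0 < k)%N & OK (k%:R * x).
Proof.
have rat_den (q : rat) : exists2 k : nat, (0 < k)%N & exists i : int, k%:R * q = i%:~R.
  exists `|denq q|%N; first by rewrite absz_gt0 denq_neq0.
  exists (numq q); rewrite -[X in _ * X = _]divq_num_den mulrC.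
  by rewrite pmulrn absz_denq divfK// intr_eq0 denq_neq0.
have [t tE] : exists t, x + conj x = ofQ t.
  by apply: conj_fixed; rewrite rmorphD /= conjK addrC.
have [n nE] : exists n, x * conj x = ofQ n.
  by apply: conj_fixed; rewrite rmorphM /= conjK mulrC.
have [k k0 [i iE]] := rat_den t; have [l l0 [j jE]] := rat_den n.
exists (k * l)%N; first by rewrite muln_gt0 k0.
have cE : conj ((k * l)%:R * x) = (k * l)%:R * conj x.
  by rewrite rmorphM; congr (_ * _); exact: rmorph_nat.
apply: (@OK_trace_norm _ (l%:Z * i) ((k * k * l)%N%:Z * j)).
- rewrite cE -mulrDr tE -ofQ_nat -rmorphM -ofQ_int; congr (ofQ _).
  by rewrite intrM natrM -iE -[l%:Z%:~R]/(l%:R); ring.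
- rewrite cE mulrACA nE -ofQ_nat -2!rmorphM -ofQ_int; congr (ofQ _).
  by rewrite intrM -pmulrn -jE !natrM; ring.
Qed.
End quadratic.

(** * Lattices of rank two and their indices *)

Definition subgroup (V : zmodType) (S : set V) :=
  S 0 /\ forall x y, S x -> S y -> S (x - y).

Section subgroup_lemmas.
Variables (V : zmodType) (S : set V).
Hypothesis sS : subgroup S.

Lemma subgroupN x : S x -> S (- x).
Proof. by move=> Sx; rewrite -sub0r; apply: sS.2 => //; case: sS. Qed.

Lemma subgroupD x y : S x -> S y -> S (x + y).
Proof. by move=> Sx Sy; rewrite -[y]opprK; apply: sS.2 => //; exact: subgroupN. Qed.

Lemma subgroup_mulz x (i : int) : S x -> S (x *~ i).
Proof.
move=> Sx; have H (n : nat) : S (x *+ n).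
  by elim: n => [|n IH]; [rewrite mulr0n; case: sS|rewrite mulrS; exact: subgroupD].
by case: i => n; [exact: H|rewrite NegzE mulrNz; apply: subgroupN; exact: H].
Qed.
End subgroup_lemmas.

(** Bezout, after reduction to a common denominator. The last clause says that
g is an integer combination of the list; it is stated with subgroups because
this is how the coefficients are used. *)
Lemma rat_gcd (qs : seq rat) : exists g : rat,
  [/\ 0 <= g, forall q, q \in qs -> exists i : int, q = i%:~R * g &
    forall S : set rat, subgroup S -> (forall q, q \in qs -> S q) -> S g].
Proof.
elim: qs => [|q qs [g [g0 qg Sg]]].
  by exists 0; split => // S [].
have [n1 [n2 [d [d0 qE gE]]]] : exists n1 n2 d : int,
    [/\ 0 < d, q = n1%:~R / d%:~R & g = n2%:~R / d%:~R].
  exists (numq q * denq g), (numq g * denq q), (denq q * denq g).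
  have dq : (denq q)%:~R != 0 :> rat by rewrite intr_eq0 denq_neq0.
  have dg : (denq g)%:~R != 0 :> rat by rewrite intr_eq0 denq_neq0.
  split; first by rewrite mulr_gt0 ?denq_gt0.
  - by rewrite -[LHS]divq_num_den !intrM; field; rewrite dq dg.
  - by rewrite -[LHS]divq_num_den !intrM; field; rewrite dq dg.
have d0' : d%:~R != 0 :> rat by rewrite intr_eq0 gt_eqF.
have [u [v uv]] := Bezoutz n1 n2.
exists ((gcdz n1 n2)%:~R / d%:~R); split.
- by rewrite divr_ge0// ler0z ?ltW.
- have g2 : exists i : int, g = i%:~R * ((gcdz n1 n2)%:~R / d%:~R).
    have /dvdzP[i iE] := dvdz_gcdr n1 n2.
    by exists i; rewrite gE {1}iE intrM mulrA.
  have g1 : exists i : int, q = i%:~R * ((gcdz n1 n2)%:~R / d%:~R).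
    have /dvdzP[i iE] := dvdz_gcdl n1 n2.
    by exists i; rewrite qE {1}iE intrM mulrA.
  move=> q'; rewrite inE => /predU1P[->//|/qg[i ->]].
  by have [j gj] := g2; exists (i * j); rewrite intrM -mulrA -gj.
- move=> S sS Sq.
  have Sg' : S g by apply: Sg => // q' q'S; apply: Sq; rewrite inE q'S orbT.
  have Sq' : S q by apply: Sq; rewrite inE eqxx.
  rewrite -uv intrD !intrM mulrDl -!mulrA -qE -gE.
  by apply: subgroupD => //; rewrite mulrzl; exact: subgroup_mulz.
Qed.

(** Hermite normal form. The second basis vector has the least possible
positive e2-coordinate r, the first is the least positive multiple p of e1 in
J; then the e1 i + e2 j with i < p and j < r represent the cosets. *)
Lemma plane_sublattice (V : fieldExtType rat) (e1 e2 : V) (L J : set V) (k : nat) :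
  (forall i j : int, e1 *~ i + e2 *~ j = 0 -> i = 0 /\ j = 0) ->
  (forall x, L x <-> exists i j : int, x = e1 *~ i + e2 *~ j) ->
  subgroup J -> J `<=` L -> (0 < k)%N -> J (e1 *+ k) -> J (e2 *+ k) ->
  exists p r : nat, exists q : int, [/\ (0 < p)%N, (0 < r)%N,
    forall x, J x <-> exists i j : int, x = (e1 *+ p) *~ i + (e1 *~ q + e2 *+ r) *~ j &
    index_of L J = (p * r)%N].
Proof.
move=> free LE sJ JL k0 J1 J2.
pose Pr (j : nat) := `[< (0 < j)%N /\ exists i : int, J (e1 *~ i + e2 *+ j) >].
pose Pp (j : nat) := `[< (0 < j)%N /\ J (e1 *+ j) >].
have exr : exists j, Pr j.
  by exists k; apply/asboolP; split => //; exists 0; rewrite mulr0z add0r.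
have exp : exists j, Pp j by exists k; apply/asboolP.
have [r /asboolP[r0 [q Jq]] rmin] := ex_minnP exr.
have [p /asboolP[p0 Jp] pmin] := ex_minnP exp.
have divr (i j : int) : J (e1 *~ i + e2 *~ j) -> exists s, j = s * r%:Z.
  move=> Jx; exists (divz j r); rewrite {1}(divz_eq j r).
  suff -> : modz j r = 0 by rewrite addr0.
  have m0 : 0 <= modz j r by rewrite modz_ge0// eqz_nat -lt0n.
  have mr : modz j r < r by rewrite ltz_pmod.
  case E : (modz j r) m0 mr => [t|//] _ tr.
  have [->//|t0] := posnP t.
  suff /rmin : Pr t by rewrite leqNgt ltz_nat in tr *; rewrite tr.
  apply/asboolP; split => //; exists (i - q * divz j r).
  have := sJ.2 _ _ Jx (subgroup_mulz sJ (divz j r) Jq).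
  congr J; rewrite {1}(divz_eq j r) E mulrzBr mulrzDr mulrzDl -!mulrzA.
  by rewrite -[e2 *+ r]/(e2 *~ r) -mulrzA [r%:Z * _]mulrC -[e2 *+ t]/(e2 *~ t)
    opprD addrACA [_ + e2 *~ t]addrC addrK.
have divp (i : int) : J (e1 *~ i) -> exists s, i = s * p%:Z.
  move=> Jx; exists (divz i p); rewrite {1}(divz_eq i p).
  suff -> : modz i p = 0 by rewrite addr0.
  have m0 : 0 <= modz i p by rewrite modz_ge0// eqz_nat -lt0n.
  have mr : modz i p < p by rewrite ltz_pmod.
  case E : (modz i p) m0 mr => [t|//] _ tr.
  have [->//|t0] := posnP t.
  suff /pmin : Pp t by rewrite leqNgt ltz_nat in tr *; rewrite tr.
  apply/asboolP; split => //.
  have := sJ.2 _ _ Jx (subgroup_mulz sJ (divz i p) Jp).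
  congr J; rewrite {1}(divz_eq i p) E mulrzDr.
  by rewrite -[e1 *+ p]/(e1 *~ p) -mulrzA [p%:Z * _]mulrC addrAC subrr add0r.
(* Division with remainder, first of j by r and then of the e1-coordinate by
   p. *)
have reduce i j : exists (s t : int) (i' : 'I_p) (j' : 'I_r), e1 *~ i + e2 *~ j =
    (e1 *+ p) *~ s + (e1 *~ q + e2 *+ r) *~ t + (e1 *+ i' + e2 *+ j').
  pose t := divz j r; pose i1 := i - q * t; pose s := divz i1 p.
  have [i' i'E] : exists i' : 'I_p, modz i1 p = i' :> int.
    have m0 : 0 <= modz i1 p by rewrite modz_ge0// eqz_nat -lt0n.
    have mr : modz i1 p < p by rewrite ltz_pmod.
    by case: (modz i1 p) m0 mr => [u|//] _ up; exists (Ordinal up).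
  have [j' j'E] : exists j' : 'I_r, modz j r = j' :> int.
    have m0 : 0 <= modz j r by rewrite modz_ge0// eqz_nat -lt0n.
    have mr : modz j r < r by rewrite ltz_pmod.
    by case: (modz j r) m0 mr => [u|//] _ up; exists (Ordinal up).
  exists s, t, i', j'.
  have iE : i = p%:Z * s + q * t + i' by rewrite [p%:Z * s]mulrC addrAC -i'E -divz_eq subrK.
  have jE : j = r%:Z * t + j' by rewrite mulrC -j'E -divz_eq.
  rewrite iE jE !pmulrn !mulrzDr -!mulrzA mulrzDl -!mulrzA.
  by rewrite [LHS]addrACA !addrA [_ + _ + e2 *~ _]addrAC.
have unique (i i' : 'I_p) (j j' : 'I_r) :
    J ((e1 *+ i + e2 *+ j) - (e1 *+ i' + e2 *+ j')) -> (i, j) = (i', j').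
  rewrite !pmulrn opprD addrACA -!mulrzBr => Jx.
  have [s sE] := divr _ _ Jx.
  have jj : j = j'.
    apply/val_inj/eqP; rewrite -eqz_nat -subr_eq0 sE.
    suff -> : s = 0 by rewrite mul0r.
    have := ltn_ord j; have := ltn_ord j'; move: sE.
    by have := r0; case: s => [[|s]|s]; nia.
  rewrite jj subrr mulr0z addr0 in Jx.
  have [s' s'E] := divp _ Jx.
  suff -> : i = i' by rewrite jj.
  apply/val_inj/eqP; rewrite -eqz_nat -subr_eq0 s'E.
  suff -> : s' = 0 by rewrite mul0r.
  have := ltn_ord i; have := ltn_ord i'; move: s'E.
  by have := p0; case: s' => [[|s']|s']; nia.
have Jcomb (s t : int) : J ((e1 *+ p) *~ s + (e1 *~ q + e2 *+ r) *~ t).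
  by apply: subgroupD => //; exact: subgroup_mulz.
have Lcomb i j : L (e1 *+ i + e2 *+ j) by apply/LE; exists i%:Z, j%:Z.
exists p, r, q; split => //.
- move=> x; split; last by move=> [i [j ->]].
  move=> Jx; have /LE[i [j xE]] := JL _ Jx.
  have [s [t [i' [j' E]]]] := reduce i j; exists s, t.
  have p1 : (0 < p)%N by []; have r1 : (0 < r)%N by [].
  suff ij : (i', j') = (Ordinal p1, Ordinal r1).
    by move: E; case: ij => -> ->; rewrite !mulr0n !addr0 xE.
  apply: unique; rewrite /= !mulr0n addr0 subr0.
  have := sJ.2 _ _ Jx (Jcomb s t); rewrite xE E.
  by rewrite addrC addKr.
- pose F (c : 'I_p * 'I_r) := [set (e1 *+ c.1 + e2 *+ c.2) + y | y in J].
  have FI : injective F.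
    move=> [i j] [i' j'] FF; apply: unique.
    have : F (i, j) (e1 *+ i + e2 *+ j) by exists 0; rewrite ?addr0//; case: sJ.
    by rewrite FF => -[y Jy <-]; rewrite /= addrAC subrr add0r.
  rewrite /index_of; have -> : cosets L J = F @` [set: 'I_p * 'I_r].
    apply/seteqP; split => [_ [x /LE[i [j ->]] <-]|_ [[i j] _ <-]].
      have [s [t [i' [j' ->]]]] := reduce i j; exists (i', j') => //.
      apply/seteqP; split => [_ [y Jy <-]|_ [y Jy <-]].
        exists (y - ((e1 *+ p) *~ s + (e1 *~ q + e2 *+ r) *~ t)); first exact: sJ.2.
        by rewrite addrC addrA subrK addrC.
      exists ((e1 *+ p) *~ s + (e1 *~ q + e2 *+ r) *~ t + y); first exact: subgroupD.
      by rewrite addrA; congr (_ + _); rewrite addrC.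
    by exists (e1 *+ i + e2 *+ j).
  rewrite (_ : fset_set _ = [fset F x | x in {: 'I_p * 'I_r}]%fset).
    by rewrite card_imfset//= -cardE card_prod !card_ord.
  have Ffin : finite_set (range F) by apply: finite_image; exact: finite_finset.
  apply/fsetP => c; rewrite in_fset_set//.
  apply/idP/imfsetP => [|[x _ ->]]; rewrite inE; last by exists x.
  by move=> [x _ <-]; exists x.
Qed.

(** * Ideals and their norms *)

Section ideals.
Variables (K : fieldExtType rat) (conj : {rmorphism K -> K}).
Hypotheses (quadK : \dim {:K} = 2%N) (conjN1 : exists x, conj x != x).
Variables (b1 b2 : K).
Hypothesis ib : integral_basis b1 b2.
Local Notation ofQ := (ofQ K).
Local Notation OK := (@OK K).
Let conjK : involutive conj := conjK quadK conjN1.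
Let conj_fixed := @conj_fixed K conj quadK conjN1.

(** The determinant of the matrix of x, y and their conjugates. For a basis of
a lattice it is, up to sign, the covolume; for an integral basis its square is
the discriminant. *)
Definition wedge (x y : K) : K := x * conj y - y * conj x.
Local Notation delta := (wedge b1 b2).

Lemma conj_wedge x y : conj (wedge x y) = - wedge x y.
Proof. by rewrite /wedge rmorphB/= !rmorphM/= !conjK; ring. Qed.

Lemma wedge_comb e1 e2 (i j k l : int) :
  wedge (e1 *~ i + e2 *~ j) (e1 *~ k + e2 *~ l) = wedge e1 e2 *~ (i * l - j * k).
Proof.
rewrite -(mulrzr e1 i) -(mulrzr e2 j) -(mulrzr e1 k) -(mulrzr e2 l).
rewrite -(mulrzr (wedge e1 e2)) intrB !intrM /wedge.
by rewrite !(rmorphD conj)/= !(rmorphM conj)/= !(rmorph_int conj); ring.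
Qed.

Lemma natrK_eq0 (n : nat) : (n%:R == 0 :> K) = (n == 0)%N.
Proof. by rewrite -ofQ_nat fmorph_eq0 pnatr_eq0. Qed.

Lemma intrK_eq0 (n : int) : (n%:~R == 0 :> K) = (n == 0).
Proof. by rewrite -ofQ_int fmorph_eq0 intr_eq0. Qed.

Lemma delta_neq0 : delta != 0.
Proof.
have [_ _ _ fr] := ib.
have b10 : b1 != 0.
  apply/eqP => b10; have [|/eqP] := fr 1 0; last by [].
  by rewrite b10 mul0rz mulr0z addr0.
apply/eqP => /eqP; rewrite subr_eq0 => /eqP E.
have [q qE] : exists q, b2 / b1 = ofQ q.
  have cb1 : conj b1 != 0 by rewrite fmorph_eq0.
  by apply: conj_fixed; rewrite fmorph_div/=; apply/(mulIf b10)/(mulIf cb1);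
    rewrite divfK// [LHS]mulrAC divfK// mulrC E.
have := fr (numq q) (- denq q) => -[|_ /eqP]; last by rewrite oppr_eq0 (negbTE (denq_neq0 q)).
have -> : b2 = ofQ q * b1 by rewrite -qE divfK.
rewrite -(mulrzr b1) -(mulrzr (_ * b1)) intrN -!ofQ_int.
have -> : ofQ (numq q)%:~R = ofQ q * ofQ (denq q)%:~R.
  by rewrite -rmorphM -{2}[q]divq_num_den divfK// intr_eq0 denq_neq0.
by ring.
Qed.

Lemma wedge_OK x y : OK x -> OK y -> exists i : int, wedge x y = delta *~ i.
Proof.
have [_ _ gen _] := ib.
move=> /gen[i [j ->]] /gen[k [l ->]]; rewrite wedge_comb.
by exists (i * l - j * k).
Qed.

(** Up to sign this is the wedge of 1 and y. *)
Lemma diff_conj_OK y : OK y -> exists i : int, y - conj y = delta *~ i.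
Proof.
move=> Oy; have [i iE] := wedge_OK (OK1 K) Oy.
by exists (- i); rewrite mulrNz -iE /wedge rmorph1; ring.
Qed.

Lemma OK_subgroup : subgroup OK.
Proof. by split; [exact: OK0|exact: OKB]. Qed.

(** The conjugate of an integral multiple of c, with the sign of its norm. *)
Lemma OK_multiple c : c != 0 -> exists (y : K) (n : nat),
  [/\ OK y, (0 < n)%N & y * c = n%:R].
Proof.
move=> c0; have [k k0 Okc] := OK_denominator quadK conjN1 c.
have [n nE] := OK_normP quadK conjN1 Okc.
have kc0 : k%:R * c != 0 by rewrite mulf_neq0// natrK_eq0 -lt0n.
have n0 : n != 0.
  by rewrite -intrK_eq0 -nE mulf_neq0// fmorph_eq0.
exists ((sgz n)%:~R * (k%:R * conj (k%:R * c))), `|n|%N; split.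
- apply: OKM; first exact: OK_int.
  by apply: OKM; [exact: OK_nat|exact: OK_conj].
- by rewrite absz_gt0.
- transitivity ((sgz n)%:~R * ((k%:R * c) * conj (k%:R * c)) : K); first by ring.
  by rewrite nE -intrM -abszEsg pmulrn.
Qed.

(** The product of a finitely generated ideal and its conjugate is generated
by a rational number g, the greatest common divisor of the norms of the
generators and of the traces of the products u conj v. Indeed u conj v / g
then has integral trace and norm, and conversely norms and traces lie in the
product ideal. *)
Lemma ideal_conj_gcd (us : seq K) : has (fun u => u != 0) us ->
  exists2 g : rat, 0 < g &
    (forall u v, u \in us -> v \in us -> OK (u * conj v / ofQ g)) /\
    (forall S : set K, subgroup S ->
      (forall u v, u \in us -> v \in us -> S (u * conj v)) -> S (ofQ g)).
Proof.
move=> us0.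
have trX x : exists q, x + conj x = ofQ q.
  by apply: conj_fixed; rewrite rmorphD/= conjK addrC.
have nmX x : exists q, x * conj x = ofQ q.
  by apply: conj_fixed; rewrite rmorphM/= conjK mulrC.
have [tr trE] := boolp.choice trX; have [nm nmE] := boolp.choice nmX.
pose qs := [seq nm u | u <- us] ++ [seq tr (u * conj v) | u <- us, v <- us].
have [g [g0 qg Sg]] := rat_gcd qs.
have nmg u : u \in us -> exists i : int, nm u = i%:~R * g.
  by move=> uus; apply: qg; rewrite mem_cat map_f.
have trg u v : u \in us -> v \in us -> exists i : int, tr (u * conj v) = i%:~R * g.
  by move=> uus vus; apply: qg; rewrite mem_cat; apply/orP; right; apply/allpairsP; exists (u, v).
have gn0 : g != 0.
  have /hasP[u uus u0] := us0; have [i iE] := nmg _ uus.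
  apply: contra u0 => /eqP g0'; rewrite g0' mulr0 in iE.
  by have /eqP := nmE u; rewrite iE rmorph0 mulf_eq0 fmorph_eq0 orbb.
exists g; first by rewrite lt0r gn0.
have gn0' : ofQ g != 0 by rewrite fmorph_eq0.
split.
- move=> u v uus vus.
  have [i iE] := trg _ _ uus vus; have [j jE] := nmg _ uus; have [k kE] := nmg _ vus.
  apply: (@OK_trace_norm _ conj _ i (j * k)).
  + by rewrite fmorph_div/= conj_ofQ -mulrDl trE iE rmorphM/= mulfK// ofQ_int.
  + rewrite fmorph_div/= conj_ofQ intrM -!ofQ_int.
    rewrite (_ : j%:~R = nm u / g); last by rewrite jE mulfK.
    rewrite (_ : k%:~R = nm v / g); last by rewrite kE mulfK.
    by rewrite !fmorph_div/= -!nmE rmorphM/= conjK; field.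
- move=> S sS Suv; pose T := [set q | S (ofQ q)].
  apply: (Sg T).
    split; first by rewrite /T/= rmorph0; case: sS.
    by move=> x y; rewrite /T/= rmorphB/=; exact: sS.2.
  move=> q; rewrite mem_cat => /orP[/mapP[u uus ->]|/allpairsP[[u v]/= [uus vus ->]]].
    by rewrite /T/= -nmE; exact: Suv.
  rewrite /T/= -trE; apply: subgroupD => //; first exact: Suv.
  by rewrite rmorphM/= conjK mulrC; exact: Suv.
Qed.

Section ideal.
Variable a : set K.
Hypothesis ida : fractional_ideal a.

Lemma ideal_subgroup : subgroup a.
Proof.
have [[x ax _] aB aM _] := ida; split => //.
by rewrite -(mul0r x); apply: aM => //; exact: OK0.
Qed.

Lemma idealZ c x : OK c -> a x -> a (c * x).
Proof. by have [_ _ + _] := ida; apply. Qed.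

Lemma ideal_denom : exists2 n : nat, (0 < n)%N & forall x, a x -> OK (n%:R * x).
Proof.
have [_ _ _ [c c0 cP]] := ida; have [y [n [Oy n0 yc]]] := OK_multiple c0.
by exists n => // x ax; rewrite -yc -mulrA; apply: OKM => //; exact: cP.
Qed.

Lemma ideal_nat : exists2 n : nat, (0 < n)%N & a n%:R.
Proof.
have [[x ax x0] _ aM _] := ida; have [y [n [Oy n0 yx]]] := OK_multiple x0.
by exists n => //; rewrite -yx; exact: aM.
Qed.

Definition Zbasis (L : set K) (e1 e2 : K) :=
  (forall x, L x <-> exists i j : int, x = e1 *~ i + e2 *~ j) /\
  (forall i j : int, e1 *~ i + e2 *~ j = 0 -> i = 0 /\ j = 0).

Lemma wedge_free e1 e2 (i j : int) : wedge e1 e2 != 0 ->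
  e1 *~ i + e2 *~ j = 0 -> i = 0 /\ j = 0.
Proof.
move=> w0 E.
have H k l : wedge e1 e2 *~ (i * l - j * k) = 0.
  by rewrite -wedge_comb E /wedge rmorph0 mul0r mulr0 subr0.
have mz (z : int) : wedge e1 e2 *~ z = 0 -> z = 0.
  by move/eqP; rewrite -mulrzr mulf_eq0 (negbTE w0) intrK_eq0 => /eqP.
by have := mz _ (H 0 1); have := mz _ (H 1 0); lia.
Qed.

(** The two bases are related by an integer matrix of determinant 1 or -1. *)
Lemma Zbasis_wedge L e1 e2 f1 f2 : Zbasis L e1 e2 -> Zbasis L f1 f2 ->
  wedge e1 e2 != 0 -> wedge f1 f2 = wedge e1 e2 \/ wedge f1 f2 = - wedge e1 e2.
Proof.
move=> [eL _] [fL _] w0.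
have Lf1 : L f1 by apply/fL; exists 1, 0; rewrite mulr1z mulr0z addr0.
have Lf2 : L f2 by apply/fL; exists 0, 1; rewrite mulr1z mulr0z add0r.
have Le1 : L e1 by apply/eL; exists 1, 0; rewrite mulr1z mulr0z addr0.
have Le2 : L e2 by apply/eL; exists 0, 1; rewrite mulr1z mulr0z add0r.
have [i [j f1E]] := (eL _).1 Lf1; have [k [l f2E]] := (eL _).1 Lf2.
have [i' [j' e1E]] := (fL _).1 Le1; have [k' [l' e2E]] := (fL _).1 Le2.
have W1 : wedge f1 f2 = wedge e1 e2 *~ (i * l - j * k).
  by rewrite {1}f1E {1}f2E wedge_comb.
have W2 : wedge e1 e2 = wedge f1 f2 *~ (i' * l' - j' * k').
  by rewrite {1}e1E {1}e2E wedge_comb.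
move: W1 W2; set u := _ - _; set v := _ - _ => W1 W2.
have uv : u * v = 1.
  apply/eqP; rewrite -subr_eq0 -intrK_eq0 intrB intrM.
  apply/eqP; apply: (mulfI w0); rewrite mulr0 mulrBr mulr1 mulrA.
  by rewrite !mulrzr -W1 -W2 subrr.
have : u = 1 \/ u = - 1.
  move/(congr1 absz): uv; rewrite abszM => /eqP; rewrite muln_eq1 => /andP[/eqP + _].
  by move=> u1; case: (u) u1 => [[|[|]]|[|]]//; [left|right].
by case=> uE; rewrite W1 uE ?mulr1z; [left|right; rewrite mulrNz mulr1z].
Qed.

Lemma OK_Zbasis : Zbasis OK b1 b2.
Proof.
have [Ob1 Ob2 gen fr] := ib; split => // x; split; first exact: gen.
by move=> [i [j ->]]; apply: subgroupD; try exact: OK_subgroup;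
  apply: subgroup_mulz => //; exact: OK_subgroup.
Qed.

(** The index of a sublattice is the ratio of the covolumes; both are p r in
the notation of [plane_sublattice]. *)
Lemma sublattice_index L e1 e2 J (k : nat) : Zbasis L e1 e2 -> wedge e1 e2 != 0 ->
  subgroup J -> J `<=` L -> (0 < k)%N -> (forall x, L x -> J (k%:R * x)) ->
  exists f1 f2 : K, [/\ Zbasis J f1 f2, (0 < index_of L J)%N &
    wedge f1 f2 = (index_of L J)%:R * wedge e1 e2].
Proof.
move=> [eL free] w0 sJ JL k0 kLJ.
have Le1 : L e1 by apply/eL; exists 1, 0; rewrite mulr1z mulr0z addr0.
have Le2 : L e2 by apply/eL; exists 0, 1; rewrite mulr1z mulr0z add0r.
have J1 : J (e1 *+ k) by rewrite -mulr_natl; exact: kLJ.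
have J2 : J (e2 *+ k) by rewrite -mulr_natl; exact: kLJ.
have [p [r [q [p0 r0 Jb idx]]]] := plane_sublattice free eL sJ JL k0 J1 J2.
exists (e1 *+ p), (e1 *~ q + e2 *+ r).
have WE : wedge (e1 *+ p) (e1 *~ q + e2 *+ r) = (index_of L J)%:R * wedge e1 e2.
  have := wedge_comb e1 e2 p 0 q r; rewrite mulr0z addr0 mul0r subr0 => ->.
  by rewrite idx mulr_natl pmulrn.
rewrite idx muln_gt0 p0 r0; split => //; last by rewrite WE idx.
split => // i j; apply: wedge_free; rewrite WE idx mulf_neq0// natrK_eq0.
by rewrite -lt0n muln_gt0 p0.
Qed.

(** A multiple of a is a sublattice of finite index of the ring of integers.
*)
Lemma ideal_basis : exists e1 e2 : K, Zbasis a e1 e2 /\ wedge e1 e2 != 0.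
Proof.
have [n n0 nP] := ideal_denom; have [m m0 mP] := ideal_nat.
pose J := [set x | exists2 y, a y & x = n%:R * y].
have [sa0 saB] := ideal_subgroup.
have nn : n%:R != 0 :> K by rewrite natrK_eq0 -lt0n.
have [f1 [f2 [[fJ fr] i0 wE]]] : exists f1 f2 : K, [/\ Zbasis J f1 f2,
    (0 < index_of OK J)%N & wedge f1 f2 = (index_of OK J)%:R * delta].
  apply: (sublattice_index (k := n * m)) OK_Zbasis delta_neq0 _ _ _ _.
  - split; first by exists 0; rewrite ?mulr0.
    by move=> _ _ [x ax ->] [y ay ->]; exists (x - y); [exact: saB|rewrite mulrBr].
  - by move=> _ [y ay ->]; exact: nP.
  - by rewrite muln_gt0 n0.
  - move=> x Ox; exists (m%:R * x); last by rewrite natrM mulrA.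
    by rewrite mulrC; exact: idealZ.
exists (f1 / n%:R), (f2 / n%:R).
have w0 : wedge (f1 / n%:R) (f2 / n%:R) != 0.
  have -> : wedge (f1 / n%:R) (f2 / n%:R) = wedge f1 f2 / n%:R ^+ 2.
    by rewrite /wedge !fmorph_div/= rmorph_nat; field.
  by rewrite wE !mulf_neq0// ?invr_neq0 ?expf_neq0 ?delta_neq0// natrK_eq0 -lt0n.
split => //; split; last by move=> i j; exact: wedge_free.
move=> x; split.
- move=> ax; have /fJ[i [j E]] : J (n%:R * x) by exists x.
  exists i, j; apply: (mulfI nn); rewrite E -(mulrzr f1) -(mulrzr f2) -(mulrzr (f1 / _)) -(mulrzr (f2 / _)).
  by field.
- move=> [i [j xE]]; have [y ay yE] : J (n%:R * x).
    by apply/fJ; exists i, j; rewrite xE -(mulrzr f1) -(mulrzr f2) -(mulrzr (f1 / _)) -(mulrzr (f2 / _)); field.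
  by rewrite (mulfI nn yE).
Qed.

Local Notation N := (ofQ (ideal_norm a)).

(** Let e1, e2 be a basis of a and g the generator of the product of a and its
conjugate. The ring of integers has the basis 1, conj e1 e2 / g, since g is a
combination of the products of e1, e2 with their conjugates. Hence e1, e2 have
wedge g delta up to sign, and comparing the indices of OK and a over their
intersection identifies g with the norm. *)
Lemma ideal_normP : [/\ 0 < ideal_norm a,
  forall x y, a x -> a y -> OK (x * conj y / N) &
  forall S : set K, subgroup S -> (forall x y, a x -> a y -> S (x * conj y)) -> S N].
Proof.
have [e1 [e2 [ab w0]]] := ideal_basis; have [eL free] := ab.
have Le1 : a e1 by apply/eL; exists 1, 0; rewrite mulr1z mulr0z addr0.
have Le2 : a e2 by apply/eL; exists 0, 1; rewrite mulr1z mulr0z add0r.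
have us0 : has (fun u => u != 0) [:: e1; e2].
  rewrite /= orbF -negb_and; apply: contra w0 => /andP[/eqP-> /eqP->].
  by rewrite /wedge mul0r subrr.
have [g g0 [gO gS]] := ideal_conj_gcd us0.
suff Ng : ideal_norm a = g.
  rewrite Ng; split => //.
  - move=> x y /eL[i [j ->]] /eL[k [l ->]].
    rewrite rmorphD/= !rmorphMz mulrDl !mulrDr !mulrDl.
    have sO := OK_subgroup.
    have H u v (s t : int) : u \in [:: e1; e2] -> v \in [:: e1; e2] ->
        OK (u *~ s * (conj v *~ t) / ofQ g).
      move=> uS vS; rewrite -(mulrzr u) -(mulrzr (conj v)).
      rewrite (_ : _ / _ = s%:~R * t%:~R * (u * conj v / ofQ g)); last by ring.
      by rewrite -intrM; apply: OKM; [exact: OK_int|exact: gO].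
    by do ![apply: subgroupD => //]; apply: H; rewrite !inE eqxx ?orbT.
  - by move=> S sS Sxy; apply: gS => // u v; rewrite !inE;
      move=> /orP[]/eqP-> /orP[]/eqP->; exact: Sxy.
have gn0 : ofQ g != 0 by rewrite fmorph_eq0 gt_eqF.
pose om := conj e1 * e2 / ofQ g.
have wom : wedge 1 om = wedge e1 e2 / ofQ g.
  by rewrite /wedge rmorph1 /om fmorph_div/= conj_ofQ rmorphM/= conjK; field.
have wom0 : wedge 1 om != 0 by rewrite wom mulf_neq0// invr_neq0.
have e1s : e1 \in [:: e1; e2] by rewrite inE eqxx.
have e2s : e2 \in [:: e1; e2] by rewrite !inE eqxx orbT.
have omO : OK om by rewrite /om [conj e1 * _]mulrC; exact: gO.
have om1 : Zbasis OK 1 om.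
  split; last by move=> i j; exact: wedge_free.
  have sO := OK_subgroup.
  move=> x; split; last first.
    by move=> [i [j ->]]; apply: subgroupD => //; apply: subgroup_mulz => //; exact: OK1.
  move=> Ox; pose M := [set w : K | exists i j : int, w = 1 *~ i + om *~ j].
  have sM : subgroup M.
    split; first by exists 0, 0; rewrite !mulr0z addr0.
    move=> _ _ [i [j ->]] [k [l ->]]; exists (i - k), (j - l).
    by rewrite !mulrzBr opprD addrACA.
  have M1 : M 1 by exists 1, 0; rewrite mulr0z addr0.
  have Mom : M om by exists 0, 1; rewrite mulr0z add0r.
  have Mg u v : u \in [:: e1; e2] -> v \in [:: e1; e2] -> M (u * conj v / ofQ g).
    have Mnorm u' : u' \in [:: e1; e2] -> M (u' * conj u' / ofQ g).
      move=> us; have := gO _ _ us us.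
      have [|q ->] := @conj_fixed (u' * conj u' / ofQ g).
        by rewrite fmorph_div/= conj_ofQ rmorphM/= conjK [conj u' * _]mulrC.
      by move=> /OK_rat[i ->]; exact: subgroup_mulz.
    have Mom' : M (conj om).
      have [t tE] := OK_traceP quadK conjN1 omO.
      have -> : conj om = t%:~R - om by rewrite -tE addrC addKr.
      by apply: sM.2 => //; exact: subgroup_mulz.
    have om'E : conj om = e1 * conj e2 / ofQ g.
      by rewrite /om fmorph_div/= conj_ofQ rmorphM/= conjK.
    rewrite !inE => /orP[]/eqP-> /orP[]/eqP->; try exact: Mnorm.
      by rewrite -om'E.
    by rewrite [e2 * _]mulrC.
  pose S := [set w : K | M (w * x / ofQ g)].
  suff : S (ofQ g) by rewrite /S/= mulrAC divff// mul1r.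
  apply: gS.
    split; first by rewrite /S/= !mul0r; case: sM.
    by move=> w w'; rewrite /S/= !mulrBl; exact: sM.2.
  move=> u v us vs; rewrite /S/=.
  have : a (x * u).
    by apply: idealZ => //; move: us; rewrite !inE => /orP[]/eqP->.
  move=> /eL[i [j xu]].
  have -> : u * conj v * x / ofQ g =
      (e1 * conj v / ofQ g) *~ i + (e2 * conj v / ofQ g) *~ j.
    rewrite -!mulrzAl -!mulrDl -xu; ring.
  by apply: subgroupD => //; apply: subgroup_mulz => //; apply: Mg.
have wd : wedge e1 e2 = ofQ g * delta \/ wedge e1 e2 = - (ofQ g * delta).
  have -> : wedge e1 e2 = ofQ g * wedge 1 om by rewrite wom mulrC divfK.
  have [->|->] := Zbasis_wedge OK_Zbasis om1 delta_neq0; first by left.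
  by right; rewrite mulrN.
(* Both OK and a contain their intersection J with finite index; compare the
   two expressions for the wedge of a basis of J. *)
have [n n0 nP] := ideal_denom; have [k k0 kP] := ideal_nat.
pose J := OK `&` a.
have sJ : subgroup J.
  have [sa0 saB] := ideal_subgroup; have [sO0 sOB] := OK_subgroup.
  by split => // x y [Ox ax] [Oy ay]; split; [exact: sOB|exact: saB].
have [f1 [f2 [fJ i1 fE]]] : exists f1 f2 : K, [/\ Zbasis J f1 f2,
    (0 < index_of OK J)%N & wedge f1 f2 = (index_of OK J)%:R * delta].
  apply: (sublattice_index (k := k)) OK_Zbasis delta_neq0 sJ _ _ _ => //.
    by move=> x [].
  move=> x Ox; split; first by apply: OKM => //; exact: OK_nat.
  by rewrite mulrC; exact: idealZ.
have [h1 [h2 [hJ i2 hE]]] : exists f1 f2 : K, [/\ Zbasis J f1 f2,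
    (0 < index_of a J)%N & wedge f1 f2 = (index_of a J)%:R * wedge e1 e2].
  apply: (sublattice_index (k := n)) ab w0 sJ _ _ _ => //.
    by move=> x [].
  move=> x ax; split; first exact: nP.
  by apply: idealZ => //; exact: OK_nat.
have i2n : (index_of a J)%:R != 0 :> K by rewrite natrK_eq0 -lt0n.
rewrite /ideal_norm -/J.
have wf0 : wedge f1 f2 != 0.
  by rewrite fE mulf_neq0 ?delta_neq0// natrK_eq0 -lt0n.
have E : (index_of OK J)%:R = g * (index_of a J)%:R \/
         (index_of OK J)%:R = - (g * (index_of a J)%:R) :> rat.
  have inj (x y : rat) : ofQ x * delta = ofQ y * delta -> x = y.
    by move=> /(mulIf delta_neq0)/fmorph_inj.
  have := Zbasis_wedge fJ hJ wf0; rewrite fE hE.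
  by case: wd => -> [] H; [left|right|right|left]; apply: inj;
    rewrite ?rmorphN !rmorphM/= !ofQ_nat; first [rewrite -[LHS]opprK -[in LHS]H; ring|rewrite -H; ring].
have i2q : (0 : rat) < (index_of a J)%:R by rewrite ltr0n.
(* The negative sign is excluded because indices are positive. *)
case: E => E; first by rewrite E mulfK// gt_eqF.
have : (0 : rat) < (index_of OK J)%:R by rewrite ltr0n.
by rewrite E oppr_gt0 pmulr_llt0// ltNge ltW.
Qed.
End ideal.
End ideals.

(** * The dual lattice and the action of the group on it *)

Lemma mulmx2E (F : comPzRingType) (M A : 'M[F]_2) i j :
  (M *m A) i j = M i 0 * A 0 j + M i 1 * A 1 j.
Proof.
rewrite mxE !big_ord_recl big_ord0 addr0.
by congr (_ * _ + _ * _); [congr (M i _)|congr (A _ j)]; apply/val_inj.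
Qed.

Lemma det2E (F : comPzRingType) (M : 'M[F]_2) :
  \det M = M 0 0 * M 1 1 - M 0 1 * M 1 0.
Proof.
rewrite (expand_det_row _ 0) !big_ord_recl big_ord0 addr0 /cofactor !det_mx11 !mxE/=.
have -> : lift 0 0 = 1 :> 'I_2 by exact/val_inj.
have -> : lift 1 0 = 0 :> 'I_2 by exact/val_inj.
by rewrite /bump/= expr0 expr1 mul1r mulN1r mulrN.
Qed.

Lemma eq_mx2 (F : Type) (A B : 'M[F]_2) : A 0 0 = B 0 0 -> A 0 1 = B 0 1 ->
  A 1 0 = B 1 0 -> A 1 1 = B 1 1 -> A = B.
Proof.
move=> E00 E01 E10 E11; apply/matrixP => i j.
have o2 (k : 'I_2) : k = 0 \/ k = 1.
  by case: k => [[|[|]]]//= ?; [left|right]; apply/val_inj.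
by have [->|->] := o2 i; have [->|->] := o2 j.
Qed.

Definition adj2 (F : pzRingType) (M : 'M[F]_2) : 'M[F]_2 :=
  \matrix_(i, j) if i == 0 then if j == 0 then M 1 1 else - M 0 1
                 else if j == 0 then - M 1 0 else M 0 0.

Lemma adj2E (F : pzRingType) (M : 'M[F]_2) : [/\ adj2 M 0 0 = M 1 1,
  adj2 M 0 1 = - M 0 1, adj2 M 1 0 = - M 1 0 & adj2 M 1 1 = M 0 0].
Proof. by split; rewrite mxE. Qed.

Lemma mul_adj2 (F : comPzRingType) (M : 'M[F]_2) : M *m adj2 M = (\det M)%:M.
Proof.
have [E00 E01 E10 E11] := adj2E M.
by apply: eq_mx2; rewrite mulmx2E !mxE /= ?E00 ?E01 ?E10 ?E11 ?mulr1n ?mulr0n ?det2E; ring.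
Qed.

Lemma adj2_mul (F : comPzRingType) (M : 'M[F]_2) : adj2 M *m M = (\det M)%:M.
Proof.
have [E00 E01 E10 E11] := adj2E M.
by apply: eq_mx2; rewrite mulmx2E !mxE /= ?E00 ?E01 ?E10 ?E11 ?mulr1n ?mulr0n ?det2E; ring.
Qed.

Section lattice_action.
Variables (R : realType) (K : fieldExtType rat).
Variables (iota : {rmorphism K -> R}) (conj : {rmorphism K -> K}) (D : int).
Hypotheses (quadK : \dim {:K} = 2%N) (conjN1 : exists x, conj x != x).
Variables (b1 b2 : K).
Hypotheses (ib : integral_basis b1 b2)
  (DE : D%:~R = (b1 * conj b2 - b2 * conj b1) ^+ 2).
Variable a : set K.
Hypothesis ida : fractional_ideal a.
Local Notation ofQ := (ofQ K).
Local Notation OK := (@OK K).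
Local Notation delta := (wedge conj b1 b2).
Local Notation N := (ofQ (ideal_norm a)).
Let conjK : involutive conj := conjK quadK conjN1.
Let conj_fixed := @conj_fixed K conj quadK conjN1.
Let sa : subgroup a := ideal_subgroup ida.
Let d0 : delta != 0 := delta_neq0 quadK conjN1 ib.
Let conj_delta : conj delta = - delta := conj_wedge quadK conjN1 b1 b2.

Lemma norm_neq0 : N != 0.
Proof.
by have [/gt_eqF N0 _ _] := ideal_normP quadK conjN1 ib ida; rewrite fmorph_eq0 N0.
Qed.

(** The norm is a combination of products x conj y with x, y in a, so z itself
is a combination of the elements (z conj y / N) x of a. *)
Lemma mem_ideal z : (forall v, a v -> OK (z * conj v / N)) -> a z.
Proof.
move=> H; have [_ _ NS] := ideal_normP quadK conjN1 ib ida.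
pose S := [set w | a (z * w / N)].
suff : S N by rewrite /S/= mulfK ?norm_neq0.
apply: NS.
  split; first by rewrite /S/= mulr0 mul0r; case: sa.
  by move=> x y; rewrite /S/= mulrBr mulrBl; exact: sa.2.
move=> x y ax ay; rewrite /S/=.
rewrite (_ : _ / _ = (z * conj y / N) * x); last by ring.
by apply: idealZ => //; exact: H.
Qed.

(** The inverse of a is its conjugate divided by its norm. *)
Lemma idealVP x : idealV a x <-> a (N * conj x).
Proof.
have [_ NO _] := ideal_normP quadK conjN1 ib ida.
have N0 := norm_neq0; split.
  move=> H; apply: mem_ideal => v av.
  rewrite (_ : _ / _ = conj (x * v)); last first.
    by rewrite (rmorphM conj)/= -(mulrA N) [N * _]mulrC mulfK.
  by apply: OK_conj; exact: H.
move=> H v av; have := OK_conj conj (NO _ _ H av).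
have : conj N = N by rewrite conj_ofQ.
move: (ofQ _) N0 => n n0 nE.
rewrite fmorph_div/= !(rmorphM conj)/= !conjK nE.
by rewrite (_ : _ / _ = x * v)//; field.
Qed.

Lemma OK_delta : OK delta.
Proof.
have [Ob1 Ob2 _ _] := ib.
by apply: OKB; apply: OKM => //; exact: OK_conj.
Qed.

(** The sign depends on the order of the integral basis. *)
Lemma iota_delta : iota delta = Num.sqrt D%:~R \/ iota delta = - Num.sqrt D%:~R.
Proof.
have E : (D%:~R : R) = iota delta ^+ 2.
  by rewrite -rmorphXn -(rmorph_int iota) DE.
rewrite E sqrtr_sqr; have [d1|d1] := leP 0 (iota delta).
  by left; rewrite ger0_norm.
by right; rewrite ltr0_norm// opprK.
Qed.

Lemma disc_gt0 : 0 < (D%:~R : R).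
Proof.
by rewrite -(rmorph_int iota) DE rmorphXn exprn_even_gt0//= fmorph_eq0.
Qed.

Lemma inverse_different x : idealV (different iota D) x <-> OK (delta * x).
Proof.
split.
  move=> H; rewrite mulrC.
  have [dE|dE] := iota_delta.
    by apply: H; exists 1; [exact: OK1|rewrite rmorph1 mulr1].
  rewrite -[delta]opprK mulrN; apply: OKN; apply: H; exists 1; first exact: OK1.
  by rewrite rmorph1 mulr1 rmorphN dE opprK.
move=> Odx y [z Oz yE].
have [dE|dE] := iota_delta.
  have -> : y = delta * z by apply: (fmorph_inj iota); rewrite yE rmorphM dE.
  by rewrite mulrCA mulrA; apply: OKM.
have -> : y = - (delta * z).
  by apply: (fmorph_inj iota); rewrite yE rmorphN rmorphM dE mulNr opprK.
by rewrite mulrN; apply: OKN; rewrite mulrCA mulrA; apply: OKM.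
Qed.

Lemma ideal_div_different l :
  idealM a (idealV (different iota D)) l <-> a (delta * l).
Proof.
split; last first.
  move=> adl; exists [:: (delta * l, delta^-1)]; last first.
    by rewrite big_seq1 /= mulrAC divff// mul1r.
  move=> q; rewrite inE => /eqP->; split => //=.
  by apply/inverse_different; rewrite divff//; exact: OK1.
move=> [u uP ->]; elim: u uP => [|q u IH] uP.
  by rewrite big_nil mulr0; case: sa.
rewrite big_cons mulrDr; apply: subgroupD => //; last first.
  by apply: IH => q' q'u; apply: uP; rewrite inE q'u orbT.
have [|aq1 /inverse_different Oq2] := uP q; first by rewrite inE eqxx.
by rewrite mulrCA mulrC; apply: idealZ.
Qed.

Definition is_int (x : K) := exists i : int, x = i%:~R.

Lemma is_intP x : OK x -> conj x = x -> is_int x.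
Proof. by move=> Ox /conj_fixed[q qE]; rewrite qE in Ox *; exact: OK_rat. Qed.

Lemma dual_latticeP A : dual_lattice iota conj D a A <->
  [/\ is_int (N * A 0 0), is_int (A 1 1), a (delta * (N * A 1 0)) & A 0 1 = conj (A 1 0)].
Proof.
have N0 := norm_neq0; rewrite /dual_lattice/= -ofQE; split.
  move=> [i [j [l [E00 E11 E10 /ideal_div_different al E01]]]].
  by split => //; [exists i; rewrite E00 mulVKf|exists j|rewrite E10 mulVKf].
move=> [[i iE] [j jE] al E01]; exists i, j, (N * A 1 0); split => //.
- by rewrite -iE mulKf.
- by rewrite mulKf.
- exact/ideal_div_different.
Qed.

Lemma GammaM M1 M2 : Gamma a M1 -> Gamma a M2 -> Gamma a (M1 *m M2).
Proof.
have sV : forall x y, idealV a x -> idealV a y -> idealV a (x + y).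
  by move=> x y Hx Hy v av; rewrite mulrDl; apply: OKD; [exact: Hx|exact: Hy].
have OV : forall c x, OK c -> idealV a x -> idealV a (c * x).
  by move=> c x Oc Hx v av; rewrite -mulrA; apply: OKM => //; exact: Hx.
move=> [A1 B1 C1 D1 d1] [A2 B2 C2 D2 d2]; split; rewrite ?mulmx2E.
- by apply: OKD; [exact: OKM|exact: B1].
- by apply: sV; [exact: OV|rewrite mulrC; exact: OV].
- by apply: subgroupD => //; [rewrite mulrC|]; exact: idealZ.
- by apply: OKD; [rewrite mulrC; exact: B2|exact: OKM].
- by rewrite det_mulmx d1 d2 mulr1.
Qed.

Lemma Gamma1 : Gamma a 1%:M.
Proof.
split; rewrite ?mxE/= ?det1//; try exact: OK1.
- by move=> v _; rewrite mul0r; exact: OK0.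
- by case: sa.
Qed.

Lemma GammaV M : Gamma a M -> Gamma a (adj2 M).
Proof.
move=> [A1 B1 C1 D1 d1].
have [E00 E01 E10 E11] := adj2E M.
split; rewrite ?E00 ?E01 ?E10 ?E11//.
- by move=> v av; rewrite mulNr; apply: OKN; exact: B1.
- exact: subgroupN.
- by rewrite det2E E00 E01 E10 E11 mulrNN mulrC -det2E.
Qed.

Lemma lactE M A i j : lact conj M A i j =
  (M i 0 * A 0 0 + M i 1 * A 1 0) * conj (M j 0) +
  (M i 0 * A 0 1 + M i 1 * A 1 1) * conj (M j 1).
Proof. by rewrite /lact mulmx2E !mulmx2E !mxE. Qed.

Lemma lact_mul M1 M2 A : lact conj (M1 *m M2) A = lact conj M1 (lact conj M2 A).
Proof. by rewrite /lact map_mxM trmx_mul !mulmxA. Qed.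

Lemma lact1 A : lact conj 1%:M A = A.
Proof. by rewrite /lact map_mx1 trmx1 mulmx1 mul1mx. Qed.

Lemma lactN M A : lact conj M (- A) = - lact conj M A.
Proof. by rewrite /lact mulmxN mulNmx. Qed.

Lemma lact_oppl M A : lact conj (- M) A = lact conj M A.
Proof. by rewrite /lact map_mxN linearN/= mulmxN !mulNmx opprK. Qed.

Lemma det_lact M A : \det M = 1 -> \det (lact conj M A) = \det A.
Proof.
by move=> d1; rewrite /lact !det_mulmx det_tr det_map_mx d1 rmorph1 mul1r mulr1.
Qed.

(** Expanding M A conj(M)^T, the diagonal entries of A contribute integral
elements. The off-diagonal ones contribute to the diagonal a trace t + conj t
in which delta t is integral, and such a trace is an integer by
[diff_conj_OK]. *)
Lemma dual_lattice_lact M A : Gamma a M -> dual_lattice iota conj D a A ->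
  dual_lattice iota conj D a (lact conj M A).
Proof.
move=> [Oal Vbe aga Ode _] /dual_latticeP[[i iE] [j jE] aw E01].
have [_ NO _] := ideal_normP quadK conjN1 ib ida.
have N0 := norm_neq0.
have cA00 : conj (A 0 0) = A 0 0.
  have -> : A 0 0 = i%:~R / N by rewrite -iE mulrAC divff// mul1r.
  by rewrite fmorph_div/= conj_ofQ rmorph_int.
have cA11 : conj (A 1 1) = A 1 1 by rewrite jE rmorph_int.
have cA01 : conj (A 0 1) = A 1 0 by rewrite E01 conjK.
have aNb : a (N * conj (M 0 1)) by apply/idealVP.
have ONbb : OK (M 0 1 * (N * conj (M 0 1))) by apply: Vbe.
have OA11 : OK (A 1 1) by rewrite jE; exact: OK_int.
have ONA00 : OK (N * A 0 0) by rewrite iE; exact: OK_int.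
have tr_int t : OK (delta * t) -> OK (t + conj t).
  move=> Ot; have [k kE] := diff_conj_OK conj ib Ot.
  suff -> : t + conj t = k%:~R by exact: OK_int.
  apply: (mulfI d0); rewrite mulrDr.
  by move: kE; rewrite rmorphM/= conj_delta mulNr opprK => ->; rewrite mulrzr.
apply/dual_latticeP; rewrite !lactE E01.
have Vinv be : idealV a be -> a (N * conj be) by move=> /idealVP.
have cN : conj N = N by rewrite conj_ofQ.
move: (M 0 0) (M 0 1) (M 1 0) (M 1 1) Oal Vbe aga Ode ONbb aNb {Vinv} =>
  al be ga de Oal Vbe aga Ode ONbb aNb.
move: (ofQ _) N0 cN NO iE aw ONbb aNb ONA00 cA00 => n n0 cN NO iE aw ONbb aNb ONA00 cA00.
set w := delta * (n * A 1 0) in aw *.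
split.
- apply: is_intP.
    rewrite (_ : n * _ = al * conj al * (n * A 0 0) +
       be * (n * conj be) * A 1 1 +
       (n * (conj al * be * A 1 0) + conj (n * (conj al * be * A 1 0)))); last first.
      by rewrite !(rmorphM conj)/= conjK cN; ring.
    apply: OKD; first apply: OKD.
    + by apply: OKM => //; apply: OKM => //; exact: OK_conj.
    + exact: OKM.
    + apply: tr_int.
      rewrite (_ : _ * _ = conj al * (be * w)); last by rewrite /w; ring.
      by apply: OKM; [exact: OK_conj|exact: Vbe].
  by rewrite !(rmorphM conj, rmorphD conj)/= !conjK cN cA00 cA11; ring.
- apply: is_intP.
    rewrite (_ : _ + _ = ga * conj ga / n * (n * A 0 0) + de * conj de * A 1 1 +
       (conj ga * de * A 1 0 + conj (conj ga * de * A 1 0))); last first.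
      by rewrite !(rmorphM conj)/= conjK; field.
    apply: OKD; first apply: OKD.
    + by apply: OKM => //; exact: NO.
    + by apply: OKM => //; apply: OKM => //; exact: OK_conj.
    + apply: tr_int.
      rewrite (_ : _ * _ = de * (w * conj ga / n)); last first.
        by rewrite /w; field.
      by apply: OKM => //; exact: NO.
  by rewrite !(rmorphM conj, rmorphD conj)/= !conjK cA00 cA11; ring.
- rewrite (_ : _ * _ = delta * conj al * (n * A 0 0) * ga
      - conj (be * w) * ga + de * conj al * w
      + delta * de * A 1 1 * (n * conj be)); last first.
    by rewrite /w !(rmorphM conj)/= conj_delta cN; ring.
  have Od := OK_delta; have Oal' := OK_conj conj Oal.
  apply: subgroupD => //; first apply: subgroupD => //; first apply: sa.2.
  + by apply: idealZ => //; do ![apply: OKM => //].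
  + by apply: idealZ => //; apply: OK_conj; exact: Vbe.
  + by apply: idealZ => //; exact: OKM.
  + by apply: idealZ => //; do ![apply: OKM => //].
- by rewrite !(rmorphM conj, rmorphD conj)/= !conjK cA00 cA11; ring.
Qed.

Lemma dual_latticeN A : dual_lattice iota conj D a A -> dual_lattice iota conj D a (- A).
Proof.
move=> /dual_latticeP[[i iE] [j jE] aw E01]; apply/dual_latticeP; rewrite !mxE; split.
- by exists (- i); rewrite mulrN iE rmorphN.
- by exists (- j); rewrite jE rmorphN.
- by rewrite !mulrN; exact: subgroupN.
- by rewrite E01 rmorphN.
Qed.

Lemma lattice_det_lact m M A : Gamma a M -> lattice_det iota conj D a m A ->
  lattice_det iota conj D a m (lact conj M A).
Proof.
move=> GM [LA dA]; split; first exact: dual_lattice_lact.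
by have [_ _ _ _ d1] := GM; rewrite det_lact.
Qed.

Lemma lattice_detN m A : lattice_det iota conj D a m A ->
  lattice_det iota conj D a m (- A).
Proof.
move=> [LA dA]; split; first exact: dual_latticeN.
by rewrite -dA !det2E !mxE !mulrNN.
Qed.

Lemma lattice_det_gt0 m A : (0 < m)%N -> lattice_det iota conj D a m A ->
  0 < iota (\det A).
Proof.
move=> m0 [_ ->]; rewrite fmorph_div rmorphM rmorph_nat rmorph_int fmorph_rat.
rewrite divr_gt0 ?ltr0n// mulr_gt0 ?disc_gt0// ltr0q.
by have [] := ideal_normP quadK conjN1 ib ida.
Qed.
End lattice_action.

(** * Integration on the real line *)

Section density_integral.
Context d (T : measurableType d) (R : realType).
Variables (mu : {measure set T -> \bar R}) (f : T -> R).
Variables (f0 : forall x, 0 <= f x) (mf : measurable_fun setT f).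
Local Open Scope ereal_scope.
Import HBNNSimple.

Lemma ge0_integral_density (D : set T) (g : T -> \bar R) : measurable D ->
  measurable_fun setT g -> (forall x, 0 <= g x) ->
  \int[density_measure mu f0 mf]_(x in D) g x =
  \int[mu]_(x in D) (g x * (f x)%:E).
Proof.
move=> mD mg g0; set nu := density_measure mu f0 mf.
pose h := nnsfun_approx measurableT mg.
have hg x : (EFin \o h n) x @[n --> \oo] --> g x.
  by apply: cvg_nnsfun_approx => //.
have mh n : measurable_fun D (EFin \o h n).
  by apply/measurable_EFinP; apply: measurable_funTS; exact/measurable_funP.
transitivity (limn (fun n => \int[nu]_(x in D) (EFin \o h n) x)).
  rewrite -monotone_convergence//.
  - by apply: eq_integral => x _; apply/esym/cvg_lim.
  - by move=> n x _; rewrite lee_fin.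
  - by move=> x _ m n mn; rewrite lee_fin; exact/lefP/nd_nnsfun_approx.
have mfE : measurable_fun D (EFin \o f).
  by apply/measurable_EFinP; exact: measurable_funTS.
rewrite [RHS](_ : _ =
    limn (fun n => \int[mu]_(x in D) ((EFin \o h n) x * (f x)%:E))); last first.
  rewrite -monotone_convergence//.
  - apply: eq_integral => x _; apply/esym/cvg_lim => //.
    by apply: cvgeZr => //; exact: hg.
  - by move=> n; exact: emeasurable_funM.
  - by move=> n x _; rewrite mule_ge0// lee_fin.
  - move=> x _ m n mn; rewrite lee_pmul// ?lee_fin//.
    exact/lefP/nd_nnsfun_approx.
congr (limn _); apply/funext => n /=.
have mk k : measurable (h n @^-1` [set k]).
  by apply: measurable_sfunP.
transitivity (\sum_(k \in range (h n))
    \int[nu]_(x in D) (k * \1_(h n @^-1` [set k]) x)%:E).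
  under eq_integral do rewrite /= fimfunE -fsumEFin//.
  rewrite ge0_integral_fsum//.
  - by move=> y; apply/measurable_EFinP/measurable_funM => //.
  - by move=> y x _; rewrite EFinM nnfun_muleindic_ge0.
transitivity (\sum_(k \in range (h n))
    \int[mu]_(x in D) ((k * \1_(h n @^-1` [set k]) x)%:E * (f x)%:E)); last first.
  rewrite -ge0_integral_fsum//.
  - apply: eq_integral => x _ /=.
    rewrite [in RHS]fimfunE -fsumEFin// ge0_mule_fsuml// => y.
    by rewrite EFinM nnfun_muleindic_ge0.
  - move=> y; apply: emeasurable_funM => //.
    by apply/measurable_EFinP/measurable_funM => //.
  - by move=> y x _; rewrite mule_ge0 ?lee_fin // -lee_fin EFinM nnfun_muleindic_ge0.
apply: eq_fsbigr => r; rewrite inE => -[x0 _ hr].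
have r0 : (0 <= r)%R by rewrite -hr.
rewrite (_ : \int[nu]_(x in D) _ =
    \int[nu]_(x in D) (r%:E * (EFin \o \1_(h n @^-1` [set r])) x)); last first.
  by apply: eq_integral => x _; rewrite EFinM.
rewrite ge0_integralZl//; last 2 first.
- by apply/measurable_EFinP; exact: measurable_indic.
- by move=> ? _; rewrite lee_fin.
rewrite (_ : \int[mu]_(x in D) _ =
  \int[mu]_(x in D) (r%:E * (fun x => (\1_(h n @^-1` [set r]) x)%:E * (f x)%:E) x));
  last by apply: eq_integral => x _; rewrite EFinM muleA.
rewrite [RHS]ge0_integralZl//; last 2 first.
- apply: emeasurable_funM => //; apply/measurable_EFinP; exact: measurable_indic.
- by move=> ? _; rewrite mule_ge0// lee_fin.
congr (_ * _); rewrite integral_indic//.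
transitivity (\int[mu]_(x in (h n @^-1` [set r]) `&` D) (f x)%:E) => //.
rewrite setIC integral_mkcondr; apply: eq_integral => y _.
rewrite patchE indicE; case: ifPn => _; by rewrite ?mul1e ?mul0e.
Qed.
End density_integral.

Lemma ge0_integral_mrestr d (T : measurableType d) (R : realType)
    (mu : {measure set T -> \bar R}) (D : set T) (mD : measurable D)
    (f : T -> \bar R) : measurable_fun setT f -> (forall x, 0 <= f x)%E ->
  (\int[mrestr mu mD]_x f x = \int[mu]_(x in D) f x)%E.
Proof.
move=> mf f0.
have N0 : mrestr mu mD (~` D) = 0%E by rewrite /mrestr/= setICl measure0.
have mN : measurable (~` D) by exact: measurableC.
rewrite (ge0_negligible_integral mN _ _ _ N0)//.
rewrite setDE setTI setCK; apply: eq_measure_integral => A mA AD.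
by rewrite /= /mrestr; congr (mu _); apply/setIidPl.
Qed.

Section change_of_variable.
Variable R : realType.
Local Open Scope ereal_scope.
Local Notation leb := (@lebesgue_measure R).

(** The inverse psi is part of the data, so that nothing about monotone
functions and their ranges has to be derived; phi maps the whole line onto J,
and other domains are reached through [ge0_integral_exp]. *)
Lemma ge0_integral_subst (phi psi dphi : R -> R) (J : set R) (f : R -> \bar R) :
  (forall x, is_derive x (1%R : R) phi (dphi x)) -> continuous dphi ->
  (forall x, 0 < dphi x)%R ->
  measurable J -> measurable_fun setT psi ->
  (forall x, J (phi x)) -> cancel phi psi -> {in J, cancel psi phi} ->
  measurable_fun setT f -> (forall x, 0 <= f x) ->
  \int[leb]_(y in J) f y = \int[leb]_x (f (phi x) * (dphi x)%:E).
Proof.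
move=> dphiP cd d0 mJ mpsi Jphi phiK psiK mf f0.
have md : measurable_fun setT dphi by exact: continuous_measurable_fun.
have cphi : continuous phi.
  by move=> x; apply: differentiable_continuous; apply/derivable1_diffP;
     have [] := dphiP x.
have mphi : measurable_fun setT phi by exact: continuous_measurable_fun.
have d0' x : (0 <= dphi x)%R by exact: ltW.
have FTC a b : (a < b)%R ->
    \int[leb]_(x in `]a, b]) (dphi x)%:E = (phi b - phi a)%:E.
  move=> ab; rewrite integral_itv_obnd_cbnd; last first.
    by apply/measurable_EFinP; exact: measurable_funTS.
  rewrite EFinB; apply: continuous_FTC2 => //.
  - exact: continuous_subspaceT.
  - split.
    + by move=> x _; have [] := dphiP x.
    + by apply: cvg_at_right_filter; exact: cphi.
    + by apply: cvg_at_left_filter; exact: cphi.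
  - by move=> x _; rewrite derive1E derive_val.
have iphi : {homo phi : x y / (x < y)%R}.
  move=> x y xy.
  have [|c _ E] := MVT xy (fun z _ => dphiP z); first exact: continuous_subspaceT.
  by rewrite -subr_gt0 E mulr_gt0// subr_gt0.
have mphile : {mono phi : x y / (x < y)%R}.
  by apply: leW_mono; apply: le_mono.
pose m2 : {measure set (measurableTypeR R) -> \bar R} := density_measure leb d0' md.
pose m1 : {measure set (measurableTypeR R) -> \bar R} :=
  measure_function_pushforward__canonical__measure_function_Measure
    (mrestr leb mJ) (mpsi : measurable_fun _ (psi : measurableTypeR R -> measurableTypeR R)).
have m1E A : measurable A -> m1 A = m2 A.
  move: A; apply: (@measure_unique _ R (measurableTypeR R) (@ocitv R)
    (fun n => `](- n%:R)%R, n%:R]%classic) _ _ _ _ m1 m2) => //.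
  - exact: ocitvI.
  - by move=> i; exact: is_ocitv.
  - apply/seteqP; split => // x _.
    have [n xn] : exists n, (`|x| < n%:R)%R.
      by exists (Num.bound `|x|%R); rewrite archi_boundP.
    exists n => //=; rewrite in_itv/=.
    by move: xn; rewrite ltr_norml => /andP[-> /ltW].
  - move=> X [[a b] _ <-]/=; rewrite /m1 /m2 /pushforward /mrestr/=.
    have [ba|ab] := leP b a.
      rewrite set_itv_ge -?leNgt// preimage_set0 set0I measure0.
      by rewrite /density_measure integral_set0.
    rewrite /density_measure FTC//.
    rewrite (_ : _ `&` J = `]phi a, phi b]%classic); last first.
      apply/seteqP; split => y /=; rewrite !in_itv/=.
      + move=> [/andP[ay yb] Jy].
        by rewrite -(psiK y) ?inE// mphile leNgt mphile -leNgt ay.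
      + move=> /andP[ay yb].
        have [||c _ cy] := @IVT _ phi a b y (ltW ab) _ _.
        - exact: continuous_subspaceT.
        - by rewrite ge_min le_max (ltW ay) yb orbT.
        have ac : (a < c)%R by rewrite -mphile cy.
        have cb : (c <= b)%R by rewrite leNgt -mphile cy -leNgt.
        by rewrite -cy phiK ac cb.
    by rewrite lebesgue_measure_itv/= lte_fin mphile ab -EFinD.
  - move=> k.
    have le1 : m1 `](- k%:R)%R, (k%:R)%R]%classic <=
               leb `](phi (- k%:R)%R), (phi (k%:R)%R)]%classic.
      rewrite /m1/= /pushforward /mrestr; apply: le_measure; rewrite ?inE//.
        apply: measurableI => //; rewrite -[X in measurable X]setTI.
        exact: (mpsi measurableT).
      move=> y [/= + Jy]; rewrite !in_itv/= => /andP[ay yb].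
      by rewrite -(psiK y) ?inE// mphile leNgt mphile -leNgt ay.
    apply: le_lt_trans le1 _.
    by rewrite lebesgue_measure_itv/=; case: ifP => // _; rewrite -EFinD ltry.
have mphi1 : measurable_fun setT (f \o phi) by exact: measurableT_comp.
transitivity (\int[m2]_x (f (phi x))).
  rewrite -[RHS](eq_measure_integral m2 (m1 := m1)) => [|A mA _]; last exact: m1E.
  rewrite ge0_integral_pushforward//= preimage_setT.
  rewrite ge0_integral_mrestr//; last first.
    by apply: measurableT_comp => //; exact: measurableT_comp.
  by apply: eq_integral => y yJ /=; rewrite psiK.
by rewrite ge0_integral_density.
Qed.
End change_of_variable.

Lemma measurable_invr (R : realType) : measurable_fun setT (@GRing.inv R).
Proof.
rewrite (_ : @GRing.inv R = fun x : R => x * (x ^+ 2) `^ (-1)).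
  apply: measurable_funM => //.
  by apply: (measurableT_comp (measurable_powR _)); exact: measurable_funX.
apply/funext => x; rewrite powR_inv1 ?sqr_ge0// expr2.
have [->|x0] := eqVneq x 0; first by rewrite invr0 mul0r.
by rewrite invfM mulrA divff// mul1r.
Qed.

Lemma measurable_sqrtr (R : realType) : measurable_fun setT (@Num.sqrt R).
Proof. by apply: continuous_measurable_fun; exact: sqrt_continuous. Qed.

Ltac mreal := repeat first
  [ exact: measurable_cst | exact: measurable_id
  | exact: measurable_fst | exact: measurable_snd
  | exact: measurable_expR | exact: measurable_ln
  | apply: measurable_funD | apply: measurable_funB | apply: measurable_funM
  | apply: measurable_funX
  | apply: (measurableT_comp (@measurable_invr _))
  | apply: (measurableT_comp (@measurable_expR _))
  | apply: (measurableT_comp (@measurable_ln _))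
  | apply: (measurableT_comp (@measurable_sqrtr _))
  | apply: measurableT_comp measurable_fst
  | apply: measurableT_comp measurable_snd
  | apply: measurable_funN ].

Section real_line.
Variable R : realType.
Local Notation leb := (@lebesgue_measure R).
Local Open Scope ereal_scope.
Implicit Type f : R -> \bar R.

Lemma ge0_integral_affine f (c t : R) : (0 < c)%R ->
  measurable_fun setT f -> (forall x, 0 <= f x) ->
  \int[leb]_x f x = \int[leb]_x (f (c * x + t)%R * c%:E).
Proof.
move=> c0 mf f0.
apply: (@ge0_integral_subst _ _ (fun x => c^-1 * (x - t))%R (fun=> c)) => //.
- move=> x; have -> : (fun x => c * x + t)%R = (c *: (id : R -> R) + cst t)%R.
    by apply/funext.
  by apply: is_derive_eq; rewrite addr0 /GRing.scale/= mulr1.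
- by move=> x; exact: cst_continuous.
- by mreal.
- by move=> x; rewrite addrK mulKf// gt_eqF.
- by move=> x _; rewrite mulVKf ?gt_eqF// subrK.
Qed.

Lemma ge0_integral_shift f (t : R) :
  measurable_fun setT f -> (forall x, 0 <= f x) ->
  \int[leb]_x f x = \int[leb]_x f (x + t)%R.
Proof.
move=> mf f0; rewrite (@ge0_integral_affine _ 1 t)//.
by apply: eq_integral => x _; rewrite mul1r mule1.
Qed.

Lemma ge0_integral_opp f :
  measurable_fun setT f -> (forall x, 0 <= f x) ->
  \int[leb]_x f x = \int[leb]_x f (- x)%R.
Proof.
move=> mf f0.
transitivity (\int[pushforward leb (-%R : _ -> measurableTypeR R)]_x f x).
  by apply: eq_measure_integral => A mA _; exact/esym/lebesgue_measureN.
by rewrite ge0_integral_pushforward.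
Qed.

Lemma ge0_integral_exp f :
  measurable_fun setT f -> (forall x, 0 <= f x) ->
  \int[leb]_(x in `]0%R, +oo[) f x = \int[leb]_x (f (expR x) * (expR x)%:E).
Proof.
move=> mf f0; apply: (@ge0_integral_subst _ _ (@ln R)) => //.
- exact: continuous_expR.
- exact: expR_gt0.
- by move=> x /=; rewrite in_itv/= expR_gt0.
- by move=> x; rewrite expRK.
- by move=> x; rewrite inE/= in_itv/= andbT => x0; rewrite lnK.
Qed.

End real_line.

(** * The hyperbolic area in polar coordinates *)

Section upper_half_plane.
Variable R : realType.
Local Notation leb := (@lebesgue_measure R).
Local Notation RR := (measurableTypeR R).
Local Open Scope ereal_scope.
Implicit Type f : RR * RR -> \bar R.

(** Under x = e^r t, y = e^r the measure dx dy / y^2 becomes dr dt. In these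
coordinates dilations and translations of the upper half plane are shifts of r
and t, so invariance of the area reduces to invariance of Lebesgue measure. *)
Definition polar_int f := \int[leb]_r \int[leb]_t f (expR r * t, expR r)%R.

Let mpair (h1 h2 : RR * RR -> R) f :
  measurable_fun setT f -> measurable_fun setT h1 -> measurable_fun setT h2 ->
  measurable_fun setT (fun p => f (h1 p, h2 p)).
Proof. by move=> mf m1 m2; apply: measurableT_comp => //; exact: measurable_fun_pair. Qed.

Lemma integral_eta f : measurable_fun setT f -> (forall p, 0 <= f p) ->
  \int[@Defs.eta R]_(p in @HH R) f p = ((4 * pi)^-1)%R%:E * polar_int f.
Proof.
move=> mf f0.
have mHH : measurable (@HH R).
  rewrite (_ : @HH R = snd @^-1` `]0%R, +oo[%classic).
    by rewrite -[X in measurable X]setTI; exact: measurable_snd.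
  by apply/seteqP; split => p; rewrite /HH/= in_itv/= andbT.
rewrite ge0_integral_density// integral_mkcond.
pose F p := f p * (eta_density p)%:E * (\1_(@HH R) p)%:E.
have eta0 := @eta_density_ge0 R.
have mF : measurable_fun setT F.
  apply: emeasurable_funM; last by apply/measurable_EFinP; exact: measurable_indic.
  by apply: emeasurable_funM => //; apply/measurable_EFinP; exact: measurable_eta_density.
have F0 p : 0 <= F p by rewrite !mule_ge0// lee_fin.
transitivity (\int[(leb \x leb)]_p F p).
  apply: eq_integral => p _; rewrite patchE /F indicE; case: ifPn => _.
    by rewrite mule1.
  by rewrite mule0.
rewrite fubini_tonelli2//.
transitivity (\int[leb]_(y in `]0%R, +oo[) \int[leb]_x (f (x, y) * (eta_density (x, y))%:E)).
  rewrite [RHS]integral_mkcond; apply: eq_integral => y _; rewrite patchE.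
  case: ifPn => yP.
    apply: eq_integral => x _; rewrite /F indicE mem_set ?mule1//.
    by move: yP; rewrite inE/= in_itv/= andbT.
  rewrite /fubini_G integral0_eq// => x _; rewrite /F indicE memNset ?mule0//.
  by move: yP; rewrite notin_setE/= in_itv/= andbT.
have mf2 : measurable_fun setT (fun p : RR * RR => f p * (eta_density p)%:E).
  by apply: emeasurable_funM => //; apply/measurable_EFinP; exact: measurable_eta_density.
rewrite ge0_integral_exp; last 2 first.
- apply: (measurable_fun_fubini_tonelli_G (m1 := leb) (fun p => f p * (eta_density p)%:E)) => //.
  by move=> p; rewrite mule_ge0// lee_fin.
- by move=> y; apply: integral_ge0 => x _; rewrite mule_ge0// lee_fin.
rewrite /polar_int -ge0_integralZl//; last 3 first.
- apply: (measurable_fun_fubini_tonelli_F (m2 := leb)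
    (fun p : RR * RR => f (expR p.1 * p.2, expR p.1)%R)) => //.
  by apply: mpair => //; mreal.
- by move=> r _; exact: integral_ge0.
- by rewrite lee_fin invr_ge0 mulr_ge0// pi_ge0.
apply: eq_integral => r _.
(* Jacobian: dx = e^r dt and dy = e^r dr, against 1/y^2 = e^(-2r). *)
rewrite (@ge0_integral_affine _ _ (expR r) 0) ?expR_gt0//; last 2 first.
- apply: (measurableT_comp mf2); apply: measurable_fun_pair => //.
- by move=> x; rewrite mule_ge0// lee_fin.
have mfr : measurable_fun setT (fun t : RR => f (expR r * t, expR r)%R).
  by apply: (measurableT_comp mf); apply: measurable_fun_pair => //; mreal.
rewrite -ge0_integralZr ?lee_fin ?expR_ge0//; last 2 first.
- apply: emeasurable_funM => //; apply: emeasurable_funM => //.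
  + by under eq_fun do rewrite addr0.
  + apply/measurable_EFinP; apply: (measurableT_comp (@measurable_eta_density R)).
    by apply: measurable_fun_pair => //; mreal.
- by move=> x _; rewrite !mule_ge0 ?lee_fin ?expR_ge0.
rewrite -ge0_integralZl ?lee_fin ?invr_ge0 ?mulr_ge0// ?pi_ge0//.
apply: eq_integral => t _; rewrite addr0 -!muleA -!EFinM muleC.
congr (_ * _); congr EFin; rewrite /eta_density/=.
have := pi_gt0 R; have := expR_gt0 r; move: (expR r) pi => e p /gt_eqF e0 /gt_eqF p0.
by field; rewrite e0 p0.
Qed.

Lemma polar_int_affine f (c t : R) : (0 < c)%R ->
  measurable_fun setT f -> (forall p, 0 <= f p) ->
  polar_int (fun p => f (c * p.1 + t, c * p.2)%R) = polar_int f.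
Proof.
move=> c0 mf f0; rewrite /polar_int.
pose G r := \int[leb]_u f (expR r * u, expR r)%R.
have mG : measurable_fun setT G.
  apply: (measurable_fun_fubini_tonelli_F (m2 := leb)
    (fun p : RR * RR => f (expR p.1 * p.2, expR p.1)%R)) => //.
  by apply: mpair => //; mreal.
rewrite [RHS](@ge0_integral_shift _ G (ln c))//; last first.
  by move=> r; exact: integral_ge0.
apply: eq_integral => r _; rewrite /G expRD lnK//.
rewrite [RHS](@ge0_integral_shift _ _ (t / (expR r * c))%R)//; last first.
  by apply: (measurableT_comp mf); apply: measurable_fun_pair => //; mreal.
apply: eq_integral => u _ /=.
have := expR_gt0 r; move: (expR r) => e /gt_eqF/negbT e0.
have /negbT c1 := gt_eqF c0.
by congr f; congr pair; field; rewrite ?e0 ?c1.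
Qed.

(** The inversion -1/z is the substitution of - t for t and of - r - ln (1 +
t^2) for r; the second is, for fixed t, a reflection followed by a shift. *)
Lemma polar_int_inversion f :
  measurable_fun setT f -> (forall p, 0 <= f p) ->
  polar_int (fun p => f (- p.1 / (p.1 ^+ 2 + p.2 ^+ 2), p.2 / (p.1 ^+ 2 + p.2 ^+ 2))%R)
  = polar_int f.
Proof.
move=> mf f0; rewrite /polar_int.
rewrite (fubini_tonelli (m1 := leb) (m2 := leb) (fun p : RR * RR =>
  f (- (expR p.1 * p.2) / ((expR p.1 * p.2) ^+ 2 + expR p.1 ^+ 2),
     expR p.1 / ((expR p.1 * p.2) ^+ 2 + expR p.1 ^+ 2))%R))//; last first.
  by apply: mpair => //; mreal.
rewrite (fubini_tonelli (m1 := leb) (m2 := leb) (fun p : RR * RR =>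
  f (expR p.1 * p.2, expR p.1)%R))//; last first.
  by apply: mpair => //; mreal.
rewrite [RHS]ge0_integral_opp; last 2 first.
- apply: (measurable_fun_fubini_tonelli_G (m1 := leb)
    (fun p : RR * RR => f (expR p.1 * p.2, expR p.1)%R)) => //.
  by apply: mpair => //; mreal.
- by move=> y; exact: integral_ge0.
apply: eq_integral => t _.
have t1 : (0 < 1 + t ^+ 2)%R by rewrite ltr_pwDl// sqr_ge0.
have mt : measurable_fun setT (fun x : R => f (expR x * - t, expR x)%R).
  by apply: (measurableT_comp mf); apply: measurable_fun_pair => //; mreal.
rewrite [RHS]ge0_integral_opp//.
rewrite [RHS](@ge0_integral_shift _ _ (ln (1 + t ^+ 2)))//; last first.
  by apply: (measurableT_comp mt); mreal.
apply: eq_integral => r _; rewrite opprD expRD !expRN lnK//.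
have := gt_eqF (expR_gt0 r); move: (expR r) => e /negbT e0.
have /negbT t0 := gt_eqF t1.
by rewrite /=; congr f; congr pair; field; rewrite ?e0/= ?t0 //=;
  apply: contra_neq (mulf_neq0 (mulf_neq0 e0 e0) t0) => E; rewrite -[RHS]E; ring.
Qed.
End upper_half_plane.

(** * Functions of the hyperbolic distance *)

Section scaling_integrals.
Context d (T : measurableType d) (R : realType) (mu : {measure set T -> \bar R}).
Local Open Scope ereal_scope.

Lemma integralZl_ge0 (c : R) (f : T -> \bar R) : (0 <= c)%R ->
  measurable_fun setT f -> (forall x, 0 <= f x) ->
  \int[mu]_x (c%:E * f x) = c%:E * \int[mu]_x f x.
Proof. by move=> c0 mf f0; rewrite ge0_integralZl. Qed.

Lemma integralZr_ge0 (c : R) (f : T -> \bar R) : (0 <= c)%R ->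
  measurable_fun setT f -> (forall x, 0 <= f x) ->
  \int[mu]_x (f x * c%:E) = \int[mu]_x f x * c%:E.
Proof. by move=> c0 mf f0; rewrite ge0_integralZr. Qed.
End scaling_integrals.

Section radial.
Variable R : realType.
Local Notation leb := (@lebesgue_measure R).
Local Notation RR := (measurableTypeR R).
Local Open Scope ereal_scope.
Implicit Types (f k h : R -> \bar R).

Lemma ge0_integral_even f : measurable_fun setT f -> (forall x, 0 <= f x) ->
  (forall x, f (- x)%R = f x) ->
  \int[leb]_x f x = 2%:E * \int[leb]_(x in `]0%R, +oo[) f x.
Proof.
move=> mf f0 fN.
have U : [set: R] = `[0%R, +oo[%classic `|` `]-oo, 0%R[%classic.
  apply/seteqP; split => // x _; rewrite /= !in_itv/= andbT.
  by case: (leP 0%R x) => _; [left|right].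
rewrite U ge0_integral_setU//; last 2 first.
- exact: measurable_funTS.
- apply/disj_setPS => x [] /=; rewrite !in_itv/= andbT => + x0.
  by rewrite leNgt x0.
rewrite integral_itv_bndo_bndc; last exact: measurable_funTS.
rewrite ge0_integration_by_substitution0//.
rewrite integral_itv_obnd_cbnd ?ge0_integration_by_substitution0//; last first.
  exact: measurable_funTS.
under eq_integral do rewrite fN.
by rewrite -mule2n -mule_natl.
Qed.

Lemma integral_invr_oneDsqr : \int[leb]_x ((1 + x ^+ 2)^-1)%R%:E = (@pi R)%:E.
Proof.
have mf : measurable_fun setT (EFin \o (fun x : R => (1 + x ^+ 2)^-1)%R).
  by apply/measurable_EFinP; mreal.
rewrite ge0_integral_even//=; last 2 first.
- by move=> x; rewrite lee_fin invr_ge0 addr_ge0// sqr_ge0.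
- by move=> x; rewrite sqrrN.
rewrite integral_itv_obnd_cbnd; last exact: measurable_funTS.
have := integral0y_oneDsqr R; rewrite /oneDsqr => ->.
by rewrite -EFinM; congr EFin; field.
Qed.

(** Polar coordinates with the slope t = v/p and the radius as variables: the
radial part of the integral is independent of the slope up to the factor 1/(1
+ t^2), whose integral is pi. *)
Lemma integral_radial k : measurable_fun setT k -> (forall x, 0 <= k x) ->
  \int[leb]_p \int[leb]_v k ((v ^+ 2 + p ^+ 2 + 2) / 2)%R =
  (2 * pi)%:E * \int[leb]_(q in `]1%R, +oo[) k q.
Proof.
move=> mk k0; set K := \int[leb]_(q in `]1%R, +oo[) k q.
pose V (p : R) := \int[leb]_v k ((v ^+ 2 + p ^+ 2 + 2) / 2)%R.
have mV : measurable_fun setT V.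
  apply: (measurable_fun_fubini_tonelli_F (m2 := leb)
    (fun p : RR * RR => k ((p.2 ^+ 2 + p.1 ^+ 2 + 2) / 2)%R)) => //.
  by apply: (measurableT_comp mk); mreal.
have V0 p : 0 <= V p by exact: integral_ge0.
rewrite -[LHS]/(\int[leb]_p V p) (ge0_integral_even mV)//; last first.
  by move=> p; rewrite /V sqrrN.
rewrite ge0_integral_exp// EFinM -muleA; congr (_ * _).
transitivity (\int[leb]_r \int[leb]_t
   (k (1 + expR r ^+ 2 * (1 + t ^+ 2) / 2)%R * (expR r ^+ 2)%:E)).
  apply: eq_integral => r _; rewrite /V.
  have e0 := expR_gt0 r.
  rewrite (@ge0_integral_affine _ _ (expR r) 0)//; last first.
    by apply: (measurableT_comp mk); mreal.
  rewrite -integralZr_ge0; [|exact: ltW|apply: emeasurable_funM => //|]; last 2 first.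
  - by apply: (measurableT_comp mk); mreal.
  - by move=> x; rewrite mule_ge0// lee_fin ltW.
  apply: eq_integral => t _; rewrite -muleA -EFinM -expr2 addr0.
  by congr (k _ * _); field.
rewrite (fubini_tonelli (m1 := leb) (m2 := leb) (fun p : RR * RR =>
  k (1 + expR p.1 ^+ 2 * (1 + p.2 ^+ 2) / 2)%R * (expR p.1 ^+ 2)%:E))//=; last 2 first.
- apply: emeasurable_funM; first by apply: (measurableT_comp mk); mreal.
  by apply/measurable_EFinP; mreal.
- by move=> x; rewrite mule_ge0// lee_fin sqr_ge0.
have KE t : \int[leb]_r (k (1 + expR r ^+ 2 * (1 + t ^+ 2) / 2)%R * (expR r ^+ 2)%:E)
    = ((1 + t ^+ 2)^-1)%R%:E * K.
  have c0 : (0 < 1 + t ^+ 2)%R by rewrite ltr_pwDl// sqr_ge0.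
  move: (1 + t ^+ 2)%R c0 => c c0.
  have D (r : R) : is_derive r (1%R : R)
      (fun r => 1 + expR r ^+ 2 * c / 2)%R (expR r ^+ 2 * c)%R.
    by apply: is_derive_eq; rewrite /GRing.scale/=; field.
  rewrite /K (@ge0_integral_subst _ _
    (fun q => ln (2 * (q - 1) / c) / 2)%R _ `]1%R, +oo[%classic _ D)//; last 6 first.
  - move=> r; apply: cvgM; last exact: cvg_cst.
    by apply: (@continuous_comp _ _ _ expR (fun x : R => x ^+ 2)%R); [exact: continuous_expR|exact: exprn_continuous].
  - by move=> r; rewrite mulr_gt0// exprn_gt0// expR_gt0.
  - by mreal.
  - by move=> r /=; rewrite in_itv/= andbT ltrDl divr_gt0// mulr_gt0// exprn_gt0// expR_gt0.
  - move=> r; rewrite addrAC subrr add0r.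
    rewrite (_ : (2 * _ / c = expR (r * 2))%R) ?expRK ?mulfK//.
    by rewrite mulr_natr mulr2n expRD; field; rewrite gt_eqF.
  - move=> q; rewrite inE/= in_itv/= andbT => q1.
    rewrite -expRM_natl mulr_natl -mulr_natr divfK// lnK.
      by field; rewrite gt_eqF.
    by rewrite posrE divr_gt0// mulr_gt0// subr_gt0.
  rewrite -integralZl_ge0; [|by rewrite invr_ge0 ltW|apply: emeasurable_funM|]; last 3 first.
  - by apply: (measurableT_comp mk); mreal.
  - by apply/measurable_EFinP; mreal.
  - by move=> r; rewrite mule_ge0// lee_fin mulr_ge0 ?sqr_ge0// ltW.
  apply: eq_integral => r _; rewrite muleCA -EFinM; congr (_ * _%:E).
  by field; rewrite gt_eqF.
under eq_integral do rewrite KE.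
rewrite ge0_integralZr; [|by []| | |exact: integral_ge0].
- by rewrite integral_invr_oneDsqr.
- by apply/measurable_EFinP; mreal.
- by move=> x _; rewrite lee_fin invr_ge0 addr_ge0// sqr_ge0.
Qed.

(** The variable p is 2 sinh (r/2). *)
Lemma integral_sinh f : measurable_fun setT f -> (forall x, 0 <= f x) ->
  \int[leb]_p f p = \int[leb]_r (f (expR (r / 2) - expR (- (r / 2)))%R *
    ((expR (r / 2) + expR (- (r / 2))) / 2)%R%:E).
Proof.
move=> mf f0.
apply: (@ge0_integral_subst _ (fun r : R => expR (r / 2) - expR (- (r / 2)))%R
  (fun p => 2 * ln ((p + Num.sqrt (p ^+ 2 + 4)) / 2))%R) => //.
- move=> r; apply: is_derive_eq.
  by rewrite /GRing.scale/=; field.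
- move=> r; apply: cvgM; last exact: cvg_cst.
  apply: cvgD.
    apply: (@continuous_comp _ _ _ (fun r : R => r / 2)%R expR); last exact: continuous_expR.
    by apply: cvgM; [exact: cvg_id|exact: cvg_cst].
  apply: (@continuous_comp _ _ _ (fun r : R => - (r / 2))%R expR); last exact: continuous_expR.
  by apply: cvgN; apply: cvgM; [exact: cvg_id|exact: cvg_cst].
- by move=> r; rewrite divr_gt0// addr_gt0// expR_gt0.
- by mreal.
- move=> r; rewrite expRN; have e0 := expR_gt0 (r / 2).
  rewrite (_ : _ + 4 = (expR (r / 2) + (expR (r / 2))^-1) ^+ 2)%R; last first.
    by field; rewrite gt_eqF.
  rewrite sqrtr_sqr ger0_norm; last by rewrite addr_ge0// ?invr_ge0 ltW.
  rewrite (_ : (_ - _ + (_ + _)) / 2 = expR (r / 2))%R; last by field; rewrite gt_eqF.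
  by rewrite !expRK mulrC divfK.
- move=> p _; rewrite [(2 * ln _)%R]mulrC mulfK//.
  have w0 : (0 <= Num.sqrt (p ^+ 2 + 4))%R by exact: sqrtr_ge0.
  have wE : (Num.sqrt (p ^+ 2 + 4) ^+ 2 = p ^+ 2 + 4)%R.
    by rewrite sqr_sqrtr// addr_ge0 ?sqr_ge0.
  move: (Num.sqrt _) w0 wE => w w0 wE.
  have pw : (0 < p + w)%R.
    have : ((w - p) * (w + p) = 4)%R.
      by rewrite -subr_sqr wE addrAC subrr add0r.
    have [p0|p0 _] := leP p 0%R; last by rewrite ltr_pwDl.
    move=> E; have : (0 < (w - p) * (w + p))%R by rewrite E.
    have w1 : (0 <= w - p)%R by rewrite subr_ge0 (le_trans p0).
    rewrite [(p + w)%R]addrC; move: w1; rewrite le_eqVlt => /predU1P[<-|w1]; first by rewrite mul0r ltxx.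
    by rewrite pmulr_rgt0.
  have s0 : (0 < (p + w) / 2)%R by rewrite divr_gt0.
  rewrite expRN lnK//.
  have s1 : (p + w != 0)%R by rewrite gt_eqF.
  have -> : ((p + w) / 2)^-1%R = ((w - p) / 2)%R.
    apply: (mulfI (lt0r_neq0 s0)); rewrite divff ?gt_eqF//.
    have -> : ((p + w) / 2 * ((w - p) / 2) = (w ^+ 2 - p ^+ 2) / 4)%R by field.
    by rewrite wE addrAC subrr add0r divff.
  by field.
Qed.

(** Averages the integrand and its reflection. It replaces a single
exponential by the hyperbolic cosine that is the derivative needed in
[integral_sinh]. *)
Lemma integral_symmetrize (W : R -> \bar R) (e : R -> R) :
  measurable_fun setT W -> (forall x, 0 <= W x) -> (forall x, W (- x)%R = W x) ->
  measurable_fun setT e -> (forall x, 0 <= e x)%R ->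
  \int[leb]_r (W r * (e (- r)%R)%:E) = \int[leb]_r (W r * ((e r + e (- r)) / 2)%R%:E).
Proof.
move=> mW W0 WN me e0.
have mWe : measurable_fun setT (fun r => W r * (e r)%:E).
  by apply: emeasurable_funM => //; exact/measurable_EFinP.
have meN : measurable_fun setT (fun r : R => e (- r)%R) by exact: measurableT_comp.
have mWeN : measurable_fun setT (fun r : R => W r * (e (- r)%R)%:E).
  by apply: emeasurable_funM => //; exact/measurable_EFinP.
have We0 r : 0 <= W r * (e r)%:E by rewrite mule_ge0// lee_fin.
have WeN0 r : 0 <= W r * (e (- r)%R)%:E by rewrite mule_ge0// lee_fin.
have E : \int[leb]_r (W r * (e (- r)%R)%:E) = \int[leb]_r (W r * (e r)%:E).
  by rewrite ge0_integral_opp//; apply: eq_integral => r _; rewrite WN opprK.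
transitivity (\int[leb]_r (2^-1%:E * (W r * (e r)%:E + W r * (e (- r)%R)%:E))).
  rewrite integralZl_ge0//; last 2 first.
  - exact: emeasurable_funD.
  - by move=> r; exact: adde_ge0.
  rewrite ge0_integralD// -E -mule2n -mule_natl muleA -EFinM mulVf ?mul1e//.
apply: eq_integral => r _; rewrite -ge0_muleDr ?lee_fin//.
by rewrite muleCA -EFinD -EFinM; congr (_ * _%:E); rewrite mulrC.
Qed.

(** The argument of k is the hyperbolic cosine of the distance to i. With x =
sqrt(y) v and p = sqrt(y) - 1/sqrt(y) it equals (v^2 + p^2 + 2)/2, a radial
function in the plane. *)
Lemma polar_int_cosh_dist k : measurable_fun setT k -> (forall x, 0 <= k x) ->
  polar_int (fun p : RR * RR => k ((p.1 ^+ 2 + p.2 ^+ 2 + 1) / (2 * p.2))%R) =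
  (2 * pi)%:E * \int[leb]_(q in `]1%R, +oo[) k q.
Proof.
move=> mk k0; rewrite -(integral_radial mk k0).
pose V (p : R) := \int[leb]_v k ((v ^+ 2 + p ^+ 2 + 2) / 2)%R.
have mV : measurable_fun setT V.
  apply: (measurable_fun_fubini_tonelli_F (m2 := leb)
    (fun p : RR * RR => k ((p.2 ^+ 2 + p.1 ^+ 2 + 2) / 2)%R)) => //.
  by apply: (measurableT_comp mk); mreal.
have V0 p : 0 <= V p by exact: integral_ge0.
have VN p : V (- p)%R = V p by rewrite /V sqrrN.
pose sh (r : R) := (expR (r / 2) - expR (- (r / 2)))%R.
have msh : measurable_fun setT sh by rewrite /sh; mreal.
have shN r : sh (- r)%R = (- sh r)%R by rewrite /sh mulNr opprK opprB.
transitivity (\int[leb]_r (V (sh r) * (expR (- r / 2))%:E)).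
  apply: eq_integral => r _; rewrite /V mulNr.
  have e0 := expR_gt0 (r / 2).
  rewrite (@ge0_integral_affine _ _ (expR (- (r / 2))) 0) ?expR_gt0//=; last first.
    by apply: (measurableT_comp mk); mreal.
  rewrite integralZr_ge0 ?expR_ge0//; last by apply: (measurableT_comp mk); mreal.
  congr (_ * _); apply: eq_integral => v _; congr k; rewrite /sh.
  rewrite [X in expR X](_ : r = r / 2 + r / 2)%R; last by field.
  by rewrite expRD expRN; move: (expR _) e0 => e e0; field; rewrite gt_eqF.
have me : measurable_fun setT (fun r : R => expR (r / 2)).
  by apply: (measurableT_comp (@measurable_expR R)); exact: measurable_funM.
rewrite (integral_symmetrize (W := V \o sh) (e := fun r => expR (r / 2)) _ _ _ me).
- rewrite [RHS](integral_sinh mV V0).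
  by apply: eq_integral => r _; rewrite mulNr.
- exact: measurableT_comp.
- by move=> r; exact: V0.
- by move=> r; rewrite /= shN VN.
- by move=> r; exact: expR_ge0.
Qed.
End radial.

(** * Moebius transformations and the invariance of the area *)

Section moebius.
Variable R : realType.
Local Notation RR := (measurableTypeR R).
Implicit Types (M : 'M[R]_2) (p : RR * RR).

(** The square of the absolute value of c z + d. *)
Definition cofac M p : R := (M 1 0 * p.1 + M 1 1) ^+ 2 + (M 1 0 * p.2) ^+ 2.

Lemma moebiusE M p : moebius M p =
  (((M 0 0 * p.1 + M 0 1) * (M 1 0 * p.1 + M 1 1) + M 0 0 * M 1 0 * p.2 ^+ 2) / cofac M p,
   (\det M * p.2 / cofac M p)).
Proof.
case: p => x y; rewrite /moebius /toC /ofC /cofac det2E /=.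
by rewrite !(mul0r, mulr0, addr0, subr0, add0r); congr pair; ring.
Qed.

Lemma cofac_gt0 M p : \det M = 1 -> HH p -> 0 < cofac M p.
Proof.
rewrite det2E /HH/= => d1 y0; rewrite lt_neqAle eq_sym addr_ge0 ?sqr_ge0// andbT.
apply/eqP => /eqP; rewrite paddr_eq0 ?sqr_ge0// !sqrf_eq0 => /andP[/eqP E].
rewrite mulf_eq0 [p.2 == 0]gt_eqF// orbF => /eqP c0.
move: E d1; rewrite c0 mul0r add0r => ->; rewrite !mulr0 subr0 => /eqP.
by rewrite eq_sym oner_eq0.
Qed.

Lemma moebius_HH M p : \det M = 1 -> HH p -> HH (moebius M p).
Proof.
move=> d1 Hp; rewrite moebiusE /HH/= d1 mul1r divr_gt0//.
exact: cofac_gt0.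
Qed.

Lemma cofacM M1 M2 p : cofac M2 p != 0 ->
  cofac (M1 *m M2) p = cofac M1 (moebius M2 p) * cofac M2 p.
Proof.
rewrite moebiusE det2E /cofac !mulmx2E/= => q0.
by field.
Qed.

Lemma moebiusM M1 M2 p : \det M1 = 1 -> \det M2 = 1 -> HH p ->
  moebius (M1 *m M2) p = moebius M1 (moebius M2 p).
Proof.
move=> d1 d2 Hp.
have /gt_eqF/negbT q2 := cofac_gt0 d2 Hp.
have /gt_eqF/negbT q1 := cofac_gt0 d1 (moebius_HH d2 Hp).
rewrite [LHS]moebiusE [RHS]moebiusE cofacM// det_mulmx !det2E !mulmx2E.
move: (cofac M1 _) q1 => c1 q1; rewrite moebiusE det2E.
move: q2; rewrite /cofac => q2.
by rewrite /=; congr pair; field; rewrite q1 q2.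
Qed.

Lemma moebius1 p : moebius 1%:M p = p.
Proof.
rewrite moebiusE /cofac det1 !mxE/=.
by case: p => x y /=; congr pair; field.
Qed.

Lemma moebiusN M p : moebius (- M) p = moebius M p.
Proof.
have dN : \det (- M) = \det M by rewrite !det2E !mxE !mulrNN.
have cN : cofac (- M) p = cofac M p by rewrite /cofac !mxE; ring.
by rewrite !moebiusE dN cN !mxE; congr (_ / _, _); ring.
Qed.

Lemma measurable_moebius M : measurable_fun setT (moebius M : RR * RR -> RR * RR).
Proof.
rewrite (_ : moebius M = fun p => (((M 0 0 * p.1 + M 0 1) * (M 1 0 * p.1 + M 1 1)
   + M 0 0 * M 1 0 * p.2 ^+ 2) / cofac M p, (\det M * p.2 / cofac M p))); last first.
  by apply/funext => p; exact: moebiusE.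
rewrite /cofac; move: (M 0 0) (M 0 1) (M 1 0) (M 1 1) (\det M) => a b c d e.
have mq : measurable_fun setT (fun p : RR * RR => (c * p.1 + d) ^+ 2 + (c * p.2) ^+ 2).
  by mreal.
have mqV : measurable_fun setT (fun p : RR * RR => ((c * p.1 + d) ^+ 2 + (c * p.2) ^+ 2)^-1).
  exact: (measurableT_comp (@measurable_invr R) mq).
apply: measurable_fun_pair; apply: (measurable_funM _ mqV); mreal.
Qed.

(** A fixed point x + i y satisfies 2 c x = a - d and c (x^2 + y^2) = - b,
which determine it unless c = 0. *)
Lemma moebius_fixed_unique M p q : \det M = 1 -> HH p -> HH q ->
  moebius M p = p -> moebius M q = q -> M <> 1%:M -> M <> - 1%:M -> p = q.
Proof.
move=> d1 Hp Hq Mp Mq M1 MN1.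
have fixE r : HH r -> moebius M r = r ->
    M 1 0 * (2 * r.1) = M 0 0 - M 1 1 /\ M 1 0 * (r.1 ^+ 2 + r.2 ^+ 2) = - M 0 1.
  case: r => x y Hr; have := cofac_gt0 d1 Hr; rewrite moebiusE d1 mul1r.
  rewrite /HH/= in Hr; move=> c0 [E1 E2].
  have cn : cofac M (x, y) != 0 by rewrite gt_eqF.
  have yn : y != 0 by rewrite gt_eqF.
  have {}E2 : cofac M (x, y) = 1.
    by apply: (mulIf yn); rewrite mul1r -{2}E2 mulrC divfK.
  rewrite E2 divr1 in E1.
  move: E2; rewrite /cofac /= => E2.
  have {}d1 : M 0 0 * M 1 1 - M 0 1 * M 1 0 = 1 by rewrite -det2E.
  move: (M 0 0) (M 0 1) (M 1 0) (M 1 1) E1 E2 d1 => a b c d E1 E2 d1.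
  have F1 : c * (2 * x) = a - d.
    have E3 : ((a * x + b) * (c * x + d) + a * c * y ^+ 2) * c =
        a * ((c * x + d) ^+ 2 + (c * y) ^+ 2) - (a * d - b * c) * (c * x + d) by ring.
    rewrite E1 E2 d1 mulr1 mul1r in E3.
    by move: E3 => /eqP; rewrite -subr_eq0 => /eqP E3; apply/eqP;
      rewrite -subr_eq0 -E3; apply/eqP; ring.
  split => //.
  have E3 : ((a * x + b) * (c * x + d) + a * c * y ^+ 2) * d =
      b * ((c * x + d) ^+ 2 + (c * y) ^+ 2) +
      (a * d - b * c) * (c * (x ^+ 2 + y ^+ 2) + d * x) by ring.
  rewrite E1 E2 d1 mulr1 mul1r in E3.
  move: E3; rewrite [x * d]mulrC addrA => /eqP; rewrite -subr_eq subrr eq_sym addr_eq0.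
  by move=> /eqP ->; rewrite opprK.
have [p1 p2] := fixE _ Hp Mp; have [q1 q2] := fixE _ Hq Mq.
(* If c = 0, the equations for one fixed point make M scalar. *)
have c0 : M 1 0 != 0.
  apply/eqP => c0; rewrite c0 !mul0r in p1 p2.
  have /eqP : M 0 0 = M 1 1 by apply/eqP; rewrite -subr_eq0 -p1.
  have b0 : M 0 1 = 0 by apply/eqP; rewrite -oppr_eq0 -p2.
  move: d1; rewrite det2E c0 mulr0 subr0 => + /eqP ad; rewrite ad -expr2 => /eqP.
  rewrite sqrf_eq1 => /orP[]/eqP d1.
    by apply: M1; apply: eq_mx2; rewrite ?mxE //= ?ad ?d1.
  by apply: MN1; apply: eq_mx2; rewrite ?mxE //= ?ad ?d1 ?b0 ?c0 ?oppr0.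
have xE : p.1 = q.1.
  have n2 : (2 : R) != 0 by rewrite pnatr_eq0.
  by apply: (mulfI n2); apply: (mulfI c0); rewrite p1 q1.
have : p.2 ^+ 2 = q.2 ^+ 2.
  by apply: (@addrI _ (p.1 ^+ 2)); rewrite {2}xE; apply: (mulfI c0); rewrite p2 q2.
rewrite /HH/= in Hp Hq.
move=> /eqP; rewrite eqrXn2 ?ltW// => /eqP yE.
by case: p q xE yE {Hp Hq Mp Mq p1 p2 q1 q2} => [? ?] [? ?] /= -> ->.
Qed.

End moebius.

Section eta_invariance.
Variable R : realType.
Local Notation RR := (measurableTypeR R).

Lemma eq_polar_int (f g : RR * RR -> \bar R) :
  (forall p, HH p -> f p = g p) -> polar_int f = polar_int g.
Proof.
move=> fg; apply: eq_integral => r _; apply: eq_integral => t _; apply: fg.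
by rewrite /HH/= expR_gt0.
Qed.

(** By the Bruhat decomposition a unimodular matrix acts either as an affine
map or, if c does not vanish, as a translation followed by the inversion and
an affine map. *)
Lemma integral_eta_moebius (M : 'M[R]_2) (f : RR * RR -> \bar R) : \det M = 1 ->
  measurable_fun setT f -> (forall p, (0 <= f p)%E) ->
  (\int[@Defs.eta R]_(p in @HH R) f (moebius M p) = \int[@Defs.eta R]_(p in @HH R) f p)%E.
Proof.
move=> d1 mf f0.
have mfM : measurable_fun setT (fun p => f (moebius M p)).
  exact: (measurableT_comp mf (measurable_moebius M)).
suff E : polar_int (fun p => f (moebius M p)) = polar_int f.
  by rewrite (integral_eta mfM (fun p => f0 _)) E (integral_eta mf f0).
have d1' : (M 0 0 * M 1 1 - M 0 1 * M 1 0 = 1) by rewrite -det2E.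
have [c0|c0] := eqVneq (M 1 0) 0.
  rewrite c0 mulr0 subr0 in d1'.
  have a0 : M 0 0 != 0.
    by apply/eqP => a0; move: d1'; rewrite a0 mul0r => /eqP; rewrite eq_sym oner_eq0.
  have dE : M 1 1 = (M 0 0)^-1 by apply: (mulfI a0); rewrite d1' divff.
  have a2 : 0 < M 0 0 ^+ 2 by rewrite lt_neqAle eq_sym sqrf_eq0 a0 sqr_ge0.
  rewrite -(polar_int_affine (M 0 0 * M 0 1) a2 mf f0).
  apply: eq_polar_int => p Hp; rewrite moebiusE d1 /cofac c0 dE.
  by congr f; congr pair; field.
pose F := fun p : RR * RR => f ((M 1 0) ^- 2 * p.1 + M 0 0 / M 1 0, (M 1 0) ^- 2 * p.2).
have mF : measurable_fun setT F.
  by apply: (measurableT_comp mf); apply: measurable_fun_pair; mreal.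
have F0 p : (0 <= F p)%E by exact: f0.
pose S (p : RR * RR) : RR * RR :=
  (- p.1 / (p.1 ^+ 2 + p.2 ^+ 2), p.2 / (p.1 ^+ 2 + p.2 ^+ 2)).
have mS : measurable_fun setT S by apply: measurable_fun_pair; mreal.
pose G := fun p : RR * RR => F (S p).
have mG : measurable_fun setT G by exact: (measurableT_comp mF mS).
have G0 p : (0 <= G p)%E by exact: f0.
have c2 : 0 < M 1 0 ^- 2 by rewrite invr_gt0 lt_neqAle eq_sym sqrf_eq0 c0 sqr_ge0.
transitivity (polar_int F); last exact: polar_int_affine.
transitivity (polar_int G); last exact: polar_int_inversion.
transitivity (polar_int (fun p => G (1 * p.1 + M 1 1 / M 1 0, 1 * p.2))); last first.
  exact: (polar_int_affine _ ltr01 mG G0).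
apply: eq_polar_int => p Hp; have := cofac_gt0 d1 Hp.
rewrite moebiusE d1 /cofac /G /F /S/= => /gt_eqF/negbT q0.
have bE : M 0 1 = ((M 0 0 * M 1 1 - 1) / M 1 0).
  by apply: (mulIf c0); rewrite divfK// -d1' opprB addrC subrK.
rewrite bE !mul1r; move: q0.
move: (M 0 0) (M 1 0) (M 1 1) p.1 p.2 c0 => a c d x y c0 q0.
have -> : (x + d / c) ^+ 2 + y ^+ 2 = ((c * x + d) ^+ 2 + (c * y) ^+ 2) / c ^+ 2 by field.
have -> : ((a * x + (a * d - 1) / c) * (c * x + d) + a * c * y ^+ 2) =
   (a * ((c * x + d) ^+ 2 + (c * y) ^+ 2) - (c * x + d)) / c by field.
move: (_ ^+ 2 + _) q0 => Q q0.
by congr f; congr pair; field; rewrite ?c0 ?q0.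
Qed.
End eta_invariance.

(** * The integral of the Legendre function *)

Section legendre_integral.
Variable R : realType.
Local Notation leb := (@lebesgue_measure R).
Local Notation RR := (measurableTypeR R).
Local Open Scope ereal_scope.
Implicit Types (h : R -> \bar R) (u X c : R).

(** Indicator factors let the region of integration be rewritten pointwise and
moved through an interchange of integrals. *)
Definition ind (b : bool) : R := b%:R.

Lemma measurable_ind_lt d (T : measurableType d) (f g : T -> R) :
  measurable_fun setT f -> measurable_fun setT g ->
  measurable_fun setT (fun x => ind (f x < g x)%R).
Proof.
move=> mf mg; rewrite (_ : (fun x => _) = \1_[set x | (f x < g x)%R]).
  apply: measurable_indic.
  rewrite (_ : [set x | _] = ~` [set x | (g x <= f x)%R]); last first.
    by apply/seteqP; split => x /=; rewrite ltNge => /negP.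
  apply: measurableC; rewrite -[X in measurable X]setTI; exact: measurable_fun_le.
by apply/funext => x; rewrite indicE /ind; congr (_%:R); congr nat_of_bool; apply/idP/idP => [h|/set_mem//]; exact/mem_set.
Qed.

Lemma ind_ge0 b : (0 <= (ind b)%:E :> \bar R).
Proof. by rewrite lee_fin /ind; case: b. Qed.

Lemma mind_lt d (T : measurableType d) (f g : T -> R) :
  measurable_fun setT f -> measurable_fun setT g ->
  measurable_fun setT (fun x => (ind (f x < g x)%R)%:E).
Proof. by move=> mf mg; apply/measurable_EFinP; exact: measurable_ind_lt. Qed.

Lemma integral_gt_ind (a : R) h : \int[leb]_(x in `]a, +oo[) h x = \int[leb]_x ((ind (a < x)%R)%:E * h x).
Proof.
rewrite integral_mkcond; apply: eq_integral => x _; rewrite patchE /ind.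
rewrite (_ : (x \in _) = (a < x)%R).
  by case: ifP => _; rewrite ?mul1e ?mul0e.
by apply/idP/idP => [/set_mem/=|h']; [|apply/mem_set => /=]; rewrite in_itv/= andbT.
Qed.

Lemma coshK (w : R) : (1 < w)%R ->
  [/\ (1 < w + Num.sqrt (w ^+ 2 - 1))%R &
    cosh (ln (w + Num.sqrt (w ^+ 2 - 1))) = w].
Proof.
move=> w1; have q0 : (0 <= Num.sqrt (w ^+ 2 - 1))%R by exact: sqrtr_ge0.
have qE : (Num.sqrt (w ^+ 2 - 1) ^+ 2 = w ^+ 2 - 1)%R.
  by rewrite sqr_sqrtr// subr_ge0 expr_ge1// ltW// (lt_trans _ w1).
move: (Num.sqrt _) q0 qE => q q0 qE.
have v1 : (1 < w + q)%R by rewrite ltr_wpDr.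
have v0 : (0 < w + q)%R by exact: lt_trans v1.
split => //; rewrite /cosh expRN lnK//.
have vN : (w + q != 0)%R by rewrite gt_eqF.
have -> : ((w + q)^-1 = w - q)%R.
  by apply: (mulfI vN); rewrite divff// mulrC -subr_sqr qE; ring.
by field.
Qed.

Lemma coshE (t : R) : (0 < t)%R ->
  (1 < cosh t)%R /\ (cosh t + Num.sqrt (cosh t ^+ 2 - 1) = expR t)%R.
Proof.
move=> t0; rewrite /cosh expRN; have e0 := expR_gt0 t.
have e1 : (1 < expR t)%R by rewrite expR_gt1.
have eN : expR t != 0%R by rewrite gt_eqF.
move: (expR t) e0 e1 eN => e e0 e1 eN.
have -> : (((e + e^-1) / 2) ^+ 2 - 1 = ((e - e^-1) / 2) ^+ 2)%R by field.
have ei : (e^-1 < 1)%R by rewrite invf_lt1.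
rewrite sqrtr_sqr ger0_norm; last by rewrite divr_ge0// subr_ge0 ltW// (lt_trans ei).
split; last by field.
rewrite ltr_pdivlMr// mul1r -subr_gt0.
have -> : (e + e^-1 - 2 = (e - 1) ^+ 2 / e)%R by field.
by rewrite divr_gt0// exprn_gt0// subr_gt0.
Qed.

(** The substitution is made with t = e^r, so that the new variable ranges
over the whole line. *)
Lemma integral_cosh (u c : R) h : (0 < c)%R -> measurable_fun setT h -> (forall x, 0 <= h x) ->
  \int[leb]_(t in `]0%R, +oo[) h (u + c * cosh t)%R =
  \int[leb]_(X in `](u + c)%R, +oo[) (h X * ((Num.sqrt ((X - u) ^+ 2 - c ^+ 2))^-1)%R%:E).
Proof.
move=> c0 mh h0.
have mc : measurable_fun setT (fun t : R => u + c * cosh t)%R by rewrite /cosh; mreal.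
have mhc : measurable_fun setT (fun t => h (u + c * cosh t)%R) by exact: measurableT_comp.
rewrite ge0_integral_exp//.
pose dphi (r : R) := (c * ((expR (expR r) - expR (- expR r)) / 2) * expR r)%R.
have Der (r : R) : is_derive r (1%R : R) (fun r => u + c * ((expR (expR r) + expR (- expR r)) / 2))%R (dphi r).
  by apply: is_derive_eq; rewrite /GRing.scale/= /dphi; field.
have sh0 (r : R) : (0 < (expR (expR r) - expR (- expR r)) / 2)%R.
  rewrite divr_gt0// subr_gt0 ltr_expR; have := expR_gt0 r; lra.
have E2 (r : R) : ((u + c * cosh (expR r) - u) ^+ 2 - c ^+ 2 =
    (c * ((expR (expR r) - expR (- expR r)) / 2)) ^+ 2)%R.
  by rewrite /cosh expRN; have e0 := expR_gt0 (expR r); field; rewrite gt_eqF.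
rewrite (@ge0_integral_subst R (fun r => u + c * ((expR (expR r) + expR (- expR r)) / 2))%R
   (fun X => ln (ln ((X - u) / c + Num.sqrt (((X - u) / c) ^+ 2 - 1))))%R dphi
   `](u + c)%R, +oo[%classic _ Der).
- apply: eq_integral => r _; rewrite -muleA -EFinM.
  rewrite -[X in Num.sqrt ((X - u) ^+ 2 - _)]/(u + c * cosh (expR r))%R E2 sqrtr_sqr.
  rewrite ger0_norm; last by rewrite mulr_ge0// ltW.
  have -> : ((c * ((expR (expR r) - expR (- expR r)) / 2))^-1 * dphi r = expR r)%R.
    by rewrite /dphi mulKf// mulf_neq0// gt_eqF.
  by [].
- have ce : continuous (fun r : R => expR (expR r)).
    by move=> r; apply: (@continuous_comp _ _ _ (@expR R) (@expR R)); exact: continuous_expR.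
  have ceN : continuous (fun r : R => expR (- expR r)%R).
    move=> r; apply: (@continuous_comp _ _ _ (fun r => - expR r)%R (@expR R)); last exact: continuous_expR.
    by apply: cvgN; exact: continuous_expR.
  move=> r; apply: cvgM; last exact: continuous_expR.
  apply: cvgM; first exact: cvg_cst.
  by apply: cvgM; [apply: cvgB; [exact: ce|exact: ceN]|exact: cvg_cst].
- by move=> r; rewrite /dphi mulr_gt0 ?expR_gt0//; apply: mulr_gt0.
- by [].
- by mreal.
- move=> r; rewrite /= in_itv/= andbT ltrD2l -[X in (X < _)%R]mulr1 ltr_pM2l//.
  by have [] := coshE (expR_gt0 r).
- move=> r; rewrite -[((expR (expR r) + expR (- expR r)) / 2)%R]/(cosh (expR r)).
  have -> : ((u + c * cosh (expR r) - u) / c = cosh (expR r))%R.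
    by field; rewrite gt_eqF.
  by have [_ ->] := coshE (expR_gt0 r); rewrite !expRK.
- move=> X /set_mem; rewrite /= in_itv/= andbT => uX.
  have w1 : (1 < (X - u) / c)%R by rewrite ltr_pdivlMr// mul1r ltrBrDl.
  have [v1 vK] := coshK w1.
  have l0 : (0 < ln ((X - u) / c + Num.sqrt (((X - u) / c) ^+ 2 - 1)))%R by rewrite ln_gt0.
  rewrite lnK//; move: vK; rewrite /cosh => ->.
  by field; rewrite gt_eqF.
- by apply: emeasurable_funM => //; apply/measurable_EFinP; mreal.
- by move=> X; rewrite mule_ge0// lee_fin invr_ge0 sqrtr_ge0.
Qed.

Lemma integral_invr_sqrt c : (0 < c)%R ->
  \int[leb]_y ((ind (0 < y)%R)%:E * ((ind (y < c ^+ 2)%R)%:E * ((Num.sqrt y)^-1)%R%:E)) = (2 * c)%:E.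
Proof.
move=> c0.
have m1 : measurable_fun setT (fun y : R => (ind (y < c ^+ 2)%R)%:E * ((Num.sqrt y)^-1)%R%:E).
  apply: emeasurable_funM; first by apply: mind_lt.
  by apply/measurable_EFinP; mreal.
have p1 (y : R) : 0 <= (ind (y < c ^+ 2)%R)%:E * ((Num.sqrt y)^-1)%R%:E.
  by rewrite mule_ge0 ?ind_ge0// lee_fin invr_ge0 sqrtr_ge0.
rewrite -integral_gt_ind ge0_integral_exp//.
have m2 : measurable_fun setT (fun r : R => (ind (expR r < c ^+ 2)%R)%:E * ((Num.sqrt (expR r))^-1)%R%:E * (expR r)%:E).
  apply: emeasurable_funM; last by apply/measurable_EFinP; mreal.
  exact: (measurableT_comp m1 (@measurable_expR R)).
rewrite (@ge0_integral_affine _ _ 2 0)//; last first.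
  by move=> r; rewrite mule_ge0// lee_fin expR_ge0.
transitivity (\int[leb]_r ((2 * ind (expR r < c)%R)%R%:E * (expR r)%:E)).
  apply: eq_integral => r _; rewrite addr0 [(2 * r)%R]mulrC mulr_natr mulr2n expRD -expr2.
  have e0 := expR_gt0 r; move: (expR r) e0 => e e0.
  rewrite sqrtr_sqr gtr0_norm// -!EFinM; congr (_%:E).
  by rewrite ltr_pXn2r ?nnegrE ?ltW//; field; rewrite gt_eqF.
rewrite -(@ge0_integral_exp R (fun y => (2 * ind (y < c)%R)%R%:E)); last 2 first.
- by apply/measurable_EFinP; apply: measurable_funM => //; apply: measurable_ind_lt.
- by move=> y; rewrite lee_fin /ind; case: (_ < _)%R; rewrite ?mulr1 ?mulr0.
transitivity (\int[leb]_(y in `]0%R, c[) (cst 2%:E y)).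
  rewrite integral_gt_ind [RHS]integral_mkcond; apply: eq_integral => y _.
  rewrite patchE (_ : (y \in _) = (0 < y)%R && (y < c)%R).
    rewrite /ind; case: (0 < y)%R; case: (y < c)%R; rewrite ?mul1e ?mul0e ?mulr1 ?mulr0//.
  by apply/idP/idP => [/set_mem/=|h']; [|apply/mem_set => /=]; rewrite in_itv/=.
by rewrite integral_cst//= lebesgue_measure_itv/= lte_fin c0 -EFinB subr0 -EFinM.
Qed.

(** The region in the (u, X)-plane over which the double integral extends,
described without the square root: for fixed X it is an interval in u. *)
Lemma sqrt_region u X : (1 < u)%R ->
  (u + Num.sqrt (u ^+ 2 - 1) < X)%R = (1 < X)%R && (0 < X ^+ 2 + 1 - 2 * u * X)%R.
Proof.
move=> u1; have q0 : (0 <= Num.sqrt (u ^+ 2 - 1))%R by exact: sqrtr_ge0.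
have qE : (Num.sqrt (u ^+ 2 - 1) ^+ 2 = u ^+ 2 - 1)%R.
  by rewrite sqr_sqrtr// subr_ge0 expr_ge1// ltW// (lt_trans _ u1).
move: (Num.sqrt _) q0 qE => q q0 qE.
apply/idP/andP => [uX|[X1 uX]].
  split; first by nra.
  by nra.
rewrite ltNge; apply/negP => Xu.
have : ((u - X) * (u - X) <= q * q)%R \/ (q < u - X)%R.
  have [h|h] := leP (u - X)%R q; [left|by right].
  have h2 : (- q <= u - X)%R by lra.
  by nra.
by case => h; nra.
Qed.

(** The substitution y = X^2 + 1 - 2 u X turns this into the integral of
1/sqrt(y) from 0 to (X - 1)^2. *)
Lemma integral_legendre_kernel X : (1 < X)%R ->
  \int[leb]_u ((ind (1 < u)%R)%:E * ((ind (0 < X ^+ 2 + 1 - 2 * u * X)%R)%:E *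
     ((Num.sqrt (X ^+ 2 + 1 - 2 * u * X))^-1)%R%:E)) = ((X - 1) / X)%:E.
Proof.
move=> X1; have X0 : (0 < X)%R by exact: lt_trans X1.
have c0 : (0 < X - 1)%R by rewrite subr_gt0.
pose G (y : R) := (ind (0 < y)%R)%:E * ((ind (y < (X - 1) ^+ 2)%R)%:E * ((Num.sqrt y)^-1)%R%:E).
have mG : measurable_fun setT G.
  by do 2 (apply: emeasurable_funM; first exact: mind_lt); apply/measurable_EFinP; mreal.
have G0 y : 0 <= G y by rewrite /G !mule_ge0 ?ind_ge0// lee_fin invr_ge0 sqrtr_ge0.
have X20 : (0 < 2 * X)%R by rewrite mulr_gt0.
have := integral_invr_sqrt c0; rewrite -/G.
rewrite (ge0_integral_opp mG G0).
have mGN : measurable_fun setT (fun x : R => G (- x)%R) by apply: (measurableT_comp mG); mreal.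
rewrite (ge0_integral_affine (- (X ^+ 2 + 1))%R X20 mGN)//.
rewrite integralZr_ge0//; last 2 first.
- exact: ltW.
- by apply: (measurableT_comp mGN); mreal.
move=> E.
have -> : ((X - 1) / X)%:E = (2 * (X - 1))%:E * ((2 * X)^-1)%:E.
  by rewrite -EFinM; congr EFin; field; rewrite gt_eqF.
rewrite -E -muleA -EFinM divff ?gt_eqF// mule1; apply: eq_integral => u _; rewrite /G.
have -> : (- (2 * X * u + - (X ^+ 2 + 1)) = X ^+ 2 + 1 - 2 * u * X)%R by ring.
have -> : (X ^+ 2 + 1 - 2 * u * X < (X - 1) ^+ 2)%R = (1 < u)%R.
  rewrite -[LHS]subr_gt0 (_ : (X - 1) ^+ 2 - (X ^+ 2 + 1 - 2 * u * X) = 2 * X * (u - 1))%R; last by ring.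
  by rewrite pmulr_rgt0// subr_gt0.
by rewrite muleCA.
Qed.

(** The Jacobian of X = u + sqrt(u^2 - 1) cosh t for fixed u is sqrt(X^2 + 1 -
2 u X). After the interchange of the integrals the inner one over u is
[integral_legendre_kernel]. *)
Lemma integral_legendre h : measurable_fun setT h -> (forall x, 0 <= h x) ->
  \int[leb]_(u in `]1%R, +oo[) \int[leb]_(t in `]0%R, +oo[)
     h (u + Num.sqrt (u ^+ 2 - 1) * cosh t)%R =
  \int[leb]_(X in `]1%R, +oo[) (h X * ((X - 1) / X)%R%:E).
Proof.
move=> mh h0.
pose k (u X : R) : \bar R := (ind (1 < u)%R)%:E * ((ind (0 < X ^+ 2 + 1 - 2 * u * X)%R)%:E *
     ((Num.sqrt (X ^+ 2 + 1 - 2 * u * X))^-1)%R%:E).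
have k0 u X : 0 <= k u X by rewrite /k !mule_ge0 ?ind_ge0// lee_fin invr_ge0 sqrtr_ge0.
pose f (p : RR * RR) : \bar R := (ind (1 < (p.2 : R))%R)%:E * h p.2 * k p.1 p.2.
have mX : measurable_fun setT (fun p : RR * RR => (p.2 : R)) by exact: measurable_snd.
have mu' : measurable_fun setT (fun p : RR * RR => (p.1 : R)) by exact: measurable_fst.
have mf : measurable_fun setT f.
  apply: emeasurable_funM.
    by apply: emeasurable_funM; [exact: mind_lt|exact: measurableT_comp].
  apply: emeasurable_funM; first exact: mind_lt.
  by apply: emeasurable_funM; [apply: mind_lt; mreal|apply/measurable_EFinP; mreal].
have f0 p : 0 <= f p by rewrite /f !mule_ge0 ?ind_ge0.
transitivity (\int[leb]_u \int[leb]_X f (u, X)).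
  rewrite integral_gt_ind; apply: eq_integral => u _.
  have [u1|u1] := ltP 1%R u; last first.
    rewrite /ind mul0e integral0_eq// => X _.
    by rewrite /f /k/= /ind [(1 < u)%R]ltNge u1/= mul0e mule0.
  rewrite /ind mul1e.
  have c0 : (0 < Num.sqrt (u ^+ 2 - 1))%R by rewrite sqrtr_gt0 subr_gt0 expr_gt1// ltW// (lt_trans _ u1).
  rewrite integral_cosh// integral_gt_ind; apply: eq_integral => X _.
  rewrite /f /k/= sqrt_region// u1 /ind mul1e.
  rewrite sqr_sqrtr ?subr_ge0 ?expr_ge1 ?(ltW u1)//; last by rewrite ltW// (lt_trans _ u1).
  rewrite (_ : ((X - u) ^+ 2 - (u ^+ 2 - 1) = X ^+ 2 + 1 - 2 * u * X)%R); last by ring.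
  by case: (1 < X)%R; case: (0 < _)%R; rewrite ?mul1e ?mul0e ?mule0.
rewrite (fubini_tonelli (m1 := leb) (m2 := leb) f)// integral_gt_ind; apply: eq_integral => X _.
have [X1|X1] := ltP 1%R X; last first.
  by rewrite /ind mul0e integral0_eq// => u _; rewrite /f/= /ind ltNge X1/= !mul0e.
rewrite /ind mul1e -(integral_legendre_kernel X1) -/(k _ X).
rewrite -(ge0_integralZl)//.
- by apply: eq_integral => u _; rewrite /f/= X1 /ind mul1e.
- apply: emeasurable_funM; first exact: mind_lt.
  by apply: emeasurable_funM; [apply: mind_lt; mreal|apply/measurable_EFinP; mreal].
- by move=> u _; exact: k0.
Qed.
End legendre_integral.

(** * Real and imaginary parts of the Legendre function *)

Lemma measurable_fun_fine (R : realType) : measurable_fun setT (@fine R : \bar R -> measurableTypeR R).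
Proof.
move=> _ B mB; rewrite setTI.
rewrite (_ : _ @^-1` B = (EFin @` B) `|` ([set x | x = +oo%E /\ B (0%R : R)] `|` [set x | x = -oo%E /\ B (0%R : R)])); last first.
  apply/seteqP; split=> [[r| |] /= Bx|x]; [by left; exists r|by right; left|by right; right|].
  by move=> [[r Br <-]|[[-> B0]|[-> B0]]].
have mI (x0 : \bar R) (P : Prop) : measurable [set x | x = x0 /\ P].
  have [HP|HP] := pselect P.
    rewrite (_ : [set x | _] = [set x0]); first exact: emeasurable_set1.
    by apply/seteqP; split => x //= [].
  rewrite (_ : [set x | _] = set0); first exact: measurable0.
  by apply/seteqP; split => x //= [].
by apply: measurableU; [exact: measurable_image_EFin|apply: measurableU; exact: mI].
Qed.

Section legendre.
Variables (R : realType) (sigma tau : R).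
Hypothesis sigma1 : 1 < sigma.
Local Notation leb := (@lebesgue_measure R).
Local Notation ind := (@ind R).
Local Notation RR := (measurableTypeR R).
Implicit Types (p q X u : R).

(** A real combination of the components of X^(-s), where s = sigma - i tau:
the pairs (p, q) = (1, 0) and (0, 1) give the real and the imaginary part. *)
Definition osc p q X : R := expR (- (sigma * ln X)) * (p * cos (tau * ln X) + q * sin (tau * ln X)).
(** The nonnegative function X^(-sigma) (1 + p cos + q sin), to which Tonelli
applies. The oscillating part [osc] is recovered as [wt p q] - [wt 0 0]. *)
Definition wt p q X : R := expR (- (sigma * ln X)) + osc p q X.

(** The Laplace transform at alpha of 1 + p cos (tau r) + q sin (tau r). *)
Definition laplace (alpha p q : R) : R := alpha^-1 + (p * alpha + q * tau) / (alpha ^+ 2 + tau ^+ 2).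

(** A primitive of the integrand of [laplace] that vanishes at infinity. *)
Definition lapA (alpha p q r : R) : R := - (expR (- (alpha * r)) * (alpha^-1 +
   (p * (alpha * cos (tau * r) - tau * sin (tau * r)) +
    q * (alpha * sin (tau * r) + tau * cos (tau * r))) / (alpha ^+ 2 + tau ^+ 2))).

Lemma is_derive_lapA (alpha p q r : R) : 0 < alpha -> is_derive r (1 : R) (lapA alpha p q)
  (expR (- (alpha * r)) * (1 + (p * cos (tau * r) + q * sin (tau * r)))).
Proof.
move=> a0; have s0 : 0 < alpha ^+ 2 + tau ^+ 2 by rewrite ltr_wpDr ?sqr_ge0// exprn_gt0.
apply: is_derive_eq; rewrite /GRing.scale/=.
move: (expR _) (cos _) (sin _) => e c d.
by field; rewrite !gt_eqF.
Qed.

Lemma lapA0 (alpha p q : R) : lapA alpha p q 0 = - laplace alpha p q.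
Proof. by rewrite /lapA /laplace !mulr0 oppr0 expR0 cos0 sin0 !mulr0 !mulr1 subr0 add0r mul1r. Qed.

Lemma lapA_cvg (alpha p q : R) : 0 < alpha -> lapA alpha p q r @[r --> +oo] --> 0.
Proof.
move=> a0; have s0 : 0 < alpha ^+ 2 + tau ^+ 2 by rewrite ltr_wpDr ?sqr_ge0// exprn_gt0.
have car : (alpha * r) @[r --> +oo] --> +oo.
  apply/cvgryPge => A; near=> x; rewrite mulrC -ler_pdivrMr//; near: x; exact: nbhs_pinfty_ge.
have ce : expR (- (alpha * r)) @[r --> +oo] --> (0 : R).
  exact: (cvg_comp _ _ car (@cvgr_expR R)).
pose B := alpha^-1 + (`|p| * (alpha + `|tau|) + `|q| * (alpha + `|tau|)) / (alpha ^+ 2 + tau ^+ 2).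
have bd r : `|lapA alpha p q r| <= B * expR (- (alpha * r)).
  rewrite /lapA normrN normrM gtr0_norm ?expR_gt0// mulrC ler_pM2r ?expR_gt0//.
  have c1 : `|cos (tau * r)| <= 1 by rewrite ler_norml cos_geN1 cos_le1.
  have c2 : `|sin (tau * r)| <= 1 by rewrite ler_norml sin_geN1 sin_le1.
  move: (cos _) (sin _) c1 c2 => c d c1 c2.
  rewrite (le_trans (ler_normD _ _))// gtr0_norm ?invr_gt0// lerD2l normrM [X in _ * X]gtr0_norm ?invr_gt0//.
  rewrite ler_pM2r ?invr_gt0// (le_trans (ler_normD _ _))// !normrM.
  have h (x y x' y' : R) : `|x| <= alpha -> `|y| <= `|tau| -> `|x' : R| <= 1 -> `|y'| <= 1 -> `|x * x' + y * y'| <= alpha + `|tau|.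
    move=> h1 h2 h3 h4; rewrite (le_trans (ler_normD _ _))// !normrM lerD//.
      by rewrite (le_trans _ h1)// ler_piMr.
    by rewrite (le_trans _ h2)// ler_piMr.
  have aa : `|alpha| <= alpha by rewrite gtr0_norm.
  by apply: lerD; apply: ler_wpM2l => //; [rewrite -mulNr; apply: h => //; rewrite normrN|apply: h].
apply: (@squeeze_cvgr _ _ _ _ (fun r => - (B * expR (- (alpha * r)))) (fun r => B * expR (- (alpha * r)))).
- by near=> r; rewrite -ler_norml.
- by rewrite -oppr0 -[in X in - X](mulr0 B); apply: cvgN; apply: cvgM => //; exact: cvg_cst.
- by rewrite -(mulr0 B); apply: cvgM => //; exact: cvg_cst.
Unshelve. all: by end_near. Qed.

Definition bounded_osc p q := forall x : R, `|p * cos x + q * sin x| <= 1.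

Lemma wtE p q X : wt p q X = expR (- (sigma * ln X)) * (1 + (p * cos (tau * ln X) + q * sin (tau * ln X))).
Proof. by rewrite [RHS]mulrDr mulr1. Qed.

Lemma wt_ge0 p q X : bounded_osc p q -> 0 <= wt p q X.
Proof.
move=> h; rewrite wtE mulr_ge0 ?expR_ge0//.
by have := h (tau * ln X); rewrite ler_norml => /andP[h1 _]; rewrite -lerBlDl sub0r.
Qed.

Lemma measurable_osc p q : measurable_fun setT (osc p q).
Proof.
have mc : measurable_fun setT (@cos R) by apply: continuous_measurable_fun; exact: continuous_cos.
have ms : measurable_fun setT (@sin R) by apply: continuous_measurable_fun; exact: continuous_sin.
apply: measurable_funM; first by mreal.
by apply: measurable_funD; apply: measurable_funM => //; apply: measurableT_comp => //; mreal.
Qed.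

Lemma measurable_wt p q : measurable_fun setT (wt p q).
Proof. by apply: measurable_funD; [mreal|exact: measurable_osc]. Qed.

Definition legJ p q := laplace (sigma - 1) p q - laplace sigma p q.

(** With X = e^r the integrand is a difference of two Laplace transforms. *)
Lemma integral_wt p q : bounded_osc p q ->
  (\int[leb]_(X in `]1%R, +oo[) ((wt p q X)%:E * ((X - 1) / X)%:E) = (legJ p q)%:E)%E.
Proof.
move=> bo; have s1 : 0 < sigma - 1 by rewrite subr_gt0.
have s0 : 0 < sigma by rewrite (lt_trans _ sigma1).
pose f (X : R) : \bar R := ((ind (1 < X)%R)%:E * ((wt p q X)%:E * ((X - 1) / X)%:E))%E.
have mw := measurable_wt p q.
have mf : measurable_fun setT f.
  apply: emeasurable_funM; first exact: mind_lt.
  by apply: emeasurable_funM; apply/measurable_EFinP => //; mreal.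
have f0 x : (0 <= f x)%E.
  rewrite /f /ind; have [x1|x1] := ltP 1 x; last by rewrite mul0e.
  rewrite mul1e -EFinM lee_fin mulr_ge0 ?wt_ge0// divr_ge0//; last by rewrite ltW// (lt_trans _ x1).
  by rewrite subr_ge0 ltW.
rewrite integral_gt_ind -/f.
transitivity (\int[leb]_(x in `]0%R, +oo[) f x)%E.
  rewrite integral_gt_ind; apply: eq_integral => X _; rewrite /f /ind.
  have [X1|X1] := ltP 1 X; last by rewrite !mul0e mule0.
  by rewrite (lt_trans _ X1)// !mul1e.
rewrite ge0_integral_exp//.
pose G (r : R) : R := expR (- ((sigma - 1) * r)) * (1 + (p * cos (tau * r) + q * sin (tau * r)))
   - expR (- (sigma * r)) * (1 + (p * cos (tau * r) + q * sin (tau * r))).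
have DG (r : R) : is_derive r (1 : R) (fun r => lapA (sigma - 1) p q r - lapA sigma p q r) (G r).
  by apply: is_deriveB; apply: is_derive_lapA.
have mG : measurable_fun setT G.
  have mc : measurable_fun setT (@cos R) by apply: continuous_measurable_fun; exact: continuous_cos.
  have ms : measurable_fun setT (@sin R) by apply: continuous_measurable_fun; exact: continuous_sin.
  have mcr : measurable_fun setT (fun r : R => cos (tau * r)) by apply: measurableT_comp => //; mreal.
  have msr : measurable_fun setT (fun r : R => sin (tau * r)) by apply: measurableT_comp => //; mreal.
  by apply: measurable_funB; apply: measurable_funM; mreal.
transitivity (\int[leb]_(r in `]0%R, +oo[) (G r)%:E)%E.
  rewrite integral_gt_ind; apply: eq_integral => r _; rewrite /f /ind expR_gt1.
  case: (ltP 0 r) => r0; last by rewrite !mul0e.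
  rewrite !mul1e -!EFinM wtE expRK; congr (_%:E); rewrite /G.
  rewrite (_ : - ((sigma - 1) * r) = - (sigma * r) + r); last by ring.
  rewrite expRD; have := gt_eqF (expR_gt0 r).
  move: (expR r) (expR _) (_ + _) => e E T /negbT e0.
  by field.
rewrite integral_itv_obnd_cbnd; last by apply: measurable_funTS; exact/measurable_EFinP.
rewrite (@ge0_continuous_FTC2y _ G (fun r => lapA (sigma - 1) p q r - lapA sigma p q r) 0 0).
- by rewrite !lapA0 -EFinB /legJ; congr EFin; ring.
- move=> r r0; rewrite /G -mulrBl mulr_ge0//.
    by rewrite subr_ge0 ler_expR lerN2 ler_wpM2r// gerBl.
  by have := bo (tau * r); rewrite ler_norml => /andP[h1 _]; rewrite -lerBlDl sub0r.
- apply: continuous_subspaceT => r.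
  have ccos : {for r, continuous (fun r => cos (tau * r))}.
    apply: continuous_comp; last exact: continuous_cos.
    by apply: cvgM; [exact: cvg_cst|exact: cvg_id].
  have csin : {for r, continuous (fun r => sin (tau * r))}.
    apply: continuous_comp; last exact: continuous_sin.
    by apply: cvgM; [exact: cvg_cst|exact: cvg_id].
  have cexp (al : R) : {for r, continuous (fun r => expR (- (al * r)))}.
    apply: (@continuous_comp _ _ _ (fun r => - (al * r)) (@expR R)); last exact: continuous_expR.
    by apply: cvgN; apply: cvgM; [exact: cvg_cst|exact: cvg_id].
  have cT : {for r, continuous (fun r => 1 + (p * cos (tau * r) + q * sin (tau * r)))}.
    apply: cvgD; first exact: cvg_cst.
    by apply: cvgD; apply: cvgM => //; exact: cvg_cst.
  apply: (@cvgB _ _ _ _ _ (fun r => expR (- ((sigma - 1) * r)) * (1 + (p * cos (tau * r) + q * sin (tau * r))))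
    (fun r => expR (- (sigma * r)) * (1 + (p * cos (tau * r) + q * sin (tau * r))))).
    by apply: cvgM; [exact: cexp|exact: cT].
  by apply: cvgM; [exact: cexp|exact: cT].
- by rewrite -(subr0 0); apply: cvgB; apply: lapA_cvg.
- by move=> x _; have [] := DG x.
- apply: cvg_at_right_filter.
  have dF : derivable (fun r => lapA (sigma - 1) p q r - lapA sigma p q r) 0 1 by have [] := DG 0.
  exact: (differentiable_continuous (proj1 (derivable1_diffP _ _) dF)).
- by move=> x _; rewrite derive1E; have [_ ->] := DG x.
Qed.

(** With (p, q) = (1, 0) and (0, 1) these are the real and imaginary parts of
the Legendre function, and [Lwt 0 0] dominates both. *)
Definition Losc p q u : R := fine (\int[leb]_(t in `]0%R, +oo[)
  (osc p q (u + Num.sqrt (u ^+ 2 - 1) * cosh t)%R)%:E)%E.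
Definition Lwt p q u : \bar R := (\int[leb]_(t in `]0%R, +oo[)
  (wt p q (u + Num.sqrt (u ^+ 2 - 1) * cosh t)%R)%:E)%E.

Lemma integral_Lwt p q : bounded_osc p q ->
  (\int[leb]_(u in `]1%R, +oo[) Lwt p q u = (legJ p q)%:E)%E.
Proof.
move=> bo; rewrite -integral_wt// -(@integral_legendre _ (fun X => (wt p q X)%:E))//.
- by apply/measurable_EFinP; exact: measurable_wt.
- by move=> x; rewrite lee_fin wt_ge0.
Qed.

Let marg : measurable_fun setT (fun z : RR * RR => (z.1 : R) + Num.sqrt ((z.1 : R) ^+ 2 - 1) * cosh (z.2 : R)).
Proof. by rewrite /cosh; mreal. Qed.

Lemma measurable_fiber_integral (h : R -> \bar R) : measurable_fun setT h -> (forall x, 0 <= h x)%E ->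
  measurable_fun setT (fun u => \int[leb]_(t in `]0%R, +oo[) h (u + Num.sqrt (u ^+ 2 - 1) * cosh t)%R)%E.
Proof.
move=> mh h0.
rewrite (_ : (fun u => _) = (fun u => \int[leb]_t ((ind (0 < t)%R)%:E *
    h (u + Num.sqrt (u ^+ 2 - 1) * cosh t)%R))%E); last first.
  by apply/funext => u; rewrite integral_gt_ind.
apply: (measurable_fun_fubini_tonelli_F (m2 := leb)
  (fun z : RR * RR => ((ind (0 < (z.2 : R))%R)%:E * h ((z.1 : R) + Num.sqrt ((z.1 : R) ^+ 2 - 1) * cosh (z.2 : R))%R)%E)).
- apply: emeasurable_funM; first by apply: mind_lt; mreal.
  exact: (measurableT_comp mh marg).
- by move=> z; rewrite mule_ge0 ?ind_ge0.
Qed.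

Lemma measurable_Losc p q : measurable_fun setT (Losc p q).
Proof.
have mo : measurable_fun setT (fun x => (osc p q x)%:E).
  by apply/measurable_EFinP; exact: measurable_osc.
apply: (measurableT_comp (@measurable_fun_fine R)).
rewrite (_ : (fun u => _) = (fun u => 
  (\int[leb]_(t in `]0%R, +oo[) ((fun x => (osc p q x)%:E)^\+ (u + Num.sqrt (u ^+ 2 - 1) * cosh t)%R) -
   \int[leb]_(t in `]0%R, +oo[) ((fun x => (osc p q x)%:E)^\- (u + Num.sqrt (u ^+ 2 - 1) * cosh t)%R))%E)); last first.
  apply/funext => u; rewrite [LHS]integralE; congr (_ - _)%E; apply: eq_integral => t _.
    by rewrite !funeposE.
  by rewrite !funenegE.
apply: emeasurable_funB; apply: measurable_fiber_integral => //.
- exact: measurable_funepos.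
- exact: measurable_funeneg.
Qed.

Lemma measurable_Lwt p q : bounded_osc p q -> measurable_fun setT (Lwt p q).
Proof.
move=> bo; apply: (@measurable_fiber_integral (fun x => (wt p q x)%:E)).
- by apply/measurable_EFinP; exact: measurable_wt.
- by move=> x; rewrite lee_fin wt_ge0.
Qed.

Lemma bounded00 : bounded_osc 0 0.
Proof. by move=> x; rewrite !mul0r addr0 normr0. Qed.

Lemma wt00 X : wt 0 0 X = expR (- (sigma * ln X)).
Proof. by rewrite wtE !mul0r !addr0 mulr1. Qed.

Lemma osc_le p q X : bounded_osc p q -> `|osc p q X| <= wt 0 0 X.
Proof.
by move=> bo; rewrite wt00 /osc normrM gtr0_norm ?expR_gt0// ler_piMr ?expR_ge0.
Qed.

Let marg1 u : measurable_fun setT (fun t : R => u + Num.sqrt (u ^+ 2 - 1) * cosh t).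
Proof. by rewrite /cosh; mreal. Qed.

Lemma Losc_le p q u : bounded_osc p q -> (`|Losc p q u|%:E <= Lwt 0 0 u)%E.
Proof.
move=> bo.
have mo : @measurable_fun _ _ RR _ (`]0%R, +oo[%classic : set R) (fun t => (osc p q (u + Num.sqrt (u ^+ 2 - 1) * cosh t)%R)%:E).
  by apply: measurable_funTS; apply/measurable_EFinP; exact: (measurableT_comp (measurable_osc p q) (marg1 u)).
have h1 := le_abse_integral leb (measurable_itv _) mo.
apply: (@le_trans _ _ (\int[leb]_(t in `]0%R, +oo[) `|(osc p q (u + Num.sqrt (u ^+ 2 - 1) * cosh t)%R)%:E|)%E).
  apply: le_trans h1; rewrite /Losc; case: (\int[leb]_(x in _) _)%E => [r| |] //=.
    by rewrite normr0 leey.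
  by rewrite normr0 leey.
apply: ge0_le_integral => //.
- exact: measurableT_comp.
- by apply: measurable_funTS; apply/measurable_EFinP; exact: (measurableT_comp (measurable_wt 0 0) (marg1 u)).
- by move=> t _; rewrite lee_fin osc_le.
Qed.

Lemma integrable_Lwt p q : bounded_osc p q -> leb.-integrable `]1%R, +oo[%classic (Lwt p q).
Proof.
move=> bo; apply/integrableP; split; first by apply: measurable_funTS; exact: measurable_Lwt.
have L0 u : (0 <= Lwt p q u)%E by apply: integral_ge0 => t _; rewrite lee_fin wt_ge0.
under eq_integral => u _ do rewrite gee0_abs//.
by rewrite integral_Lwt// ltry.
Qed.

Lemma integrable_Losc p q : bounded_osc p q ->
  leb.-integrable `]1%R, +oo[%classic (EFin \o Losc p q).
Proof.
move=> bo; apply: le_integrable (integrable_Lwt bounded00) => //.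
- by apply: measurable_funTS; apply/measurable_EFinP; exact: measurable_Losc.
- by move=> u _; rewrite /= [leRHS]gee0_abs ?Losc_le//; apply: integral_ge0 => t _; rewrite lee_fin wt_ge0//; exact: bounded00.
Qed.

(** For almost all u the integrals [Lwt p q u] and [Lwt 0 0 u] are finite,
because their integrals over u are; at such u the difference of the integrands
is [osc]. *)
Lemma integral_Losc p q : bounded_osc p q ->
  (\int[leb]_(u in `]1%R, +oo[) (Losc p q u)%:E = (legJ p q - legJ 0 0)%:E)%E.
Proof.
move=> bo; have iw := integrable_Lwt bo; have i0 := integrable_Lwt bounded00.
have L0 p' q' u : bounded_osc p' q' -> (0 <= Lwt p' q' u)%E.
  by move=> bo'; apply: integral_ge0 => t _; rewrite lee_fin wt_ge0.
rewrite EFinB -integral_Lwt// -[in RHS]integral_Lwt; last exact: bounded00.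
rewrite -integralB//.
apply: ae_eq_integral => //.
- by apply: measurable_funTS; apply/measurable_EFinP; exact: measurable_Losc.
- by apply: measurable_funTS; apply: emeasurable_funB; apply: measurable_Lwt => //; exact: bounded00.
have mD : measurable (`]1%R, +oo[%classic : set RR) by exact: measurable_itv.
have a1 := integrable_ae mD iw; have a2 := integrable_ae mD i0.
apply: filterS2 a1 a2 => u h1 h2 uD; have {}h1 := h1 uD; have {}h2 := h2 uD.
have mw p' q' : @measurable_fun _ _ RR _ (`]0%R, +oo[%classic : set R) (fun t => (wt p' q' (u + Num.sqrt (u ^+ 2 - 1) * cosh t))%:E).
  by apply: measurable_funTS; apply/measurable_EFinP; exact: (measurableT_comp (measurable_wt p' q') (marg1 u)).
have iwt p' q' : bounded_osc p' q' -> Lwt p' q' u \is a fin_num ->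
    leb.-integrable `]0%R, +oo[%classic (EFin \o (fun t => wt p' q' (u + Num.sqrt (u ^+ 2 - 1) * cosh t))).
  move=> bo' fi; apply/integrableP; split; first exact: mw.
  under eq_integral => t _ do rewrite gee0_abs ?lee_fin ?wt_ge0//.
  by rewrite -/(Lwt p' q' u) ltey_eq fi.
have mD0 : measurable (`]0%R, +oo[%classic : set RR) by exact: measurable_itv.
have E : (\int[leb]_(t in `]0%R, +oo[) (osc p q (u + Num.sqrt (u ^+ 2 - 1) * cosh t)%R)%:E = Lwt p q u - Lwt 0 0 u)%E.
  rewrite -(integralB_EFin mD0 (iwt p q bo h1) (iwt 0 0 bounded00 h2)).
  apply: eq_integral => t _; rewrite -EFinB; congr EFin.
  by rewrite [wt 0 0 _]wt00 /wt [_ + osc p q _]addrC addrK.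
by rewrite /Losc E fineK// fin_numB h1 h2.
Qed.
End legendre.

Lemma Re_legendreQ (R : realType) (s : R[i]) (u : R) :
  complex.Re (legendreQ s u) = Losc (complex.Re s) (- complex.Im s) 1 0 u.
Proof.
case: s => x y; rewrite /legendreQ /cintegral /Rintegral /Losc /=; congr fine.
by apply: eq_integral => t _; rewrite /osc /cpow /= mul1r mul0r addr0 !mulNr.
Qed.

Lemma Im_legendreQ (R : realType) (s : R[i]) (u : R) :
  complex.Im (legendreQ s u) = Losc (complex.Re s) (- complex.Im s) 0 1 u.
Proof.
case: s => x y; rewrite /legendreQ /cintegral /Rintegral /Losc /=; congr fine.
by apply: eq_integral => t _; rewrite /osc /cpow /= mul1r mul0r add0r !mulNr.
Qed.

Lemma bounded_cos (R : realType) : bounded_osc (1 : R) 0.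
Proof. by move=> x; rewrite mul1r mul0r addr0 ler_norml cos_geN1 cos_le1. Qed.

Lemma bounded_sin (R : realType) : bounded_osc (0 : R) 1.
Proof. by move=> x; rewrite mul1r mul0r add0r ler_norml sin_geN1 sin_le1. Qed.

(** The two components of 1/(s-1) - 1/s. *)
Lemma legJ_value (R : realType) (s : R[i]) (sg := complex.Re s) (ta := - complex.Im s) : 1 < sg ->
  (legJ sg ta 1 0 - legJ sg ta 0 0) +i* (legJ sg ta 0 1 - legJ sg ta 0 0) = (s * (s - 1))^-1.
Proof.
rewrite /sg /ta; case: s {sg ta} => x y /= x1.
have n1 : 0 < (x - 1) ^+ 2 + (- y) ^+ 2 by rewrite ltr_wpDr ?sqr_ge0// exprn_gt0// subr_gt0.
have n0 : 0 < x ^+ 2 + (- y) ^+ 2 by rewrite ltr_wpDr ?sqr_ge0// exprn_gt0// (lt_trans _ x1).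
have {}n1 : (x - 1) ^+ 2 + (- y) ^+ 2 != 0 by rewrite gt_eqF.
have {}n0 : x ^+ 2 + (- y) ^+ 2 != 0 by rewrite gt_eqF.
have xn : x != 0 by rewrite gt_eqF// (lt_trans _ x1).
have x1n : x - 1 != 0 by rewrite subr_eq0 gt_eqF.
have key : ((legJ x (- y) 1 0 - legJ x (- y) 0 0) +i* (legJ x (- y) 0 1 - legJ x (- y) 0 0)) *
    ((x +i* y) * ((x +i* y) - 1)) = 1.
  rewrite /legJ /laplace; apply/eqP; rewrite eq_complex/=; apply/andP; split; apply/eqP;
  by field; rewrite ?n1 ?n0 ?xn ?x1n.
have s0 : (x +i* y) * ((x +i* y) - 1) != 0.
  by apply/eqP => E; move/eqP: key; rewrite E mulr0 eq_sym oner_eq0.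
by apply: (mulIf s0); rewrite key mulVf.
Qed.

(** * Geometry of numbers *)

Lemma finite_argmin (T : choiceType) (le : rel T) (A : set T) :
  total le -> transitive le -> finite_set A -> A !=set0 ->
  exists2 x, A x & forall y, A y -> le x y.
Proof.
move=> tot tr /finite_seqP[s ->] [x0].
elim: s x0 => [//|x s IH] x0 _.
case: s IH => [|y s] IH.
  exists x; first by rewrite /= inE eqxx.
  by move=> y; rewrite /= inE => /eqP ->; have := tot x x; rewrite orbb.
have [|m ms mP] := IH y; first by rewrite /= inE eqxx.
have [xm|mx] := orP (tot x m).
- exists x; first by rewrite /= inE eqxx.
  move=> z; rewrite /= inE => /predU1P[->|/mP]; last exact: tr.
  by have := tot x x; rewrite orbb.
- exists m; first by rewrite /= inE ms orbT.
  by move=> z; rewrite /= inE => /predU1P[->//|/mP].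
Qed.

Lemma finite_bounded_int (R : realType) (B : R) :
  finite_set [set i : int | `|i%:~R| <= B].
Proof.
pose n := Num.bound B.
apply: (@sub_finite_set _ _ ((fun k : 'I_(n + n).+1 => k%:Z - n%:Z) @` setT)); last first.
  by apply: finite_image; exact: finite_finset.
move=> i /= iB; have iN : (`|i| <= n)%N.
  have : `|i%:~R| <= n%:R :> R.
    apply: le_trans iB _; apply: ltW; have [B0|B0] := leP 0 B; first exact: archi_boundP.
    by rewrite (lt_le_trans B0).
  by rewrite -intr_norm -abszE -pmulrn ler_nat.
have iN2 : (absz (i + n%:Z)%R < (n + n).+1)%N by lia.
by exists (Ordinal iN2) => //=; lia.
Qed.

Section geometry.
Variables (R : realType) (K : fieldExtType rat).
Variables (iota : {rmorphism K -> R}) (conj : {rmorphism K -> K}).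
Hypotheses (quadK : \dim {:K} = 2%N) (conjN1 : exists x, conj x != x).
Variables (b1 b2 : K).
Hypothesis ib : integral_basis b1 b2.
Local Notation ofQ := (ofQ K).
Local Notation OK := (@OK K).
Local Notation delta := (wedge conj b1 b2).
Let conjK : involutive conj := conjK quadK conjN1.
Let d0 : delta != 0 := delta_neq0 quadK conjN1 ib.
Definition iota2 : {rmorphism K -> R} := iota \o conj.
Local Notation s1 := iota.
Local Notation s2 := iota2.

Let id0 : s1 delta != 0. Proof. by rewrite fmorph_eq0. Qed.

Lemma iota_wedge x y : s1 (wedge conj x y) = s1 x * s2 y - s1 y * s2 x.
Proof. by rewrite /wedge rmorphB/= !(rmorphM iota). Qed.

(** By Cramer the coordinates in the integral basis of an element with bounded
conjugates are bounded. *)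
Lemma bounded_finite (n : nat) (B : R) : (0 < n)%N ->
  finite_set [set x | [/\ OK (n%:R * x), `|s1 x| <= B & `|s2 x| <= B]].
Proof.
move=> n0; pose M := n%:R * B * (`|s1 b1| + `|s1 b2| + `|s2 b1| + `|s2 b2|) / `|s1 delta|.
pose I := [set i : int | `|i%:~R| <= M].
apply: (@sub_finite_set _ _ ((fun q : int * int => (b1 *~ q.1 + b2 *~ q.2) / n%:R) @` (I `*` I))).
  move=> x [Onx x1 x2]; have [_ _ gen _] := ib; have [i [j E]] := gen _ Onx.
  have nK : n%:R != 0 :> K by rewrite natrK_eq0 -lt0n.
  exists (i, j); last by rewrite /= -E mulrC mulKf.
  have B0 : 0 <= B by exact: le_trans (normr_ge0 _) x1.
  have sn1 : s1 (n%:R * x) = n%:R * s1 x by rewrite rmorphM rmorph_nat.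
  have sn2 : s2 (n%:R * x) = n%:R * s2 x by rewrite rmorphM rmorph_nat.
  have key (k : int) (u1 u2 : R) : k%:~R * s1 delta = n%:R * (s1 x * u2 - u1 * s2 x) ->
      `|u1| + `|u2| <= `|s1 b1| + `|s1 b2| + `|s2 b1| + `|s2 b2| -> I k.
    move=> kE ub; rewrite /I/= /M ler_pdivlMr ?normr_gt0// -normrM kE normrM.
    rewrite (ger0_norm (ler0n _ _)) -mulrA ler_wpM2l// (le_trans (ler_normB _ _))//.
    rewrite !normrM; apply: le_trans (_ : B * (`|u1| + `|u2|) <= _); last exact: ler_wpM2l.
    rewrite mulrDr addrC lerD ?ler_wpM2r//.
    by rewrite [leRHS]mulrC ler_wpM2l.
  split => /=.
  - apply: (key _ (s1 b2) (s2 b2)).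
      have := wedge_comb conj b1 b2 i j 0 1.
      rewrite mulr0z add0r mulr1z mulr1 mulr0 subr0 -E => /(congr1 s1).
      rewrite iota_wedge sn1 sn2 (rmorphMz iota) -(mulrzr (s1 delta)) => H.
      by rewrite mulrC -H; ring.
    by rewrite -!addrA ler_wpDl// lerD// ler_wpDl.
  - apply: (key _ (- s1 b1) (- s2 b1)).
      have := wedge_comb conj b1 b2 1 0 i j.
      rewrite mulr0z addr0 mulr1z mul1r mul0r subr0 -E => /(congr1 s1).
      rewrite iota_wedge sn1 sn2 (rmorphMz iota) -(mulrzr (s1 delta)) => H.
      by rewrite mulrC -H; ring.
    by rewrite !normrN; have := normr_ge0 (s1 b2); have := normr_ge0 (s2 b2); lra.
by apply: finite_image; apply: finite_setX; exact: finite_bounded_int.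
Qed.

(** The ring of integers is cocompact in the plane: round the two coordinates
down. *)
Lemma covering : exists2 B : R, 0 < B & forall r1 r2 : R, exists o : K,
  [/\ OK o, `|r1 - s1 o| <= B & `|r2 - s2 o| <= B].
Proof.
exists (1 + (`|s1 b1| + `|s1 b2| + `|s2 b1| + `|s2 b2|)).
  by rewrite ltr_pwDl// !addr_ge0.
move=> r1 r2.
pose s := (r1 * s2 b2 - r2 * s1 b2) / s1 delta.
pose t := (r2 * s1 b1 - r1 * s2 b1) / s1 delta.
have dE := iota_wedge b1 b2; have w0 := id0; rewrite dE in w0.
have r1E : r1 = s * s1 b1 + t * s1 b2.
  by rewrite /s /t dE; field.
have r2E : r2 = s * s2 b1 + t * s2 b2.
  by rewrite /s /t dE; field.
have fl (u : R) : `|u - (Num.floor u)%:~R| <= 1.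
  have /andP[u1 u2] := mem_rg1_floor u; rewrite ger0_norm ?subr_ge0//.
  by rewrite lerBlDl ltW.
have [Ob1 Ob2 _ _] := ib.
exists (b1 *~ Num.floor s + b2 *~ Num.floor t).
have sE (f : {rmorphism K -> R}) : f (b1 *~ Num.floor s + b2 *~ Num.floor t) =
    (Num.floor s)%:~R * f b1 + (Num.floor t)%:~R * f b2.
  by rewrite rmorphD !rmorphMz -!(mulrzr (f _)) ![f _ * _]mulrC.
have bound (u v : R) : `|s * u + t * v - ((Num.floor s)%:~R * u + (Num.floor t)%:~R * v)| <= `|u| + `|v|.
  rewrite opprD addrACA -!mulrBl (le_trans (ler_normD _ _))// !normrM.
  by rewrite lerD// ler_piMl.
split.
- apply: subgroupD; try exact: OK_subgroup.
  + by apply: subgroup_mulz => //; exact: OK_subgroup.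
  + by apply: subgroup_mulz => //; exact: OK_subgroup.
- rewrite sE {1}r1E (le_trans (bound _ _))// ler_wpDl// -!addrA !lerD// ?lerDl.
  by rewrite addr_ge0.
- rewrite sE {1}r2E (le_trans (bound _ _))// ler_wpDl// -!addrA.
  by rewrite ler_wpDl// ler_wpDl.
Qed.

(** Pigeonhole principle: modulo the ring of integers the multiples of (r1,
r2) stay in a fixed square by [covering], which is cut into M^2 cells of side
eps. *)
Lemma dirichlet (eps : R) : 0 < eps -> exists2 k : nat, (0 < k)%N &
  forall r1 r2 : R, exists (j : nat) (o : K),
    [/\ (0 < j <= k)%N, OK o, `|j%:R * r1 - s1 o| < eps & `|j%:R * r2 - s2 o| < eps].
Proof.
move=> e0; have [B B0 cov] := covering.
pose M := (Num.bound (2 * B / eps)).+1.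
have cellP (v : R) : `|v| <= B -> exists c : 'I_M, c%:R * eps <= v + B < c.+1%:R * eps.
  move=> vB; have v0 : 0 <= (v + B) / eps.
    rewrite divr_ge0 ?(ltW e0)//; move: vB; rewrite ler_norml => /andP[+ _].
    by rewrite -subr_ge0 opprK.
  have /andP[c1 c2] := Num.Theory.truncn_itv v0.
  have cM : (Num.truncn ((v + B) / eps) < M)%N.
    rewrite -(ltr_nat R) (le_lt_trans c1)//.
    apply: le_lt_trans (_ : 2 * B / eps < _).
      rewrite ler_pM2r ?invr_gt0// mulrDl mul1r lerD2r.
      by move: vB; rewrite ler_norml => /andP[].
    rewrite (lt_le_trans (archi_boundP _)) ?ler_nat//.
    by rewrite divr_ge0 ?mulr_ge0 ?ltW.
  by exists (Ordinal cM); rewrite /= -ler_pdivlMr// c1 -ltr_pdivrMr.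
exists (M * M)%N => // r1 r2.
have oX (j : 'I_(M * M).+1) : exists o : K,
   [/\ OK o, `|j%:R * r1 - s1 o| <= B & `|j%:R * r2 - s2 o| <= B] by exact: cov.
have [ow oP] := boolp.choice oX.
have cX (j : 'I_(M * M).+1) : exists c : 'I_M * 'I_M,
   c.1%:R * eps <= (j%:R * r1 - s1 (ow j)) + B < c.1.+1%:R * eps /\
   c.2%:R * eps <= (j%:R * r2 - s2 (ow j)) + B < c.2.+1%:R * eps.
  have [_ /cellP[u uP] /cellP[v vP]] := oP j.
  by exists (u, v).
have [c cP] := boolp.choice cX.
have : ~~ injectiveb c.
  apply/negP => /injectiveP/leq_card; rewrite card_prod !card_ord.
  by rewrite ltnn.
move=> /injectivePn[j1 [j2 j12 cE]].
wlog lt : j1 j2 j12 cE / (j1 < j2)%N.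
  move=> H; have [l|l|/val_inj E] := ltngtP j1 j2; first exact: (H j1 j2).
    by apply: (H j2 j1) => //; rewrite eq_sym.
  by rewrite E eqxx in j12.
exists (j2 - j1)%N, (ow j2 - ow j1).
(* Two numbers in the same cell differ by less than eps. *)
have close (u v : R) (m : nat) : m%:R * eps <= u + B < m.+1%:R * eps ->
    m%:R * eps <= v + B < m.+1%:R * eps -> `|v - u| < eps.
  rewrite -natr1 mulrDl mul1r => /andP[h1 h2] /andP[h3 h4].
  by rewrite ltr_norml; apply/andP; split; lra.
have [[Oo1 _ _] [Oo2 _ _]] := (oP j1, oP j2).
have [[p1 p2] [q1 q2]] := (cP j1, cP j2).
split.
- by rewrite subn_gt0 lt/= (leq_trans (leq_subr _ _))// -ltnS.
- exact: OKB.
- rewrite natrB ?(ltnW lt)// rmorphB mulrBl opprB addrACA [- _ + _]addrC.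
  rewrite [X in `|X|](_ : _ = (j2%:R * r1 - s1 (ow j2)) - (j1%:R * r1 - s1 (ow j1))); last by ring.
  by apply: (close _ _ (c j2).1) => //; rewrite -cE.
- rewrite natrB ?(ltnW lt)// rmorphB.
  rewrite [X in `|X|](_ : _ = (j2%:R * r2 - s2 (ow j2)) - (j1%:R * r2 - s2 (ow j1))); last by ring.
  by apply: (close _ _ (c j2).2) => //; rewrite -cE.
Qed.

(** The fractional part of an integer of K that is not rational. *)
Lemma small_integer : exists x0 : K, [/\ OK x0, x0 != 0 & `|s1 x0| < 1].
Proof.
have [th Oth thN] : exists2 th, OK th & conj th != th.
  have [Ob1 Ob2 _ _] := ib.
  have [E1|?] := eqVneq (conj b1) b1; last by exists b1.
  have [E2|?] := eqVneq (conj b2) b2; last by exists b2.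
  by move: d0; rewrite /wedge E1 E2 mulrC subrr eqxx.
exists (th - (Num.floor (s1 th))%:~R); split.
- by apply: OKB => //; exact: OK_int.
- by apply: contra thN => /eqP/subr0_eq ->; rewrite rmorph_int.
- have /andP[u1 u2] := mem_rg1_floor (s1 th).
  rewrite rmorphB/= rmorph_int ger0_norm ?subr_ge0// ltrBlDl.
  by [].
Qed.
End geometry.

(** * Pairs of minimal depth *)

Section heights.
Variables (R : realType) (K : fieldExtType rat) (s : {rmorphism K -> R}).
Local Notation RR := (measurableTypeR R).
Implicit Types (c d : K) (p : RR * RR).

(** The inverse of the height of p seen from the cusp - d / c, in the
normalization given by the pair (c, d). *)
Definition depth c d p : R := ((s c * p.1 + s d) ^+ 2 + (s c * p.2) ^+ 2) / p.2.

Lemma depthM x c d p : depth (x * c) (x * d) p = s x ^+ 2 * depth c d p.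
Proof. by rewrite /depth !(rmorphM s) mulrA; congr (_ / _); ring. Qed.

Lemma depth_gt0 c d p : c != 0 \/ d != 0 -> HH p -> 0 < depth c d p.
Proof.
move=> cd; rewrite /HH/= => y0; rewrite divr_gt0// lt_neqAle eq_sym addr_ge0 ?sqr_ge0// andbT.
apply/eqP => /eqP; rewrite paddr_eq0 ?sqr_ge0// !sqrf_eq0 => /andP[/eqP E].
rewrite mulf_eq0 [p.2 == 0]gt_eqF// orbF fmorph_eq0 => /eqP c0.
move: E cd; rewrite c0 rmorph0 mul0r add0r => /eqP; rewrite fmorph_eq0 => ->.
by rewrite eqxx => -[].
Qed.

Lemma depth_cofac (M : 'M[K]_2) p : depth (M 1 0) (M 1 1) p = cofac (map_mx s M) p / p.2.
Proof. by rewrite /depth /cofac !mxE. Qed.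

Lemma moebius_height (M : 'M[K]_2) p : \det M = 1 -> HH p ->
  (moebius (map_mx s M) p).2 = (depth (M 1 0) (M 1 1) p)^-1.
Proof.
move=> d1 _; rewrite moebiusE det_map_mx d1 rmorph1 mul1r /= depth_cofac.
by rewrite invf_div.
Qed.

(** A pair (u, v) seen from the image of p under M is the pair (u, v) M seen
from p. *)
Lemma depth_mul (M : 'M[K]_2) u v p : \det M = 1 -> HH p ->
  depth (u * M 0 0 + v * M 1 0) (u * M 0 1 + v * M 1 1) p =
  depth u v (moebius (map_mx s M) p).
Proof.
move=> d1 Hp; have sd1 : \det (map_mx s M) = 1 by rewrite det_map_mx d1 rmorph1.
have q0 : cofac (map_mx s M) p != 0 by rewrite gt_eqF// cofac_gt0.
rewrite moebiusE sd1 mul1r /depth /=.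
have {}sd1 : s (M 0 0) * s (M 1 1) - s (M 0 1) * s (M 1 0) = 1.
  by rewrite -sd1 det2E !mxE.
rewrite !(rmorphD s) !(rmorphM s).
move: q0; rewrite /cofac !mxE.
rewrite /HH/= in Hp; have y0 : p.2 != 0 by rewrite gt_eqF.
move: (s (M 0 0)) (s (M 0 1)) (s (M 1 0)) (s (M 1 1)) (s u) (s v) sd1 => a b c d {}u {}v sd1 q0.
move: p.1 p.2 y0 q0 => x y y0 q0 {Hp}.
have E : y = (a * d - b * c) * y by rewrite sd1 mul1r.
rewrite (_ : u * (y / ((c * x + d) ^+ 2 + (c * y) ^+ 2)) =
   u * ((a * d - b * c) * y / ((c * x + d) ^+ 2 + (c * y) ^+ 2))); last by rewrite -E.
by field; rewrite ?y0 ?q0.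
Qed.

(** Only finitely many pairs of integers of K are close to a point with
respect to both embeddings; this is the underlying bound on one embedding. *)
Lemma depth_bound c d p (B : R) : HH p -> depth c d p <= B ->
  `|s c| <= 1 + B / p.2 /\ `|s d| <= 1 + B * p.2 + (1 + B / p.2) * `|p.1|.
Proof.
rewrite /HH/= => y0; rewrite /depth ler_pdivrMr// => H.
have sq (t B' : R) : t ^+ 2 <= B' -> `|t| <= 1 + B'.
  move=> tB; have [t1|t1] := leP `|t| 1; first by rewrite (le_trans t1)// lerDl (le_trans _ tB)// sqr_ge0.
  rewrite ler_wpDl// (le_trans _ tB)// -real_normK ?num_real// expr2 ler_peMl//.
  exact: ltW.
have c1 : `|s c| <= 1 + B / p.2.
  apply: sq; rewrite ler_pdivlMr//.
  have : (s c * p.2) ^+ 2 <= B * p.2 by apply: le_trans H; rewrite lerDr sqr_ge0.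
  by rewrite exprMn [p.2 ^+ 2]expr2 mulrA ler_pM2r.
split => //.
have d1 : `|s c * p.1 + s d| <= 1 + B * p.2.
  by apply: sq; apply: le_trans H; rewrite lerDl sqr_ge0.
have -> : s d = (s c * p.1 + s d) - s c * p.1 by rewrite addrAC subrr add0r.
by rewrite (le_trans (ler_normB _ _))// lerD// normrM ler_wpM2r.
Qed.
End heights.

Section reduction.
Variables (R : realType) (K : fieldExtType rat).
Variables (iota : {rmorphism K -> R}) (conj : {rmorphism K -> K}).
Hypotheses (quadK : \dim {:K} = 2%N) (conjN1 : exists x, conj x != x).
Variables (b1 b2 : K).
Hypothesis ib : integral_basis b1 b2.
Variable a : set K.
Hypothesis ida : fractional_ideal a.
Local Notation OK := (@OK K).
Local Notation ofQ := (ofQ K).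
Local Notation N := (ofQ (ideal_norm a)).
Local Notation s1 := iota.
Local Notation s2 := (iota2 iota conj).
Local Notation RR := (measurableTypeR R).
Let conjK : involutive conj := conjK quadK conjN1.
Let sa : subgroup a := ideal_subgroup ida.
Let N0 : N != 0 := norm_neq0 quadK conjN1 ib ida.
Let mem_a := mem_ideal quadK conjN1 ib ida.
Let aV := idealVP quadK conjN1 ib ida.

Lemma ideal_bounded_finite (B : R) :
  finite_set [set x | [/\ a x, `|s1 x| <= B & `|s2 x| <= B]].
Proof.
have [n n0 nP] := ideal_denom quadK conjN1 ida.
apply: sub_finite_set (bounded_finite iota quadK conjN1 ib B n0).
by move=> x [ax x1 x2]; split => //; exact: nP.
Qed.

Lemma OK_bounded_finite (B : R) :
  finite_set [set x | [/\ OK x, `|s1 x| <= B & `|s2 x| <= B]].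
Proof.
apply: sub_finite_set (bounded_finite iota quadK conjN1 ib B (ltn0Sn 0)).
by move=> x [ax x1 x2]; split => //; rewrite mul1r.
Qed.

Definition max_depth (z : (RR * RR) * (RR * RR)) (q : K * K) : R :=
  Num.max (depth s1 q.1 q.2 z.1) (depth s2 q.1 q.2 z.2).

(** The possible bottom rows of matrices in the group, without the condition
that the row generate the unit ideal. *)
Definition cusp_pair (q : K * K) := [/\ a q.1, OK q.2 & q.1 != 0 \/ q.2 != 0].

(** Pairs that are at most as deep as (0, 1) have bounded entries in both
embeddings, so there are finitely many. *)
Lemma minimal_pair z : HH2 z -> exists2 q, cusp_pair q &
  forall q', cusp_pair q' -> max_depth z q <= max_depth z q'.
Proof.
move=> [H1 H2].
have p01 : cusp_pair (0, 1).
  by split; [case: sa|exact: OK1|right; rewrite oner_neq0].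
pose B0 := max_depth z (0, 1).
pose A := [set q | cusp_pair q /\ max_depth z q <= B0].
pose C := Num.max (Num.max (1 + B0 / z.1.2) (1 + B0 * z.1.2 + (1 + B0 / z.1.2) * `|z.1.1|))
  (Num.max (1 + B0 / z.2.2) (1 + B0 * z.2.2 + (1 + B0 / z.2.2) * `|z.2.1|)).
have Afin : finite_set A.
  apply: (@sub_finite_set _ _ ([set x | [/\ a x, `|s1 x| <= C & `|s2 x| <= C]] `*`
      [set x | [/\ OK x, `|s1 x| <= C & `|s2 x| <= C]])); last first.
    by apply: finite_setX; [exact: ideal_bounded_finite|exact: OK_bounded_finite].
  move=> q [[aq Oq _]]; rewrite /max_depth ge_max => /andP[h1 h2].
  have [c1 d1] := depth_bound H1 h1; have [c2 d2] := depth_bound H2 h2.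
  by split; split => //; rewrite /C !le_max ?c1 ?c2 ?d1 ?d2 ?orbT.
have A0 : A !=set0 by exists (0, 1); split => //=.
have [q [cq qB] qmin] := @finite_argmin _ (fun q q' => max_depth z q <= max_depth z q') A
  (fun q q' => le_total _ _) (fun q q' q'' => @le_trans _ _ _ _ _) Afin A0.
exists q => // q' cq'; have [h|h] := leP (max_depth z q') B0; first exact: qmin.
by rewrite (le_trans qB)// ltW.
Qed.

(** The hypothesis on n says that n annihilates the quotient of the fractional
ideal of multipliers of (c, d) by the ring of integers. By [ideal_conj_gcd],
applied to d and to the products of c with generators of the inverse of a,
that fractional ideal is spanned by conjugates of these elements divided by g,
and g is a combination of their products. *)
Lemma unimodular_completion c d (n : nat) : cusp_pair (c, d) ->
  (forall x, a (x * c) -> OK (x * d) -> OK (n%:R * x)) ->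
  exists o e, [/\ OK o, idealV a e & n%:R = o * d - e * c].
Proof.
move=> [/= ac Od cd] nJ.
have [e1 [e2 [[eL _] _]]] := ideal_basis quadK conjN1 ib ida.
have ae1 : a e1 by apply/eL; exists 1, 0; rewrite mulr1z mulr0z addr0.
have ae2 : a e2 by apply/eL; exists 0, 1; rewrite mulr1z mulr0z add0r.
have [_ NO _] := ideal_normP quadK conjN1 ib ida.
pose us := [:: c * (conj e1 / N); c * (conj e2 / N); d].
have eV e : a e -> idealV a (conj e / N).
  by move=> ae v av; rewrite mulrC mulrA; exact: NO.
have us0 : has (fun u => u != 0) us.
  rewrite /= orbF; case: cd => [c0|->]; last by rewrite !orbT.
  rewrite -!negb_and; apply/negP; rewrite !mulf_eq0 (negbTE c0) invr_eq0 (negbTE N0) !orbF /= !fmorph_eq0.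
  move=> /and3P[/eqP e10 /eqP e20 _].
  by have [[x ax /negP x0] _ _ _] := ida; apply: x0; move: ax => /eL[i [j ->]];
    rewrite e10 e20 !mul0rz addr0.
have [g g0 [gO gS]] := ideal_conj_gcd quadK conjN1 us0.
have g0' : ofQ g != 0 by rewrite fmorph_eq0 gt_eqF.
have dus : d \in us by rewrite !inE eqxx !orbT.
have e1us : c * (conj e1 / N) \in us by rewrite !inE eqxx.
have e2us : c * (conj e2 / N) \in us by rewrite !inE eqxx !orbT.
(* These are the multipliers of (c, d) to which the hypothesis applies. *)
have nO u : u \in us -> OK (n%:R * (conj u / ofQ g)).
  move=> uus; apply: nJ.
    apply: mem_a => v /eL[i [j ->]].
    have sO := OK_subgroup K.
    have E : conj u / ofQ g * c * conj (e1 *~ i + e2 *~ j) / N =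
       (c * (conj e1 / N) * conj u / ofQ g) *~ i + (c * (conj e2 / N) * conj u / ofQ g) *~ j.
      rewrite rmorphD/= !(rmorphMz conj) -(mulrzr (conj e1)) -(mulrzr (conj e2)).
      rewrite -(mulrzr (_ / _) i) -(mulrzr (_ / _) j); move: (ofQ g) N => g' N'; ring.
    rewrite E; apply: subgroupD => //; apply: subgroup_mulz => //; exact: gO.
  rewrite mulrC mulrA; exact: gO.
(* The identity to be proved is additive in the element that takes the place
   of g, so it suffices to check it on the products u conj v. *)
pose S := [set w | exists o e, [/\ OK o, idealV a e & n%:R * w / ofQ g = o * d - e * c]].
suff [oo [e [Oo Ve E]]] : S (ofQ g).
  by exists oo, e; split => //; rewrite -E mulfK.
apply: gS.
  split.
    exists 0, 0; rewrite mulr0 !mul0r subr0; split => //; first exact: OK0.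
    by move=> v av; rewrite mul0r; exact: OK0.
  move=> x y [oo [e [Oo Ve E]]] [oo' [e' [Oo' Ve' E']]].
  exists (oo - oo'), (e - e'); split; first exact: OKB.
    by move=> v av; rewrite mulrBl; apply: OKB; [exact: Ve|exact: Ve'].
  by rewrite mulrBr mulrBl E E'; ring.
move=> u v uus /nO Ov; rewrite /S/=.
move: uus; rewrite !inE => /or3P[] /eqP->.
- exists 0, (- (conj e1 / N * (n%:R * (conj v / ofQ g)))); split; first exact: OK0.
    by move=> w aw; rewrite mulNr mulrAC; apply: OKN; apply: OKM => //; exact: eV.
  by ring.
- exists 0, (- (conj e2 / N * (n%:R * (conj v / ofQ g)))); split; first exact: OK0.
    by move=> w aw; rewrite mulNr mulrAC; apply: OKN; apply: OKM => //; exact: eV.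
  by ring.
- exists (n%:R * (conj v / ofQ g)), 0; split => //.
    by move=> w aw; rewrite mul0r; exact: OK0.
  by ring.
Qed.

Definition mx2 (F : pzRingType) (u v w t : F) : 'M[F]_2 :=
  \matrix_(i, j) if i == 0 then if j == 0 then u else v else if j == 0 then w else t.

Lemma mx2E (F : pzRingType) (u v w t : F) : [/\ mx2 u v w t 0 0 = u,
  mx2 u v w t 0 1 = v, mx2 u v w t 1 0 = w & mx2 u v w t 1 1 = t].
Proof. by split; rewrite mxE. Qed.

(** Unimodular matrices whose bottom row is one of the group and whose top row
is so up to the denominator n. They occur because the bottom row of a point of
minimal depth generates an ideal that is trivial only up to bounded
denominators, the class number being arbitrary. *)
Definition near_Gamma (n : nat) (M : 'M[K]_2) :=
  [/\ OK (n%:R * M 0 0), idealV a (n%:R * M 0 1), a (M 1 0), OK (M 1 1) & \det M = 1].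

Lemma idealV_fractional : fractional_ideal (idealV a).
Proof.
have [n n0 nP] := ideal_denom quadK conjN1 ida; have [[v av v0] _ _ _] := ida.
split.
- by exists n%:R => //; rewrite natrK_eq0 -lt0n.
- by move=> x y Hx Hy w aw; rewrite mulrBl; apply: OKB; [exact: Hx|exact: Hy].
- by move=> x y Ox Hy w aw; rewrite -mulrA; apply: OKM => //; exact: Hy.
- by exists v => // x Hx; rewrite mulrC; exact: Hx.
Qed.

Lemma OK_fractional : fractional_ideal OK.
Proof.
split.
- by exists 1; [exact: OK1|exact: oner_neq0].
- by move=> x y; exact: OKB.
- by move=> x y; exact: OKM.
- by exists 1; [exact: oner_neq0|move=> x; rewrite mul1r].
Qed.

(** I contains an integer v, and [covering] scaled by n v subtracts a multiple
of n in I from x. *)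
Lemma reduce_mod (I : set K) (n : nat) : (0 < n)%N -> fractional_ideal I ->
  exists B : R, forall x, I x -> exists y w,
    [/\ I y, `|s1 y| <= B, `|s2 y| <= B, I w & x = y + n%:R * w].
Proof.
move=> n0 idI; have [v v0 Iv] := ideal_nat quadK conjN1 idI.
have [B B0 cov] := covering iota quadK conjN1 ib.
pose nv := ((n * v)%:R : R).
have nv0 : 0 < nv by rewrite ltr0n muln_gt0 n0.
exists (nv * B) => x Ix.
have [oo [Oo o1 o2]] := cov (s1 x / nv) (s2 x / nv).
have Iw : I (oo * v%:R) by apply: idealZ.
exists (x - n%:R * (oo * v%:R)), (oo * v%:R).
have key (f : {rmorphism K -> R}) : `|f x / nv - f oo| <= B ->
    `|f (x - n%:R * (oo * v%:R))| <= nv * B.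
  rewrite (rmorphB f) !(rmorphM f) !(rmorph_nat f) => h.
  have -> : f x - n%:R * (f oo * v%:R) = nv * (f x / nv - f oo).
    by rewrite mulrBr [nv * (f x / nv)]mulrC divfK ?gt_eqF// /nv natrM; ring.
  by rewrite normrM gtr0_norm// ler_pM2l.
split => //; last by rewrite subrK.
- by apply: (ideal_subgroup idI).2 => //; apply: idealZ => //; exact: OK_nat.
- exact: key.
- exact: key.
Qed.

(** Two matrices whose entries, multiplied by n, agree modulo n^2 differ by an
element of Gamma, and there are finitely many residues by [reduce_mod]. *)
Lemma finite_cosets (n : nat) : (0 < n)%N -> exists G : set 'M[K]_2,
  [/\ finite_set G, forall g, G g -> near_Gamma n g &
   forall M, near_Gamma n M -> exists g gam, [/\ G g, Gamma a gam & M = g *m gam]].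
Proof.
move=> n0; have n20 : (0 < n * n)%N by rewrite muln_gt0 n0.
have nK : n%:R != 0 :> K by rewrite natrK_eq0 -lt0n.
have [BO BOP] := reduce_mod n20 OK_fractional.
have [BV BVP] := reduce_mod n20 idealV_fractional.
have [Ba BaP] := reduce_mod n20 ida.
have finV : finite_set [set x | [/\ idealV a x, `|s1 x| <= BV & `|s2 x| <= BV]].
  have [k k0 kP] := ideal_denom quadK conjN1 idealV_fractional.
  apply: sub_finite_set (bounded_finite iota quadK conjN1 ib BV k0).
  by move=> x [Vx x1 x2]; split => //; exact: kP.
pose cong (f : (K * K) * (K * K)) (M : 'M[K]_2) := exists w00 w01 w10 w11,
  [/\ [/\ OK w00, idealV a w01, a w10 & OK w11],
      n%:R * M 0 0 = f.1.1 + (n * n)%:R * w00,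
      n%:R * M 0 1 = f.1.2 + (n * n)%:R * w01,
      n%:R * M 1 0 = f.2.1 + (n * n)%:R * w10 &
      n%:R * M 1 1 = f.2.2 + (n * n)%:R * w11].
pose F := ([set x | [/\ OK x, `|s1 x| <= BO & `|s2 x| <= BO]] `*`
           [set x | [/\ idealV a x, `|s1 x| <= BV & `|s2 x| <= BV]]) `*`
          ([set x | [/\ a x, `|s1 x| <= Ba & `|s2 x| <= Ba]] `*`
           [set x | [/\ OK x, `|s1 x| <= BO & `|s2 x| <= BO]]).
have Ffin : finite_set F.
  apply: finite_setX; apply: finite_setX => //; try exact: OK_bounded_finite.
  exact: ideal_bounded_finite.
pose rep f := xget 1%:M [set M | near_Gamma n M /\ cong f M].
exists (rep @` (F `&` [set f | exists M, near_Gamma n M /\ cong f M])); split.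
- by apply: finite_image; exact: finite_setIl.
- move=> _ [f [_ [M MP]] <-].
  have ex : exists M, [set M | near_Gamma n M /\ cong f M] M by exists M.
  by have [] := xgetPex 1%:M ex.
move=> M nM; have [OM00 VM01 aM10 OM11 dM] := nM.
have [f00 [w00 [Of00 f00a f00b Ow00 E00]]] := BOP _ OM00.
have [f01 [w01 [Vf01 f01a f01b Vw01 E01]]] := BVP _ VM01.
have [f10 [w10 [af10 f10a f10b aw10 E10]]] := BaP _ (idealZ ida (OK_nat K n) aM10).
have [f11 [w11 [Of11 f11a f11b Ow11 E11]]] := BOP _ (OKM (OK_nat K n) OM11).
pose f := ((f00, f01), (f10, f11)).
have Mf : near_Gamma n M /\ cong f M by split => //; exists w00, w01, w10, w11.
have ex : exists M, [set M | near_Gamma n M /\ cong f M] M by exists M.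
have [ng [u00 [u01 [u10 [u11 [[Ou00 Vu01 au10 Ou11] F00 F01 F10 F11]]]]]] :=
  xgetPex 1%:M ex.
rewrite -/(rep f) in ng F00 F01 F10 F11.
have Gg : (rep @` (F `&` [set f | exists M, near_Gamma n M /\ cong f M])) (rep f).
  by exists f => //; split => //; exists M.
move: (rep f) Gg ng F00 F01 F10 F11 => g Gg ng F00 F01 F10 F11.
have [Og00 Vg01 ag10 Og11 dg] := ng.
exists g, (adj2 g *m M); split.
- exact: Gg.
- have [A00 A01 A10 A11] := adj2E g.
  have nn (x y fx u w : K) : n%:R * x = fx + (n * n)%:R * w -> n%:R * y = fx + (n * n)%:R * u ->
      x = y + n%:R * (w - u).
    move=> Ex Ey; apply: (mulfI nK); rewrite mulrDr Ex Ey natrM; ring.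
  have M00 := nn _ _ _ _ _ E00 F00; have M01 := nn _ _ _ _ _ E01 F01.
  have M10 := nn _ _ _ _ _ E10 F10; have M11 := nn _ _ _ _ _ E11 F11.
  have Ov00 := OKB Ow00 Ou00; have Ov11 := OKB Ow11 Ou11.
  have av10 := sa.2 _ _ aw10 au10.
  have Vv01 := (ideal_subgroup idealV_fractional).2 _ _ Vw01 Vu01.
  have On := OK_nat K n.
  have dgE : g 0 0 * g 1 1 - g 0 1 * g 1 0 = 1 by rewrite -det2E.
  split; rewrite ?mulmx2E ?A00 ?A01 ?A10 ?A11 ?M00 ?M01 ?M10 ?M11.
  + rewrite (_ : _ + _ = (g 0 0 * g 1 1 - g 0 1 * g 1 0) +
      n%:R * g 1 1 * (w00 - u00) - n%:R * g 0 1 * (w10 - u10)); last by ring.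
    rewrite dgE; apply: OKB; last exact: Vg01.
    by apply: OKD; [exact: OK1|apply: OKM => //; exact: OKM].
  + rewrite (_ : _ + _ = n%:R * g 1 1 * (w01 - u01) - (w11 - u11) * (n%:R * g 0 1)); last by ring.
    apply: (ideal_subgroup idealV_fractional).2.
      by apply: (idealZ idealV_fractional) => //; exact: OKM.
    exact: (idealZ idealV_fractional).
  + rewrite (_ : _ + _ = n%:R * g 0 0 * (w10 - u10) - n%:R * (w00 - u00) * g 1 0); last by ring.
    by apply: sa.2; apply: idealZ => //; exact: OKM.
  + rewrite (_ : _ + _ = (g 0 0 * g 1 1 - g 0 1 * g 1 0) -
      (w01 - u01) * (n%:R * g 1 0) + n%:R * g 0 0 * (w11 - u11)); last by ring.
    rewrite dgE; apply: OKD; last exact: OKM.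
    by apply: OKB; [exact: OK1|apply: Vv01; exact: idealZ].
  + rewrite det_mulmx dM mulr1 det2E A00 A01 A10 A11 mulrNN mulrC -dgE; ring.
- by rewrite mulmxA mul_adj2 dg mul1mx.
Qed.
End reduction.

(** * Siegel sets *)

Section siegel.
Variables (R : realType) (K : fieldExtType rat).
Variables (iota : {rmorphism K -> R}) (conj : {rmorphism K -> K}).
Hypotheses (quadK : \dim {:K} = 2%N) (conjN1 : exists x, conj x != x).
Variables (b1 b2 : K).
Hypothesis ib : integral_basis b1 b2.
Variable a : set K.
Hypothesis ida : fractional_ideal a.
Local Notation OK := (@OK K).
Local Notation ofQ := (ofQ K).
Local Notation N := (ofQ (ideal_norm a)).
Local Notation s1 := iota.
Local Notation s2 := (iota2 iota conj).
Local Notation RR := (measurableTypeR R).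
Local Notation H2T := ((RR * RR) * (RR * RR))%type.
Implicit Types (z : H2T) (M : 'M[K]_2).
Let conjK : involutive conj := conjK quadK conjN1.
Let sa : subgroup a := ideal_subgroup ida.

Definition hilbert_act M z : H2T := (moebius (map_mx s1 M) z.1, moebius (map_mx s2 M) z.2).
Local Notation act := hilbert_act.

Lemma det_map_mx1 (s : {rmorphism K -> R}) M : \det M = 1 -> \det (map_mx s M) = 1.
Proof. by move=> d; rewrite det_map_mx d rmorph1. Qed.

Lemma act_HH2 M z : \det M = 1 -> HH2 z -> HH2 (act M z).
Proof.
by move=> d [z1 z2]; split; apply: moebius_HH => //; rewrite det_map_mx1.
Qed.

Lemma actM M M' z : \det M = 1 -> \det M' = 1 -> HH2 z ->
  act (M *m M') z = act M (act M' z).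
Proof.
move=> d d' [z1 z2]; rewrite /hilbert_act !map_mxM/=.
by rewrite !moebiusM ?det_map_mx1.
Qed.

(** Bounded real parts, and heights that are bounded below and of bounded
ratio; the bound on the ratio is the reduction modulo units. *)
Definition siegel (C : R) z := [/\ `|z.1.1| <= C, `|z.2.1| <= C,
  C^-1 <= z.1.2, C^-1 <= z.2.2 & z.1.2 <= C * z.2.2 /\ z.2.2 <= C * z.1.2].

Lemma cusp_pair_comb M n u v : near_Gamma a n M -> n%:R * u != 0 ->
  a u -> OK v ->
  cusp_pair a (n%:R * u * M 0 0 + v * M 1 0, n%:R * u * M 0 1 + v * M 1 1).
Proof.
move=> [nOM nVM aM10 OM11 dM] u0 au Ov; split => /=.
- apply: (subgroupD sa); last exact: idealZ.
  by rewrite mulrAC; apply: idealZ.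
- apply: OKD; last exact: OKM.
  by rewrite mulrAC; exact: nVM.
- have E : n%:R * u = (n%:R * u * M 0 0 + v * M 1 0) * M 1 1 -
      (n%:R * u * M 0 1 + v * M 1 1) * M 1 0.
    by rewrite -[LHS]mulr1 -dM det2E; ring.
  have [c0|] := eqVneq (n%:R * u * M 0 0 + v * M 1 0) 0; last by left.
  right; apply: contra u0 => /eqP d0; rewrite E c0 d0 !mul0r subrr //.
Qed.

(** Minimality of q against the pair x q; in particular the conjugates of x
are not both less than 1 in absolute value. *)
Lemma no_small_multiplier z q x : HH2 z -> cusp_pair a q ->
  (forall q', cusp_pair a q' -> max_depth iota conj z q <= max_depth iota conj z q') ->
  a (x * q.1) -> OK (x * q.2) -> x != 0 ->
  Num.max (depth s1 q.1 q.2 z.1) (depth s2 q.1 q.2 z.2) <=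
  Num.max (s1 x ^+ 2 * depth s1 q.1 q.2 z.1) (s2 x ^+ 2 * depth s2 q.1 q.2 z.2).
Proof.
move=> Hz [aq Oq q0] qmin ax Ox x0.
have := qmin (x * q.1, x * q.2); rewrite /max_depth/= !depthM; apply; split => //=.
by case: q0 => q0; [left|right]; rewrite mulf_neq0.
Qed.

(** Complete a pair (c, d) of minimal depth at z to a unimodular matrix M with
a bounded denominator n. At M z the two heights have a bounded ratio, because
multiplication of (c, d) by an integer that is small at one place must not
decrease the maximum of the depths; the real parts become bounded by a
translation; and the heights are bounded below, because otherwise [dirichlet],
applied to the real parts of M z, gives a pair of smaller depth. *)
Lemma siegel_reduction : exists (n : nat) (G : set 'M[K]_2) (C : R),
  [/\ (0 < n)%N, finite_set G, 0 < C, forall g, G g -> near_Gamma a n g &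
   forall z, HH2 z -> exists g gam, [/\ G g, Gamma a gam & siegel C (act (g *m gam) z)]].
Proof.
have [k1 k10 dir1] := dirichlet iota quadK conjN1 ib (@ltr01 R).
(* Every j up to k1 divides n: this makes n a common denominator of all
   multipliers of a pair of minimal depth. *)
pose n := k1`!.
have n0 : (0 < n)%N by exact: fact_gt0.
have nK : n%:R != 0 :> K by rewrite natrK_eq0 -lt0n.
have [G [Gfin Gnear Gcos]] := finite_cosets iota quadK conjN1 ib ida n0.
have [nu nu0 nuP] := ideal_denom quadK conjN1 ida.
have [nu' nu'0 anu'] := ideal_nat quadK conjN1 ida.
have [B B0 cov] := covering iota quadK conjN1 ib.
have nR : 0 < n%:R :> R by rewrite ltr0n.
have eps0 : 0 < (2 * n%:R)^-1 :> R by rewrite invr_gt0 mulr_gt0.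
have [k k0 dir2] := dirichlet iota quadK conjN1 ib eps0.
have [x0 [Ox0 x00 x01]] := small_integer iota quadK conjN1 ib.
(* A bound for the ratio of the two heights. *)
pose kap : R := s2 x0 ^+ 2 + 1.
have kap1 : 1 <= kap by rewrite lerDr sqr_ge0.
have kap0 : 0 < kap by exact: lt_le_trans kap1.
(* The reduced point will have a height of at least 1/L at one of the two
   places, and then at least 1/(L kap) at the other. *)
pose L : R := 2 * n%:R * k%:R * nu'%:R.
have L0 : 0 < L by rewrite !mulr_gt0 ?ltr0n.
have Lk0 : 0 < L * kap by exact: mulr_gt0.
have nB0 : 0 < nu%:R * B by rewrite mulr_gt0 ?ltr0n.
pose C := nu%:R * B + kap + L * kap.
have C0 : 0 < C by rewrite /C addr_gt0// addr_gt0.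
exists n, G, C; split => // z Hz; have [Hz1 Hz2] := Hz.
have [[c d] cq qmin] := minimal_pair iota quadK conjN1 ib ida Hz.
have [/= ac Od cd] := cq.
pose p := depth s1 c d z.1; pose r := depth s2 c d z.2.
have p0 : 0 < p by apply: depth_gt0.
have r0 : 0 < r by apply: depth_gt0.
have nosmall x : a (x * c) -> OK (x * d) -> x != 0 ->
    Num.max p r <= Num.max (s1 x ^+ 2 * p) (s2 x ^+ 2 * r).
  by move=> ax Ox xn0; exact: (@no_small_multiplier z (c, d) x Hz cq qmin ax Ox xn0).
have conjOx0 : OK (conj x0) by exact: OK_conj.
have s1sq : s1 x0 ^+ 2 < 1.
  by rewrite -real_normK ?num_real// exprn_ilt1.
have pr : p <= kap * r.
  have := nosmall x0 (idealZ ida Ox0 ac) (OKM Ox0 Od) x00.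
  rewrite ge_max !le_max => /andP[+ _].
  rewrite leNgt gtr_pMl// s1sq/= => h; apply: (le_trans h).
  by rewrite ler_pM2r// lerDl.
have rp : r <= kap * p.
  have := nosmall (conj x0) (idealZ ida conjOx0 ac) (OKM conjOx0 Od).
  rewrite fmorph_eq0 => /(_ x00); rewrite ge_max !le_max => /andP[_].
  rewrite /iota2/= conjK [X in _ || X]leNgt gtr_pMl// s1sq orbF => h; apply: (le_trans h).
  by rewrite ler_pM2r// lerDl.
(* If x multiplies (c, d) into cusp pairs, so does j x - oo; its conjugates
   are less than 1, so it vanishes by minimality. *)
have nJ x : a (x * c) -> OK (x * d) -> OK (n%:R * x).
  move=> ax Ox.
  have [j [oo [/andP[j0 jk] Oo h1 h2]]] := dir1 (s1 x) (s2 x).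
  have [y0|y0] := eqVneq (j%:R * x - oo) 0.
    have jn : n = (n %/ j * j)%N by rewrite divnK// dvdn_fact// j0.
    rewrite jn natrM -mulrA; apply: OKM; first exact: OK_nat.
    by move/subr0_eq: y0 => ->.
  exfalso; have := nosmall (j%:R * x - oo).
  rewrite (rmorphB s1) (rmorphB s2) (rmorphM s1) (rmorphM s2) (rmorph_nat s1) (rmorph_nat s2).
  have ay : a ((j%:R * x - oo) * c).
    rewrite mulrBl -mulrA; apply: sa.2; apply: (idealZ ida) => //; exact: OK_nat.
  have Oy : OK ((j%:R * x - oo) * d).
    by rewrite mulrBl -mulrA; apply: OKB; apply: OKM => //; exact: OK_nat.
  move=> /(_ ay Oy y0); rewrite leNgt => /negP; apply.
  have sq1 (w : R) : `|w| < 1 -> w ^+ 2 < 1.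
    by move=> w1; rewrite -real_normK ?num_real// exprn_ilt1.
  have lp : (j%:R * s1 x - s1 oo) ^+ 2 * p < p by rewrite gtr_pMl// sq1.
  have lr : (j%:R * s2 x - s2 oo) ^+ 2 * r < r by rewrite gtr_pMl// sq1.
  by rewrite gt_max !lt_max lp lr orbT.
have [oo [e [Oo Ve nE]]] := unimodular_completion quadK conjN1 ib ida cq nJ.
pose M0 := mx2 (oo / n%:R) (e / n%:R) c d.
have [M000 M001 M010 M011] := mx2E (oo / n%:R) (e / n%:R) c d.
rewrite -/M0 in M000 M001 M010 M011.
have dM0 : \det M0 = 1.
  by rewrite det2E M000 M001 M010 M011 mulrAC [e / _ * _]mulrAC -mulrBl -nE divff.
pose w := act M0 z.
have [vo [Oo1 c1 c2]] := cov (w.1.1 / nu%:R) (w.2.1 / nu%:R).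
(* The factor nu makes the translation integral with respect to a, which may
   have denominators. *)
pose t := - (nu%:R * vo).
pose T := mx2 1 t 0 1.
have [T00 T01 T10 T11] := mx2E 1 t 0 1; rewrite -/T in T00 T01 T10 T11.
have dT : \det T = 1 by rewrite det2E T00 T01 T10 T11; ring.
have actT v : act T v = ((v.1.1 + s1 t, v.1.2), (v.2.1 + s2 t, v.2.2)).
  rewrite /hilbert_act !moebiusE /cofac !det_map_mx dT !mxE !rmorph1 !rmorph0/=.
  by congr ((_ , _), (_, _)); field.
pose M := T *m M0.
have [M00 M01 M10 M11] : [/\ M 0 0 = oo / n%:R + t * c, M 0 1 = e / n%:R + t * d,
    M 1 0 = c & M 1 1 = d].
  by rewrite !mulmx2E T00 T01 T10 T11 M000 M001 M010 M011; split; ring.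
have dM : \det M = 1 by rewrite det_mulmx dT dM0 mulr1.
have OnM00 : OK (n%:R * M 0 0).
  rewrite M00 mulrDr [oo / _]mulrC mulrA divff// mul1r; apply: OKD => //.
  rewrite /t mulNr mulrN; apply: OKN; apply: OKM; first exact: OK_nat.
  by rewrite mulrAC; apply: OKM => //; exact: nuP.
have VnM01 : idealV a (n%:R * M 0 1).
  rewrite M01 mulrDr [e / _]mulrC mulrA divff// mul1r => v av.
  rewrite mulrDl; apply: OKD; first exact: Ve.
  rewrite /t mulNr mulrN mulNr; apply: OKN.
  rewrite (_ : _ * v = n%:R * vo * d * (nu%:R * v)); last by ring.
  by apply: OKM; [apply: OKM => //; apply: OKM => //; exact: OK_nat|exact: nuP].
have nM : near_Gamma a n M by split; rewrite ?M10 ?M11.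
pose zs := act M z.
have zsE : zs = ((w.1.1 + s1 t, w.1.2), (w.2.1 + s2 t, w.2.2)).
  by rewrite /zs /M actM// actT.
have Hzs : HH2 zs by apply: act_HH2.
have [Hzs1 Hzs2] := Hzs.
have nuR : 0 < nu%:R :> R by rewrite ltr0n.
have xbound (s : {rmorphism K -> R}) (x : R) : `|x / nu%:R - s vo| <= B -> `|x + s t| <= C.
  move=> h; have -> : x + s t = nu%:R * (x / nu%:R - s vo).
    by rewrite /t (rmorphN s) (rmorphM s) (rmorph_nat s); field; rewrite gt_eqF.
  rewrite normrM gtr0_norm// /C -addrA (le_trans (_ : _ <= nu%:R * B))//; first by rewrite ler_pM2l.
  by rewrite lerDl ltW// addr_gt0.
have y1E : zs.1.2 = p^-1.
  by rewrite -[LHS]/((moebius (map_mx s1 M) z.1).2) moebius_height// M10 M11.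
have y2E : zs.2.2 = r^-1.
  by rewrite -[LHS]/((moebius (map_mx s2 M) z.2).2) moebius_height// M10 M11.
have y1k : zs.1.2 <= kap * zs.2.2.
  by rewrite y1E y2E -[p^-1]mul1r ler_pdivrMr// mulrAC ler_pdivlMr// mul1r.
have y2k : zs.2.2 <= kap * zs.1.2.
  by rewrite y1E y2E -[r^-1]mul1r ler_pdivrMr// mulrAC ler_pdivlMr// mul1r.
have LC : L <= C.
  rewrite (@le_trans _ _ (L * kap))//; first by rewrite ler_pMr.
  by rewrite /C lerDr ltW// addr_gt0.
have LkC : L * kap <= C by rewrite /C lerDr ltW// addr_gt0.
have kapC : kap <= C by rewrite /C addrAC lerDr ltW// addr_gt0.
(* The bottom row of a matrix that moves the real parts of zs close to 0; it
   competes with (c, d). *)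
have [j [vo2 [/andP[j0 jk] Oo2 h1 h2]]] := dir2 (nu'%:R * zs.1.1) (nu'%:R * zs.2.1).
have u0 : n%:R * (j%:R * nu'%:R) != 0 :> K by rewrite !mulf_neq0// natrK_eq0 -lt0n.
have au : a (j%:R * nu'%:R) by apply: idealZ => //; exact: OK_nat.
have On2 : OK (- (n%:R * vo2)) by apply: OKN; apply: OKM => //; exact: OK_nat.
have := qmin _ (cusp_pair_comb nM u0 au On2).
rewrite /max_depth/= !depth_mul// -/p -/r.
have depthE (s : {rmorphism K -> R}) (v : RR * RR) :
    `|j%:R * (nu'%:R * v.1) - s vo2| < (2 * n%:R)^-1 -> HH v -> v.2 < L^-1 ->
    depth s (n%:R * (j%:R * nu'%:R)) (- (n%:R * vo2)) v < v.2^-1.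
  move=> h v0 vL; rewrite /HH/= in v0.
  rewrite /depth ltr_pdivrMr// mulVf ?gt_eqF//.
  rewrite !(rmorphM s, rmorphN s) !(rmorph_nat s).
  have t1 : (n%:R * (j%:R * (nu'%:R * v.1) - s vo2)) ^+ 2 <= 4^-1.
    rewrite -real_normK ?num_real// (_ : 4^-1 = (2^-1) ^+ 2); last by field.
    rewrite lerXn2r ?nnegrE// normrM gtr0_norm//.
    rewrite -ler_pdivlMl// (le_trans (ltW h))// invfM.
    by rewrite mulrC.
  have t2 : (n%:R * (j%:R * nu'%:R) * v.2) ^+ 2 <= 4^-1.
    rewrite (_ : 4^-1 = (2^-1) ^+ 2); last by field.
    rewrite lerXn2r ?nnegrE//; first by rewrite !mulr_ge0// ltW.
    rewrite (le_trans (_ : _ <= n%:R * (k%:R * nu'%:R) * L^-1))//.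
      apply: ler_pM => //; rewrite ?mulr_ge0//; try exact: ltW.
      by rewrite ler_pM2l// ler_pM2r ?ltr0n// ler_nat.
    by rewrite /L le_eqVlt; apply/orP; left; apply/eqP; field; rewrite !gt_eqF ?ltr0n.
  rewrite (_ : (_ + - _) ^+ 2 = (n%:R * (j%:R * (nu'%:R * v.1) - s vo2)) ^+ 2); last by ring.
  by apply: le_lt_trans (lerD t1 t2) _; lra.
rewrite -/(act M z) -/zs => hmax.
have yL : C^-1 <= zs.1.2 /\ C^-1 <= zs.2.2.
  have CL : C^-1 <= L^-1 by rewrite lef_pV2.
  have CLk : C^-1 <= L^-1 / kap by rewrite -invfM lef_pV2.
  have [l1|l1] := leP L^-1 zs.1.2.
    split; first exact: le_trans l1.
    by rewrite (le_trans CLk)// ler_pdivrMr// mulrC (le_trans l1).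
  have [l2|l2] := leP L^-1 zs.2.2.
    split; last exact: le_trans l2.
    by rewrite (le_trans CLk)// ler_pdivrMr// mulrC (le_trans l2).
  have e1 := depthE s1 zs.1 h1 Hzs1 l1.
  have e2 := depthE s2 zs.2 h2 Hzs2 l2.
  exfalso; move: hmax; rewrite leNgt => /negP; apply.
  rewrite gt_max !lt_max.
  move: e1 e2; rewrite y1E y2E !invrK => -> ->.
  by rewrite orbT.
have [g [gam [Gg Ggam ME]]] := Gcos _ nM.
exists g, gam; split => //; rewrite -ME -/zs; split; try by case: yL.
- by rewrite zsE; exact: xbound.
- by rewrite zsE; exact: xbound.
- split; [apply: (le_trans y1k)|apply: (le_trans y2k)]; rewrite ler_pM2r//.
Qed.
End siegel.

(** * Comparing integrals over fundamental domains *)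

Section transfer.
Context d (T : measurableType d) (R : realType) (mu : {measure set T -> \bar R}).
Variables (W : set T) (mW : measurable W) (I : choiceType) (C : set I).
Variables (phi psi : nat -> T -> T) (alpha beta : nat -> I -> I).
Hypotheses (mphi : forall n, measurable_fun setT (phi n))
  (mpsi : forall n, measurable_fun setT (psi n)).
Hypotheses (phiW : forall n x, W x -> W (phi n x)) (psiW : forall n x, W x -> W (psi n x)).
Hypotheses (phiK : forall n x, W x -> psi n (phi n x) = x)
  (psiK : forall n x, W x -> phi n (psi n x) = x).
Hypotheses (alphaC : forall n i, C i -> C (alpha n i)) (betaC : forall n i, C i -> C (beta n i)).
Hypotheses (alphaK : forall n i, C i -> beta n (alpha n i) = i)
  (betaK : forall n i, C i -> alpha n (beta n i) = i).
Hypothesis inv : forall n (f : T -> \bar R), measurable_fun setT f -> (forall x, 0 <= f x)%E ->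
  (\int[mu]_(x in W) f (phi n x) = \int[mu]_(x in W) f x)%E.

(** Invariance of the integral over W, localized to a subset. *)
Lemma integral_transport n (E : set T) (f : T -> \bar R) : measurable E -> E `<=` W ->
  measurable_fun setT f -> (forall x, 0 <= f x)%E ->
  (\int[mu]_(x in E) f x = \int[mu]_(x in W `&` psi n @^-1` E) f (psi n x))%E.
Proof.
move=> mE EW mf f0.
have mpE : measurable (psi n @^-1` E) by rewrite -[X in measurable X]setTI; exact: mpsi.
have mg : measurable_fun setT ((f \o psi n) \_ (psi n @^-1` E)).
  apply/(measurable_restrictT _ mpE); apply: measurable_funTS; exact: measurableT_comp.
have g0 x : (0 <= ((f \o psi n) \_ (psi n @^-1` E)) x)%E by rewrite erestrict_ge0// => y _; exact: f0.
rewrite [RHS]integral_mkcondr -[RHS](inv n mg g0) -[in LHS](setIidr EW) [LHS]integral_mkcondr.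
apply: eq_integral => x /set_mem Wx.
have pE : (phi n x \in psi n @^-1` E) = (x \in E).
  by apply/idP/idP => /set_mem/= h; apply/mem_set => /=; move: h; rewrite phiK.
by rewrite !patchE pE; case: ifP => //= _; rewrite phiK.
Qed.

(** The group acts on the pairs (i, x) through the maps alpha n and phi n, and
f is invariant. If no two points of E are equivalent and every point of E is
equivalent to a point of E', then the integral over E is at most that over E'.
The part of E whose first translate in E' is the n-th one is moved by n; the
images of these parts are disjoint. Applied in both directions this identifies
the integrals over two fundamental domains. *)
Lemma transfer (f : I -> T -> \bar R) (E E' : I -> set T) :
  (forall i, C i -> measurable_fun setT (f i)) -> (forall i x, 0 <= f i x)%E ->
  (forall n i x, C i -> W x -> f (alpha n i) (phi n x) = f i x) ->
  (forall i, C i -> measurable (E i)) -> (forall i, C i -> measurable (E' i)) ->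
  (forall i, C i -> E i `<=` W) ->
  (forall n n' i i' x x', C i -> C i' -> E i x -> E i' x' ->
     alpha n i = alpha n' i' -> phi n x = phi n' x' -> i = i' /\ x = x') ->
  (forall i x, C i -> E i x -> exists n, E' (alpha n i) (phi n x)) ->
  (\esum_(i in C) \int[mu]_(x in E i) f i x <= \esum_(i in C) \int[mu]_(x in E' i) f i x)%E.
Proof.
move=> mf f0 fi mE mE' EW injE covE.
pose En i n := E i `&` (phi n @^-1` E' (alpha n i)) `&`
  \bigcap_(m in `I_n) ~` (phi m @^-1` E' (alpha m i)).
have mphiE' n i : C i -> measurable (phi n @^-1` E' (alpha n i)).
  move=> Ci; rewrite -[X in measurable X]setTI; apply: mphi => //; apply: mE'; exact: alphaC.
have mEn i n : C i -> measurable (En i n).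
  move=> Ci; apply: measurableI.
    by apply: measurableI; [exact: mE|exact: mphiE'].
  by apply: bigcap_measurableType => // m _; apply: measurableC; exact: mphiE'.
have EnW i n : C i -> En i n `<=` W by move=> Ci x [[Ex _] _]; exact: EW Ci _ Ex.
have EEn i : C i -> E i = \bigcup_n En i n.
  move=> Ci; apply/seteqP; split; last by move=> x [n _ [[]]].
  move=> x Ex; have [n0 n0P] := covE i x Ci Ex.
  have exn : exists n, `[< E' (alpha n i) (phi n x) >] by exists n0; apply/asboolP.
  have := ex_minnP exn => -[n /asboolP nP nmin].
  exists n => //; split => // m /= mn mP.
  by have /nmin := asboolT mP; rewrite leqNgt mn.
have trEn i : trivIset setT (En i).
  apply/trivIsetP => n m _ _; wlog nm : n m / (n < m)%N.
    move=> H; rewrite neq_ltn => /orP[nm|mn]; first by apply: H => //; rewrite neq_ltn nm.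
    by rewrite setIC; apply: H => //; rewrite neq_ltn mn.
  move=> _; apply/seteqP; split => // x [[[_ Enx] _] [_ /(_ n nm)]]; exact.
(* The image under n of the n-th part of E at the index that n moves to j. *)
pose S j n := W `&` psi n @^-1` (En (beta n j) n).
pose h j n := (\int[mu]_(x in S j n) f j x)%E.
have h0 j n : (0 <= h j n)%E by apply: integral_ge0.
have mS j n : C j -> measurable (S j n).
  move=> Cj; apply: measurableI => //; rewrite -[X in measurable X]setTI.
  by apply: mpsi => //; apply: mEn; exact: betaC.
have E1 i : C i -> (\int[mu]_(x in E i) f i x = \esum_(n in setT) h (alpha n i) n)%E.
  move=> Ci; rewrite EEn// ge0_integral_bigcup//; last 2 first.
  - by move=> n; exact: mEn.
  - by apply: measurable_funTS; exact: mf.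
  rewrite nneseries_esumT; last by move=> n; apply: integral_ge0.
  apply: eq_esum => n _; rewrite /h /S alphaK//.
  rewrite (@integral_transport n)//; [|exact: mEn|exact: EnW|exact: mf].
  apply: eq_integral => x /set_mem[Wx _].
  by rewrite -[in RHS](psiK n Wx) fi//; exact: psiW.
rewrite (eq_esum E1) esum_esum//.
rewrite (_ : esum _ _ = \esum_(k in C `*`` (fun=> setT)) h k.1 k.2)%E; last first.
  apply/esym/(@reindex_esum _ _ _ _ _ (fun k : I * nat => (alpha k.2 k.1, k.2))).
  split.
  - by move=> [i n] [/= Ci _]; split => //; exact: alphaC.
  - move=> [i n] [i' n']; rewrite !inE/= => -[/= Ci _] [/= Ci' _] [+ nn].
    by rewrite -nn => aa; congr (_, _); rewrite -(alphaK n Ci) -(alphaK n Ci') aa.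
  - move=> [j n] [/= Cj _]; exists (beta n j, n); first by split => //; exact: betaC.
    by rewrite /= betaK.
rewrite -(@esum_esum _ _ _ C (fun=> setT) h)//.
apply: le_esum => j Cj.
rewrite -nneseries_esumT//.
have trS : trivIset setT (S j).
  apply/trivIsetP => n m _ _ nm; apply/seteqP; split => // y [[Wy Sn] [_ Sm]].
  have [[En1 En2] En3] := Sn; have [[Em1 Em2] Em3] := Sm.
  rewrite /= psiK// betaK// in En2; rewrite /= psiK// betaK// in Em2.
  have [ij xy] : beta n j = beta m j /\ psi n y = psi m y.
    apply: (injE n m) => //; try exact: betaC; by rewrite ?betaK ?psiK.
  case: (ltngtP n m) nm => // lt _.
    apply: (Em3 n lt); rewrite /= -xy psiK// -ij betaK//.
  by apply: (En3 m lt); rewrite /= xy psiK// ij betaK.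
rewrite -(@ge0_integral_bigcup _ _ _ mu (S j))//; last 2 first.
- by move=> n; exact: mS.
- by apply: measurable_funTS; exact: mf.
apply: ge0_subset_integral => //.
- by apply: bigcup_measurable => n _; exact: mS.
- exact: mE'.
- by apply: measurable_funTS; exact: mf.
- by move=> y [n _ [Wy [[_ /=]]]]; rewrite psiK// betaK.
Qed.
End transfer.

(** * Quotient measures *)

Section quotient.
Context d (T : measurableType d) (R : realType) (mu : {measure set T -> \bar R}).
Variables (Y : pointedType) (p : T -> Y) (W : set T) (mW : measurable W).
Variables (phi psi : nat -> T -> T).
Hypotheses (mphi : forall n, measurable_fun setT (phi n))
  (mpsi : forall n, measurable_fun setT (psi n)).
Hypotheses (phiW : forall n x, W x -> W (phi n x)) (psiW : forall n x, W x -> W (psi n x)).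
Hypotheses (phiK : forall n x, W x -> psi n (phi n x) = x)
  (psiK : forall n x, W x -> phi n (psi n x) = x).
Hypothesis inv : forall n (f : T -> \bar R), measurable_fun setT f -> (forall x, 0 <= f x)%E ->
  (\int[mu]_(x in W) f (phi n x) = \int[mu]_(x in W) f x)%E.
Hypothesis orbit_phi : forall n x, W x -> p (phi n x) = p x.
Hypothesis orbitP : forall x y, W x -> p x = p y -> exists n, y = phi n x.

Lemma preimage_orbits : p @^-1` (p @` W) = W.
Proof.
apply/seteqP; split; last by move=> x Wx; exists x.
by move=> x [y Wy /(orbitP Wy)[n ->]]; exact: phiW.
Qed.

(** The case of [transfer] of a constant function and a single index. *)
Lemma section_le (E F : set T) : measurable E -> measurable F -> E `<=` W ->
  set_inj E p -> (forall x, E x -> exists n, F (phi n x)) -> (mu E <= mu F)%E.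
Proof.
move=> mE mF EW injE cov.
have := @transfer _ T R mu W mW unit setT phi psi (fun=> id) (fun=> id) mphi mpsi psiW
  phiK psiK (fun _ _ => id) (fun _ _ => id) (fun _ _ _ => erefl) (fun _ _ _ => erefl)
  inv (fun _ => cst 1%E) (fun=> E) (fun=> F).
have esum_unit (q : unit -> \bar R) : (0 <= q tt)%E -> (\esum_(i in setT) q i = q tt)%E.
  move=> q0; rewrite -(esum_set1 q0); congr (esum _ _).
  by apply/seteqP; split => // -[].
rewrite (esum_unit (fun=> _)); last by apply: integral_ge0.
rewrite (esum_unit (fun=> _)); last by apply: integral_ge0.
rewrite !integral_cst// !mul1e; apply => //.
- move=> n n' i i' x x' _ _ Ex Ex' _ e; split; first by case: i i' => -[].
  by apply: injE; rewrite ?inE// -(orbit_phi n (EW _ Ex)) e orbit_phi//; exact: EW.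
- by move=> i x _; exact: cov.
Qed.

Variable F : set T.
Hypotheses (mF : measurable F) (FW : F `<=` W) (injF : set_inj F p)
  (covF : forall x, W x -> exists n, F (phi n x)).

(** The quotient measure is a supremum over partial sections; a strict
fundamental domain F gives the largest value by [section_le]. *)
Lemma quotient_measureE (B : set Y) : measurable (p @^-1` B) -> p @^-1` B `<=` W ->
  quotient_measure mu p B = mu (F `&` p @^-1` B).
Proof.
move=> mB BW; have mFB : measurable (F `&` p @^-1` B) by exact: measurableI.
apply/eqP; rewrite eq_le; apply/andP; split; last first.
  apply: ereal_sup_ubound; exists (F `&` p @^-1` B) => //; split => //.
  by move=> x y; rewrite !inE => -[Fx _] [Fy _]; apply: injF; rewrite inE.
apply: ge_ereal_sup => _ [E [mE EB injE] <-].
apply: section_le => //; first by move=> x /EB/BW.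
move=> x Ex; have Wx : W x by apply: BW; exact: EB.
have [n Fn] := covF Wx; exists n; split => //=; rewrite /preimage/= orbit_phi//; exact: EB.
Qed.

Let X : set (quotient_space p) := p @` W.

Lemma measurable_quotientP (B : set (quotient_space p)) :
  measurable (p @^-1` B) -> measurable B.
Proof.
by move=> mB; apply: sub_sigma_algebra; rewrite /image_set_system/= setTI.
Qed.

Lemma measurable_proj : measurable_fun setT (p : T -> quotient_space p).
Proof.
move=> _ B mB; rewrite setTI.
have sA : sigma_algebra [set: Y] (image_set_system setT p (@measurable d T)).
  by apply: sigma_algebra_image; exact: sigma_algebra_measurable.
by have := mB _ (conj sA (@subset_refl _ _)); rewrite /image_set_system/= setTI.
Qed.

Lemma measurable_orbits : measurable X.
Proof. by apply: measurable_quotientP; rewrite preimage_orbits. Qed.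

Lemma measurable_fun_orbits d' (V : measurableType d') (h : Y -> V) :
  measurable_fun W (h \o p) -> measurable_fun X (h : quotient_space p -> V).
Proof.
move=> mh _ B mB; apply: measurable_quotientP.
rewrite preimage_setI preimage_orbits; exact: mh.
Qed.

(** On the set of orbits the quotient measure is the image of the measure
restricted to F. *)
Lemma ge0_integral_orbits (h : Y -> \bar R) : measurable_fun W (h \o p) ->
  (forall y, 0 <= h y)%E ->
  (\int[quotient_measure mu p]_(y in X) h y = \int[mu]_(x in F) h (p x))%E.
Proof.
move=> mh h0; have mX := measurable_orbits; have mp := measurable_proj.
pose nu := measure_function_pushforward__canonical__measure_function_Measure (mrestr mu mF) mp.
rewrite (@eq_measure_integral _ _ _ _ nu).
  rewrite ge0_integral_pushforward//; last exact: measurable_fun_orbits.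
  rewrite preimage_orbits.
  rewrite integral_mkcond ge0_integral_mrestr.
  - rewrite [in RHS](_ : F = F `&` W); last by rewrite (setIidl FW).
    rewrite [RHS]integral_mkcondr; apply: eq_integral => x _.
    by [].
  - exact/(measurable_restrictT _ mW).
  - by move=> x; apply: erestrict_ge0 => y _; exact: h0.
move=> A mA AX; rewrite /nu/= /pushforward/= /mrestr setIC.
by apply: quotient_measureE; [have := mp measurableT _ mA; rewrite setTI|rewrite -preimage_orbits; exact: preimage_subset].
Qed.
End quotient.

(** * Measurable fundamental domains *)

Section measurable_order.
(** A total order whose comparison of measurable functions is measurable. *)
Definition measurable_order d (T : measurableType d) (le : rel T) :=
  [/\ total le, transitive le, antisymmetric le &
   forall d' (S : measurableType d') (f g : S -> T),
     measurable_fun setT f -> measurable_fun setT g -> measurable [set x | le (f x) (g x)]].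

Lemma measurable_order_real (R : realType) :
  @measurable_order _ (measurableTypeR R) (fun x y : R => x <= y).
Proof.
split; [exact: le_total|exact: le_trans|exact: le_anti|].
move=> d' S f g mf mg; rewrite -[X in measurable X]setTI.
exact: measurable_fun_le.
Qed.

Definition lex_prod (T1 T2 : Type) (le1 : rel T1) (le2 : rel T2) : rel (T1 * T2) :=
  fun p q => le1 p.1 q.1 && (le1 q.1 p.1 ==> le2 p.2 q.2).

Lemma measurable_order_lex d1 d2 (T1 : measurableType d1) (T2 : measurableType d2) le1 le2 :
  @measurable_order _ T1 le1 -> @measurable_order _ T2 le2 ->
  @measurable_order _ (T1 * T2)%type (lex_prod le1 le2).
Proof.
move=> [tot1 tr1 anti1 m1] [tot2 tr2 anti2 m2]; split.
- move=> [x1 x2] [y1 y2]; rewrite /lex_prod/=.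
  have := tot1 x1 y1; have := tot2 x2 y2.
  by case: (le1 x1 y1) (le1 y1 x1) (le2 x2 y2) => [] [] [].
- move=> [y1 y2] [x1 x2] [z1 z2]; rewrite /lex_prod/= => /andP[xy1 xy2] /andP[yz1 yz2].
  rewrite (tr1 _ _ _ xy1 yz1)/=; apply/implyP => zx.
  have yx := tr1 _ _ _ yz1 zx; have zy := tr1 _ _ _ zx xy1.
  by rewrite yx zy in xy2 yz2; exact: tr2 yz2.
- move=> [x1 x2] [y1 y2]; rewrite /lex_prod/= => /andP[/andP[xy1 xy2] /andP[yx1 yx2]].
  rewrite xy1 yx1 in xy2 yx2; congr (_, _); first by apply: anti1; rewrite xy1 yx1.
  by apply: anti2; move: xy2 yx2 => /= -> ->.
- move=> d' S f g mf mg.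
  rewrite (_ : [set x | _] = [set x | le1 (f x).1 (g x).1] `&`
     (~` [set x | le1 (g x).1 (f x).1] `|` [set x | le2 (f x).2 (g x).2])).
    apply: measurableI; last apply: measurableU; last 2 first.
    + by apply: measurableC; apply: m1; exact: measurableT_comp.
    + by apply: m2; exact: measurableT_comp.
    + by apply: m1; exact: measurableT_comp.
  apply/seteqP; split => x /=.
    by move=> /andP[-> /implyP h]; split => //; have [/h|] := boolP (le1 (g x).1 (f x).1); [right|left; exact/negP].
  by rewrite /lex_prod => -[-> [/negP/negbTE->|->]] //=; rewrite implybT.
Qed.
End measurable_order.

Section measurable_section.
Context d (T : measurableType d) (Y : Type) (p : T -> Y) (W : set T) (mW : measurable W).
Variable phi : nat -> T -> T.
Hypotheses (mphi : forall n, measurable_fun setT (phi n)).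
Hypotheses (phiW : forall n x, W x -> W (phi n x)).
Hypothesis orbit_phi : forall n x, W x -> p (phi n x) = p x.
Hypothesis orbitP : forall x y, W x -> p x = p y -> exists n, y = phi n x.
Variables (B : nat -> set T) (mB : forall k, measurable (B k)).
Hypothesis coverB : forall x, W x -> exists k, B k x.
Hypothesis finB : forall k x, W x -> finite_set [set y | B k y /\ exists n, y = phi n x].
Variables (le : rel T) (mle : measurable_order le).

(** Take in each orbit the least point among the finitely many ones in the
first B k that the orbit meets. That x is this point is a countable condition:
no translate lies in an earlier B j, and every translate in B k is at least x.
*)
Lemma measurable_section : exists F,
  [/\ measurable F, F `<=` W, set_inj F p & forall x, W x -> exists n, F (phi n x)].
Proof.
have [tot tr anti mo] := mle.
pose Fk k := B k `&` \bigcap_n (\bigcap_(j in `I_k) ~` (phi n @^-1` B j) `&`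
   (~` (phi n @^-1` B k) `|` [set x | le x (phi n x)])).
have mpB n k : measurable (phi n @^-1` B k).
  by rewrite -[X in measurable X]setTI; exact: mphi.
exists (W `&` \bigcup_k Fk k); split.
- apply: measurableI => //; apply: bigcupT_measurable => k; apply: measurableI => //.
  apply: bigcapT_measurable => n; apply: measurableI.
    by apply: bigcap_measurableType => // j _; exact: measurableC.
  by apply: measurableU; [exact: measurableC|apply: mo].
- by move=> x [].
- move=> x y; rewrite !inE => -[Wx [k _ [Bkx hx]]] [Wy [k' _ [Bky hy]]] pxy.
  have [n yE] := orbitP Wx pxy; have [m xE] := orbitP Wy (esym pxy).
  have [hx1 hx2] := hx n Logic.I; have [hy1 hy2] := hy m Logic.I.
  rewrite /= -yE in hx1 hx2; rewrite /= -xE in hy1 hy2.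
  (* Each of two equivalent selected points excludes that the other one lies
     in an earlier set. *)
  have kk : k = k'.
    by case: (ltngtP k k') => // lt; [case: (hy1 _ lt)|case: (hx1 _ lt)]; rewrite /= -?yE -?xE.
  rewrite -kk in hy2 Bky; apply: anti.
  by case: hx2 => // ->; case: hy2 => // ->.
- move=> x Wx.
  have exk : exists k, `[< exists n, B k (phi n x) >].
    have [k Bk] := coverB Wx; exists k; apply/asboolP.
    by have [n xE] := orbitP Wx (erefl (p x)); exists n; rewrite -xE.
  have [k /asboolP[n0 Bn0] kmin] := ex_minnP exk.
  have [|y [By [n yE]] ymin] := @finite_argmin _ le _ tot tr (finB k Wx).
    by exists (phi n0 x); split => //; exists n0.
  exists n; rewrite -yE; have Wy : W y by rewrite yE; exact: phiW.
  have orb m : exists n', phi m y = phi n' x.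
    by apply: orbitP => //; rewrite orbit_phi// yE orbit_phi.
  split => //; exists k => //; split => // m _; have [n' E] := orb m; split.
    move=> j /= jk; rewrite E => Bj; have : `[< exists n, B j (phi n x) >] by apply/asboolP; exists n'.
    by move=> /kmin; rewrite leqNgt jk.
  rewrite /= E; have [Bk|nBk] := pselect (B k (phi n' x)); [right|by left].
  by apply: ymin; split => //; exists n'.
Qed.
End measurable_section.

(** * Discreteness *)

Section matrix_enumeration.
Import VectorInternalTheory.

(** K has finite dimension over the rationals, so matrices are encoded by
their rational coordinates. *)
Lemma matrix_enum (K : fieldExtType rat) (S : set 'M[K]_2) : S !=set0 ->
  exists e : nat -> 'M[K]_2, (forall n, S (e n)) /\ forall M, S M -> exists n, e n = M.
Proof.
move=> [M0 SM0].
pose e0 n : 'M[K]_2 := map_mx (@r2v _ K) (odflt 0 (choice.unpickle n : option 'M['rV[rat]_(dim K)]_2)).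
exists (fun n => if `[< S (e0 n) >] then e0 n else M0); split.
  by move=> n; case: asboolP.
move=> M SM; exists (choice.pickle (map_mx (@v2r _ K) M)).
have -> : e0 (choice.pickle (map_mx (@v2r _ K) M)) = M.
  by rewrite /e0 choice.pickleK/=; apply/matrixP => i j; rewrite !mxE v2rK.
by case: asboolP.
Qed.

Lemma matrix_inj_nat (K : fieldExtType rat) : exists c : 'M[K]_2 -> nat, injective c.
Proof.
exists (fun M => choice.pickle (map_mx (@v2r _ K) M : 'M['rV[rat]_(dim K)]_2)).
move=> M M' /(pcan_inj choice.pickleK) /matrixP E; apply/matrixP => i j.
by have := E i j; rewrite !mxE => /(can_inj v2rK).
Qed.

End matrix_enumeration.

Lemma ord2 (k : 'I_2) : k = 0 \/ k = 1.
Proof. by case: k => [[|[|]]]//= ?; [left|right]; apply/val_inj. Qed.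

Lemma finite_mx2 (F : pzRingType) (S : set F) : finite_set S ->
  finite_set [set M : 'M[F]_2 | forall i j, S (M i j)].
Proof.
move=> Sf; apply: (@sub_finite_set _ _
  ((fun q : (F * F) * (F * F) => mx2 q.1.1 q.1.2 q.2.1 q.2.2) @` ((S `*` S) `*` (S `*` S)))).
  move=> M SM; exists ((M 0 0, M 0 1), (M 1 0, M 1 1)); first by split; split; exact: SM.
  by apply: eq_mx2; rewrite !mxE.
by apply: finite_image; do 2 apply: finite_setX.
Qed.

Section boxes.
Variable R : realType.
Local Notation RR := (measurableTypeR R).

(** A compact exhaustion of the upper half plane. *)
Definition box (k : nat) : set (RR * RR) :=
  [set p | [/\ `|p.1 : R| <= k.+1%:R, (k.+1%:R)^-1 <= (p.2 : R) & (p.2 : R) <= k.+1%:R]].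

Lemma box_cover (p : RR * RR) : HH p -> exists k, forall k', (k <= k')%N -> box k' p.
Proof.
rewrite /HH/= => y0.
pose M := Num.max `|p.1| (Num.max p.2^-1 p.2).
have M0 : 0 <= M by rewrite le_max normr_ge0.
exists (Num.bound M) => k' kk.
have Mk : M <= k'.+1%:R.
  rewrite (le_trans (ltW (archi_boundP M0)))// ler_nat; exact: leqW.
move: Mk; rewrite !ge_max => /and3P[h1 h2 h3]; split => //.
by rewrite -[p.2]invrK lef_pV2// posrE ?invr_gt0.
Qed.

Lemma measurable_box k : measurable (box k).
Proof.
rewrite (_ : box k = [set p : RR * RR | (`|p.1 : R| <= k.+1%:R)] `&`
  ([set p : RR * RR | ((k.+1%:R)^-1 <= (p.2 : R))] `&` [set p : RR * RR | (p.2 : R) <= k.+1%:R])); last first.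
  by apply/seteqP; split => [p [? ? ?]|p [? [? ?]]].
have m1 : measurable_fun setT (fun p : RR * RR => p.1 : R) by exact: measurable_fst.
have m2 : measurable_fun setT (fun p : RR * RR => p.2 : R) by exact: measurable_snd.
apply: measurableI; last apply: measurableI.
- rewrite -[X in measurable X]setTI; apply: measurable_fun_le => //.
  exact: (measurableT_comp (@normr_measurable R setT)).
- by rewrite -[X in measurable X]setTI; apply: measurable_fun_le.
- by rewrite -[X in measurable X]setTI; apply: measurable_fun_le.
Qed.
End boxes.

Section discreteness.
Variables (R : realType) (K : fieldExtType rat).
Variables (iota : {rmorphism K -> R}) (conj : {rmorphism K -> K}).
Hypotheses (quadK : \dim {:K} = 2%N) (conjN1 : exists x, conj x != x).
Variables (b1 b2 : K).
Hypothesis ib : integral_basis b1 b2.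
Variable a : set K.
Hypothesis ida : fractional_ideal a.
Local Notation OK := (@OK K).
Local Notation s1 := iota.
Local Notation s2 := (iota2 iota conj).
Local Notation RR := (measurableTypeR R).
Local Notation H2T := ((RR * RR) * (RR * RR))%type.
Implicit Types (z : H2T) (M : 'M[K]_2).
Let conjK : involutive conj := conjK quadK conjN1.
Local Notation act := (hilbert_act iota conj).

(** If M p lies in the box then the bottom row of M has bounded depth at p,
and so has the top row, which is the pair (1, 0) seen from M p ([depth_mul]).
*)
Lemma box_entries (s : {rmorphism K -> R}) k (p : RR * RR) : HH p ->
  exists B, forall M, \det M = 1 -> box k (moebius (map_mx s M) p) ->
    forall i j, `|s (M i j)| <= B.
Proof.
move=> Hp; pose D0 : R := (k.+1%:R + k.+1%:R) * k.+1%:R ^+ 2.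
pose B1 := 1 + D0 / p.2; pose B2 := 1 + D0 * p.2 + (1 + D0 / p.2) * `|p.1|.
exists (Num.max B1 B2) => M dM [x1 y1 y2].
have k1 : 1 <= k.+1%:R :> R by rewrite ler1n.
have k0 : 0 < k.+1%:R :> R by rewrite ltr0n.
have Hq : HH (moebius (map_mx s M) p) by apply: moebius_HH => //; rewrite det_map_mx1.
rewrite /HH/= in Hq.
have kk : (k.+1%:R : R) <= D0.
  rewrite /D0 -{1}[k.+1%:R]mulr1; apply: ler_pM => //; first by rewrite lerDl ltW.
  by rewrite exprn_ege1.
have d1 : depth s (M 1 0) (M 1 1) p <= D0.
  apply: le_trans kk; rewrite -[X in X <= _]invrK -(moebius_height s dM Hp).
  by rewrite -[k.+1%:R]invrK lef_pV2// posrE invr_gt0.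
have d2 : depth s (M 0 0) (M 0 1) p <= D0.
  have := depth_mul s 1 0 dM Hp; rewrite !mul1r !mul0r !addr0 => ->.
  rewrite /depth rmorph1 rmorph0 !mul1r addr0.
  move: (moebius _ p) x1 y1 y2 Hq => [x y] /= x1 y1 y2 _.
  have Hq : 0 < y by rewrite (lt_le_trans _ y1)// invr_gt0.
  rewrite ler_pdivrMr//.
  rewrite /D0.
  have xx : x ^+ 2 <= k.+1%:R ^+ 2 by rewrite -real_normK ?num_real// lerXn2r ?nnegrE.
  have yy : y ^+ 2 <= k.+1%:R ^+ 2 by rewrite lerXn2r ?nnegrE// ltW.
  have ky : 1 <= k.+1%:R * y by rewrite mulrC -ler_pdivrMr// div1r.
  apply: le_trans (lerD xx yy) _.
  rewrite -mulr2n -[X in X <= _]mulr_natl.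
  have -> : (k.+1%:R + k.+1%:R) * k.+1%:R ^+ 2 * y = 2 * k.+1%:R ^+ 2 * (k.+1%:R * y) :> R by ring.
  by rewrite ler_peMr// mulr_ge0// exprn_ge0.
have [c1 c2] := depth_bound Hp d1; have [c3 c4] := depth_bound Hp d2.
by move=> i j; have [->|->] := ord2 i; have [->|->] := ord2 j; rewrite le_max ?c1 ?c2 ?c3 ?c4 ?orbT.
Qed.

Lemma Gamma_denom : exists2 n, (0 < n)%N & forall M, Gamma a M -> forall i j, OK (n%:R * M i j).
Proof.
have [n n0 nP] := ideal_denom quadK conjN1 ida.
have [n' n'0 n'P] := ideal_denom quadK conjN1 (idealV_fractional quadK conjN1 ida).
have On := OK_nat K.
exists (n * n')%N; first by rewrite muln_gt0 n0.
move=> M [M00 M01 a10 M11 _] i j; rewrite natrM.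
have [->|->] := ord2 i; have [->|->] := ord2 j.
- by apply: OKM => //; apply: OKM.
- by rewrite -mulrA; apply: OKM => //; exact: n'P.
- by rewrite mulrAC; apply: OKM => //; exact: nP.
- by apply: OKM => //; apply: OKM.
Qed.

Lemma bounded_matrices_finite n (B : R) : (0 < n)%N ->
  finite_set [set M : 'M[K]_2 | forall i j,
    [/\ OK (n%:R * M i j), `|s1 (M i j)| <= B & `|s2 (M i j)| <= B]].
Proof. by move=> n0; apply: finite_mx2 (bounded_finite iota quadK conjN1 ib B n0). Qed.

Lemma Gamma_discrete k z : HH2 z ->
  finite_set [set M | Gamma a M /\ (box k `*` box k) (act M z)].
Proof.
move=> [z1 z2]; have [n n0 nP] := Gamma_denom.
have [B1 B1P] := box_entries s1 k z1; have [B2 B2P] := box_entries s2 k z2.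
apply: sub_finite_set (bounded_matrices_finite (Num.max B1 B2) n0).
move=> M [GM [/= h1 h2]] i j; have [_ _ _ _ dM] := GM.
by split; [exact: nP|rewrite le_max B1P|rewrite le_max B2P ?orbT].
Qed.

Lemma mx_entry_bound (X Y : 'M[R]_2) (x y : R) : (forall i j, `|X i j| <= x) ->
  (forall i j, `|Y i j| <= y) -> forall i j, `|(X *m Y) i j| <= x * y + x * y.
Proof.
move=> hx hy i j; rewrite mulmx2E (le_trans (ler_normD _ _))// !normrM.
by apply: lerD; apply: ler_pM.
Qed.

Lemma mx_bounded (X : 'M[R]_2) : exists x, forall i j, `|X i j| <= x.
Proof.
exists (`|X 0 0| + `|X 0 1| + (`|X 1 0| + `|X 1 1|)) => i j.
have [->|->] := ord2 i; have [->|->] := ord2 j.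
- by rewrite -addrA lerDl !addr_ge0.
- by rewrite -addrA addrCA lerDl !addr_ge0.
- by rewrite addrCA lerDl !addr_ge0.
- by rewrite addrA lerDr !addr_ge0.
Qed.

Definition stab (A : 'M[K]_2) : set 'M[K]_2 :=
  [set M | Gamma a M /\ (lact conj M A = A \/ lact conj M A = - A)].

(** The entries of M are bounded at the second place by [box_entries]. The
relation M A conj(M)^T = A or - A expresses M through A and the adjugate of
conj(M)^T, so they are bounded at the first place too. *)
Lemma stab_discrete k A (p : RR * RR) : \det A != 0 -> HH p ->
  finite_set [set M | stab A M /\ box k (moebius (map_mx s2 M) p)].
Proof.
move=> dA Hp; have [n n0 nP] := Gamma_denom.
have [B BP] := box_entries s2 k Hp.
have [xA xAP] := mx_bounded (map_mx s1 A).
have [yA yAP] := mx_bounded (map_mx s1 (adj2 A)).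
pose c := xA * B + xA * B; pose c' := c * yA + c * yA.
have sdA : s1 (\det A) != 0 by rewrite fmorph_eq0.
pose B' := c' / `|s1 (\det A)|.
apply: sub_finite_set (bounded_matrices_finite (Num.max B' B) n0).
move=> M [[GM MA] Mp] i j; have [_ _ _ _ dM] := GM.
split; [exact: nP| |by rewrite le_max BP ?orbT].
rewrite le_max; apply/orP; left.
have bM := BP _ dM Mp.
pose Y := adj2 (map_mx conj M)^T.
have E : lact conj M A *m Y *m adj2 A = \det A *: M.
  rewrite /lact -!mulmxA [(map_mx conj M)^T *m _]mulmxA mul_adj2 det_tr det_map_mx dM rmorph1.
  by rewrite mul1mx mul_adj2 mul_mx_scalar.
have bY i' j' : `|map_mx s1 Y i' j'| <= B.
  have [E00 E01 E10 E11] := adj2E (map_mx conj M)^T.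
  rewrite mxE /Y; have [->|->] := ord2 i'; have [->|->] := ord2 j';
    rewrite ?E00 ?E01 ?E10 ?E11 ?(rmorphN s1) ?normrN !mxE; exact: bM.
have key : `|map_mx s1 (A *m Y *m adj2 A) i j| <= c'.
  rewrite !map_mxM; apply: mx_entry_bound => // i' j'.
  exact: mx_entry_bound.
rewrite /B' ler_pdivlMr ?normr_gt0// -normrM mulrC -(rmorphM s1).
have -> : \det A * M i j = (\det A *: M) i j by rewrite mxE.
rewrite -E; case: MA => ->; first by move: key; rewrite mxE.
by rewrite !mulNmx mxE (rmorphN s1) normrN; move: key; rewrite mxE.
Qed.
End discreteness.

(** * Countable sums and the invariant measure *)

Section countable_sums.
Variables (R : realType) (I : choiceType) (i0 : I) (c : I -> nat).
Hypothesis injc : injective c.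

(** Reduces a sum over an index set with an injective code in the natural
numbers to a series. *)
Lemma esum_series (C : set I) (u : I -> \bar R) : (forall i, 0 <= u i)%E ->
  (\esum_(i in C) u i = \sum_(n <oo) (if n \in c @` C then u (xget i0 [set i | c i = n]) else 0))%E.
Proof.
move=> u0; have cK i : xget i0 [set j | c j = c i] = i.
  by apply: xget_unique => // j /injc.
rewrite nneseries_esumT; last by move=> n; case: ifP.
rewrite -(@esum_mkcond _ _ (c @` C) (fun n => u (xget i0 [set i | c i = n]))).
rewrite (@reindex_esum _ _ _ C (c @` C) c).
  by apply: eq_esum => i _; rewrite cK.
split; first by move=> i Ci; exists i.
  by move=> i j _ _ /injc.
by move=> n [i Ci <-]; exists i.
Qed.

Variables (d : measure_display) (T : measurableType d) (mu : {measure set T -> \bar R}).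

Lemma measurable_esum (C : set I) (f : I -> T -> \bar R) :
  (forall i, measurable_fun setT (f i)) -> (forall i x, 0 <= f i x)%E ->
  measurable_fun setT (fun x => \esum_(i in C) f i x)%E.
Proof.
move=> mf f0; rewrite (_ : (fun x => _) = (fun x => \sum_(n <oo)
  (if n \in c @` C then f (xget i0 [set i | c i = n]) x else 0)))%E; last first.
  by apply/funext => x; rewrite (@esum_series C (f ^~ x))// => i; exact: f0.
apply: ge0_emeasurable_sum.
  by move=> n x _ _; case: ifP => _; [exact: f0|].
by move=> n _; case: (n \in c @` C); [exact: mf|exact: measurable_cst].
Qed.

Lemma ge0_integral_esum (D : set T) (C : set I) (f : I -> T -> \bar R) : measurable D ->
  (forall i, measurable_fun setT (f i)) -> (forall i x, 0 <= f i x)%E ->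
  (\int[mu]_(x in D) (\esum_(i in C) f i x) = \esum_(i in C) \int[mu]_(x in D) f i x)%E.
Proof.
move=> mD mf f0.
under eq_integral => x _ do rewrite (@esum_series C (f ^~ x))//.
rewrite integral_nneseries//; last 2 first.
- move=> n; case: (n \in c @` C); [|exact: measurable_cst].
  exact: measurable_funTS.
- by move=> n x _; case: ifP => _; [exact: f0|].
rewrite esum_series; last by move=> i; apply: integral_ge0.
apply: eq_eseriesr => n _; case: ifP => // _.
by rewrite integral0.
Qed.
End countable_sums.

Section omega2.
Variable R : realType.
Local Notation RR := (measurableTypeR R).
Local Notation H2T := ((RR * RR) * (RR * RR))%type.
Local Notation eta := (@Defs.eta R).

Lemma measurable_HH : measurable (@HH R).
Proof.
rewrite (_ : @HH R = snd @^-1` `]0%R, +oo[%classic).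
  by rewrite -[X in measurable X]setTI; exact: measurable_snd.
by apply/seteqP; split => p; rewrite /HH/= in_itv/= andbT.
Qed.

Lemma measurable_HH2 : measurable (@HH2 R).
Proof. by apply: measurableX; exact: measurable_HH. Qed.

Let md1 : measurable_fun setT (fun z : H2T => (eta_density z.1)%:E).
Proof.
by apply/measurable_EFinP; exact: (measurableT_comp (@measurable_eta_density R)).
Qed.

Lemma measurable_inner_integral (A : set (RR * RR)) (f : H2T -> \bar R) : measurable A ->
  measurable_fun setT f -> (forall z, 0 <= f z)%E ->
  measurable_fun setT (fun w => \int[eta]_(v in A) f (v, w))%E.
Proof.
move=> mA mf f0.
have mf1 w : measurable_fun setT (fun v => f (v, w)).
  exact: (measurableT_comp mf (measurable_pair2 w)).
rewrite (_ : (fun w => _) = (fun w => \int[@lebesgue2 R]_v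
    ((\1_A v)%:E * (f (v, w) * (eta_density v)%:E)))%E); last first.
  apply/funext => w; rewrite ge0_integral_density// integral_mkcond.
  apply: eq_integral => v _; rewrite patchE indicE.
  by case: (v \in A); rewrite ?mul1e ?mul0e.
apply: (measurable_fun_fubini_tonelli_G (m1 := @lebesgue2 R)
  (fun z : H2T => ((\1_A z.1)%:E * (f z * (eta_density z.1)%:E))%E)).
- apply: emeasurable_funM; last exact: emeasurable_funM.
  apply/measurable_EFinP; apply: (measurableT_comp (measurable_indic mA)).
  exact: measurable_fst.
- move=> z; apply: mule_ge0; first by rewrite lee_fin.
  by apply: mule_ge0 => //; rewrite lee_fin eta_density_ge0.
Qed.

(** The square of eta1 + eta2 is 2 eta1 eta2. *)
Lemma integral_omega2 (A B : set (RR * RR)) (f : H2T -> \bar R) : measurable A -> measurable B ->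
  measurable_fun setT f -> (forall z, 0 <= f z)%E ->
  (\int[@omega2 R]_(z in A `*` B) f z =
   2%:E * \int[eta]_(w in B) \int[eta]_(v in A) f (v, w))%E.
Proof.
move=> mA mB mf f0.
have mAB := measurableX mA mB.
have e0 (p : RR * RR) : (0 <= (eta_density p)%:E :> \bar R)%E by rewrite lee_fin eta_density_ge0.
have me : measurable_fun setT (fun p : RR * RR => (eta_density p)%:E).
  by apply/measurable_EFinP; exact: measurable_eta_density.
have mf1 w : measurable_fun setT (fun v => f (v, w)).
  exact: (measurableT_comp mf (measurable_pair2 w)).
have mi := measurable_inner_integral mA mf f0.
have i0 w : (0 <= \int[eta]_(v in A) f (v, w))%E by apply: integral_ge0.
rewrite [in LHS]/omega2 ge0_integral_density//.
rewrite integral_mkcond.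
pose h (z : H2T) := ((\1_A z.1)%:E * ((\1_B z.2)%:E * (f z * (2 * (eta_density z.1 * eta_density z.2))%:E)))%E.
have h0 z : (0 <= h z)%E.
  rewrite /h; apply: mule_ge0; first by rewrite lee_fin.
  apply: mule_ge0; first by rewrite lee_fin.
  by apply: mule_ge0 => //; rewrite lee_fin !mulr_ge0// eta_density_ge0.
have mh : measurable_fun setT h.
  apply: emeasurable_funM.
    by apply/measurable_EFinP; apply: (measurableT_comp (measurable_indic mA)); exact: measurable_fst.
  apply: emeasurable_funM.
    by apply/measurable_EFinP; apply: (measurableT_comp (measurable_indic mB)); exact: measurable_snd.
  apply: emeasurable_funM => //; apply/measurable_EFinP; exact: measurable_omega2_density.
transitivity (\int[@lebesgue2 R \x @lebesgue2 R]_z h z)%E.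
  apply: eq_integral => -[v w] _; rewrite patchE /h /= !indicE.
  have -> : ((v, w) \in A `*` B) = (v \in A) && (w \in B) by rewrite in_setX.
  by case: (v \in A) => /=; case: (w \in B) => /=; rewrite ?mul1e ?mul0e.
rewrite (fubini_tonelli2 (m1 := @lebesgue2 R) (m2 := @lebesgue2 R))// /fubini_G.
rewrite ge0_integral_density// [in RHS]integral_mkcond.
have mBi : measurable_fun setT ((fun w => (\int[eta]_(v in A) f (v, w)) * (eta_density w)%:E) \_ B)%E.
  apply/(measurable_restrictT _ mB); apply: measurable_funTS; exact: emeasurable_funM.
rewrite -integralZl_ge0//; last first.
  by move=> w; apply: erestrict_ge0 => w' _; exact: mule_ge0.
apply: eq_integral => w _; rewrite patchE /h /=.
case: ifPn => wB; last first.
  have -> : (2%:E * point = 0 :> \bar R)%E by exact: mule0.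
  by apply: integral0_eq => v _; rewrite [\1_B w]indicE (negbTE wB) mul0e mule0.
have -> : (\int[@lebesgue2 R]_v ((\1_A v)%:E * ((\1_B w)%:E * (f (v, w) * (2 * (eta_density v * eta_density w))%:E))) =
   \int[@lebesgue2 R]_v ((2 * eta_density w)%:E * ((\1_A v)%:E * (f (v, w) * (eta_density v)%:E))))%E.
  apply: eq_integral => v _; rewrite [\1_B w]indicE wB mul1e [in RHS]muleCA.
  congr (_ * _)%E; rewrite [in RHS]muleCA; congr (_ * _)%E; rewrite -EFinM; congr (_%:E); ring.
rewrite integralZl_ge0//.
- rewrite EFinM -muleA; congr (_ * _)%E; rewrite muleC; congr (_ * _)%E.
  rewrite ge0_integral_density// [in RHS]integral_mkcond; apply: eq_integral => v _.
  by rewrite patchE indicE; case: (v \in A); rewrite ?mul1e ?mul0e.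
- by rewrite mulr_ge0// eta_density_ge0.
- apply: emeasurable_funM; first by apply/measurable_EFinP; exact: measurable_indic.
  exact: emeasurable_funM.
- move=> v; apply: mule_ge0; first by rewrite lee_fin.
  exact: mule_ge0.
Qed.

Lemma integral_omega2_moebius (M1 M2 : 'M[R]_2) (f : H2T -> \bar R) :
  \det M1 = 1 -> \det M2 = 1 -> measurable_fun setT f -> (forall z, 0 <= f z)%E ->
  (\int[@omega2 R]_(z in @HH2 R) f (moebius M1 z.1, moebius M2 z.2) =
   \int[@omega2 R]_(z in @HH2 R) f z)%E.
Proof.
move=> d1 d2 mf f0; have mH := measurable_HH.
have m12 : measurable_fun setT (fun z : H2T => (moebius M1 z.1, moebius M2 z.2) : H2T).
  apply: (@measurable_fun_pair _ _ _ H2T _ _ (moebius M1 \o fst) (moebius M2 \o snd));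
  by apply: measurableT_comp => //; exact: measurable_moebius.
rewrite (integral_omega2 mH mH (measurableT_comp mf m12))//; last by move=> z; exact: f0.
rewrite (integral_omega2 mH mH mf f0); congr (_ * _)%E.
rewrite -(integral_eta_moebius d2 (measurable_inner_integral mH mf f0)); last first.
  by move=> w; apply: integral_ge0.
apply: eq_integral => w _ /=.
rewrite -(@integral_eta_moebius _ M1 (fun v => f (v, moebius M2 w)))//.
exact: (measurableT_comp mf (measurable_pair2 _)).
Qed.
End omega2.

(** * Fundamental domains of the two actions *)

Section orbits.
Variables (R : realType) (K : fieldExtType rat).
Variables (iota : {rmorphism K -> R}) (conj : {rmorphism K -> K}) (D : int).
Hypotheses (quadK : \dim {:K} = 2%N) (conjN1 : exists x, conj x != x).
Variables (b1 b2 : K).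
Hypothesis ib : integral_basis b1 b2.
Variable a : set K.
Hypothesis ida : fractional_ideal a.
Local Notation OK := (@OK K).
Local Notation s1 := iota.
Local Notation s2 := (iota2 iota conj).
Local Notation RR := (measurableTypeR R).
Local Notation H2T := ((RR * RR) * (RR * RR))%type.
Implicit Types (z : H2T) (M : 'M[K]_2).
Let conjK : involutive conj := conjK quadK conjN1.
Local Notation act := (hilbert_act iota conj).
Local Notation act2 M := (moebius (map_mx s2 M)).
Local Notation orb := (orbitH2 iota conj a).
Local Notation stab := (stab conj a).

Lemma Gamma_det M : Gamma a M -> \det M = 1.
Proof. by case. Qed.

Lemma orbitH2E z : orb z = [set act M z | M in Gamma a].
Proof.
have E M : map_mx iota (map_mx conj M) = map_mx s2 M.
  by apply/matrixP => i j; rewrite !mxE.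
by rewrite /orbitH2 /real_mx /hilbert_act; apply: eq_imagel => M _; rewrite E.
Qed.

Lemma act1T z : act 1%:M z = z.
Proof. by case: z => z1 z2; rewrite /hilbert_act !map_mx1 !moebius1. Qed.

Lemma actK M z : \det M = 1 -> HH2 z -> act (adj2 M) (act M z) = z.
Proof.
move=> d Hz; rewrite -actM//; first by rewrite adj2_mul d act1T.
by have := adj2_mul M; rewrite d => /(congr1 determinant); rewrite det_mulmx d det1 mulr1.
Qed.

Lemma det_adj2 (F : comPzRingType) (M : 'M[F]_2) : \det (adj2 M) = \det M.
Proof. by have [E00 E01 E10 E11] := adj2E M; rewrite !det2E E00 E01 E10 E11; ring. Qed.

Lemma actVK M z : \det M = 1 -> HH2 z -> act M (act (adj2 M) z) = z.
Proof.
move=> d Hz; rewrite -actM ?det_adj2//.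
by rewrite mul_adj2 d act1T.
Qed.

Lemma orb_self z : orb z z.
Proof.
by rewrite orbitH2E; exists 1%:M; [exact: (Gamma1 ida)|exact: act1T].
Qed.

Lemma orb_act M z : Gamma a M -> HH2 z -> orb (act M z) = orb z.
Proof.
move=> GM Hz; have dM := Gamma_det GM; rewrite !orbitH2E; apply/seteqP; split => _ [M' GM' <-].
  exists (M' *m M); first exact: (GammaM ida).
  by rewrite actM// Gamma_det.
exists (M' *m adj2 M); first by apply: (GammaM ida) => //; exact: (GammaV ida).
by rewrite -actM ?det_mulmx ?det_adj2 ?dM ?Gamma_det ?mulr1// -mulmxA adj2_mul dM mulmx1.
Qed.

Lemma orb_eqP z z' : orb z = orb z' -> exists2 M, Gamma a M & z' = act M z.
Proof.
move=> E; have := orb_self z'; rewrite -E orbitH2E => -[M GM <-]; by exists M.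
Qed.

Lemma measurable_act M : measurable_fun setT (act M).
Proof.
apply: (@measurable_fun_pair _ _ _ H2T _ _ (moebius (map_mx s1 M) \o fst) (act2 M \o snd));
by apply: measurableT_comp => //; exact: measurable_moebius.
Qed.

Lemma integral_act M (f : H2T -> \bar R) : \det M = 1 -> measurable_fun setT f ->
  (forall z, 0 <= f z)%E ->
  (\int[@omega2 R]_(z in @HH2 R) f (act M z) = \int[@omega2 R]_(z in @HH2 R) f z)%E.
Proof. by move=> d mf f0; apply: integral_omega2_moebius => //; rewrite det_map_mx1. Qed.

Lemma Gamma_enum : exists e : nat -> 'M[K]_2,
  (forall n, Gamma a (e n)) /\ forall M, Gamma a M -> exists n, e n = M.
Proof. by apply: matrix_enum; exists 1%:M; exact: (Gamma1 ida). Qed.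

(** The last clause applies to nonnegative functions on the quotient; they are
measurable as soon as their lifts are. *)
Lemma Gamma_domain : exists F : set H2T,
  [/\ measurable F, F `<=` @HH2 R, set_inj F orb,
      forall z, HH2 z -> exists2 M, Gamma a M & F (act M z) &
      forall h : set H2T -> \bar R, measurable_fun (@HH2 R) (h \o orb) -> (forall O, 0 <= h O)%E ->
        @measurable_fun _ _ (quotient_space orb) _ (X iota conj a) h /\
        (\int[omega2X iota conj a]_(O in X iota conj a) h O = \int[@omega2 R]_(z in F) h (orb z))%E].
Proof.
have [e [Ge eG]] := Gamma_enum.
have de n := Gamma_det (Ge n); have dV n : \det (adj2 (e n)) = 1 by rewrite det_adj2.
have mphi n := measurable_act (e n); have mpsi n := measurable_act (adj2 (e n)).
have phiW n z : HH2 z -> HH2 (act (e n) z) by exact: act_HH2.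
have psiW n z : HH2 z -> HH2 (act (adj2 (e n)) z) by exact: act_HH2.
have phiK n z : HH2 z -> act (adj2 (e n)) (act (e n) z) = z by exact: actK.
have psiK n z : HH2 z -> act (e n) (act (adj2 (e n)) z) = z by exact: actVK.
have orb_phi n z : HH2 z -> orb (act (e n) z) = orb z by exact: orb_act.
have orbP z z' : HH2 z -> orb z = orb z' -> exists n, z' = act (e n) z.
  by move=> _ /orb_eqP[M /eG[n <-] ->]; exists n.
have mo := @measurable_order_real R.
have mo2 := @measurable_order_lex _ _ RR RR _ _ mo mo.
have mo4 := @measurable_order_lex _ _ (RR * RR)%type (RR * RR)%type _ _ mo2 mo2.
pose B k : set H2T := box k `*` box k.
have mB k : measurable (B k) by apply: measurableX; exact: measurable_box.
have coverB z : HH2 z -> exists k, B k z.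
  move=> [/box_cover[k1 k1P] /box_cover[k2 k2P]]; exists (maxn k1 k2).
  by split; [apply: k1P; exact: leq_maxl|apply: k2P; exact: leq_maxr].
have finB k z : HH2 z -> finite_set [set y | B k y /\ exists n, y = act (e n) z].
  move=> Hz.
  apply: sub_finite_set (finite_image (act ^~ z) (Gamma_discrete iota quadK conjN1 ib ida k Hz)).
  by move=> y [By [n yE]]; exists (e n) => //; split => //; rewrite -yE.
have [F [mF FW injF covF]] := @measurable_section _ H2T _ orb (@HH2 R) (@measurable_HH2 R) (fun n => act (e n)) mphi phiW orb_phi orbP B mB coverB finB _ mo4.
exists F; split => //.
  by move=> z /covF[n Fn]; exists (e n).
move=> h mh h0; split.
  exact: (@measurable_fun_orbits _ H2T (set H2T) orb (@HH2 R) (@measurable_HH2 R) (fun n => act (e n)) phiW orbP _ _ h mh).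
exact: (@ge0_integral_orbits _ H2T R (@omega2 R) (set H2T) orb (@HH2 R) (@measurable_HH2 R)
  (fun n => act (e n)) (fun n => act (adj2 (e n))) mphi mpsi phiW psiW phiK psiK
  (fun n f mf f0 => integral_act (de n) mf f0) orb_phi orbP F mF FW injF covF h mh h0).
Qed.

Lemma stab1 A : stab A 1%:M.
Proof. by split; [exact: (Gamma1 ida)|left; exact: lact1]. Qed.

Lemma stabM A M M' : stab A M -> stab A M' -> stab A (M *m M').
Proof.
move=> [GM MA] [GM' MA']; split; first exact: (GammaM ida).
by rewrite lact_mul; case: MA' => ->; rewrite ?lactN; case: MA => ->; rewrite ?opprK; [left|right|right|left].
Qed.

Lemma lactK M A : \det M = 1 -> lact conj (adj2 M) (lact conj M A) = A.
Proof. by move=> d; rewrite -lact_mul adj2_mul d lact1. Qed.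

Lemma lactVK M A : \det M = 1 -> lact conj M (lact conj (adj2 M) A) = A.
Proof. by move=> d; rewrite -lact_mul mul_adj2 d lact1. Qed.

Lemma stabV A M : stab A M -> stab A (adj2 M).
Proof.
move=> [GM MA]; have d := Gamma_det GM; split; first exact: (GammaV ida).
case: MA => E; [left|right]; first by rewrite -[X in lact _ _ X]E lactK.
by rewrite -[X in lact _ _ X]opprK -E lactN lactK.
Qed.

Local Notation orbs A := (orbitH (stab' iota conj a A)).

Lemma orbitHE A (p : RR * RR) : orbs A p = [set act2 M p | M in stab A].
Proof.
have E M : map_mx iota (map_mx conj M) = map_mx s2 M.
  by apply/matrixP => i j; rewrite !mxE.
rewrite /orbitH /stab' /real_mx; apply/seteqP; split.
  by move=> _ [_ [M SM <-] <-]; exists M => //; rewrite E.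
by move=> _ [M SM <-]; exists (map_mx s2 M) => //; exists M => //; rewrite E.
Qed.

Lemma act2M M M' (p : RR * RR) : \det M = 1 -> \det M' = 1 -> HH p ->
  act2 (M *m M') p = act2 M (act2 M' p).
Proof. by move=> d d' Hp; rewrite map_mxM moebiusM// det_map_mx1. Qed.

Lemma act2_1 (p : RR * RR) : act2 1%:M p = p.
Proof. by rewrite map_mx1 moebius1. Qed.

Lemma act2_HH M (p : RR * RR) : \det M = 1 -> HH p -> HH (act2 M p).
Proof. by move=> d; apply: moebius_HH; rewrite det_map_mx1. Qed.

Lemma orbs_act A M (p : RR * RR) : stab A M -> HH p -> orbs A (act2 M p) = orbs A p.
Proof.
move=> SM Hp; have dM := Gamma_det SM.1; rewrite !orbitHE; apply/seteqP; split => _ [M' SM' <-].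
  by exists (M' *m M); [exact: stabM|rewrite act2M//; exact: (Gamma_det SM'.1)].
exists (M' *m adj2 M); first by apply: stabM => //; exact: stabV.
have dM' := Gamma_det SM'.1.
by rewrite -act2M ?det_mulmx ?det_adj2 ?dM ?dM' ?mulr1// -mulmxA adj2_mul dM mulmx1.
Qed.

Lemma orbs_eqP A p q : orbs A p = orbs A q -> exists2 M, stab A M & q = act2 M p.
Proof.
move=> E; have : orbs A q q by rewrite orbitHE; exists 1%:M; [exact: stab1|exact: act2_1].
by rewrite -E orbitHE => -[M SM <-]; exists M.
Qed.

Lemma stab_domain A : \det A != 0 -> exists F : set (RR * RR),
  [/\ measurable F, F `<=` @HH R, set_inj F (orbs A),
      forall p, HH p -> exists2 M, stab A M & F (act2 M p) &
      volT_A iota conj a A = @Defs.eta R F].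
Proof.
move=> dA; have [e [Se eS]] : exists e : nat -> 'M[K]_2, (forall n, stab A (e n)) /\
    forall M, stab A M -> exists n, e n = M.
  by apply: matrix_enum; exists 1%:M; exact: stab1.
have de n := Gamma_det (Se n).1; have dV n : \det (adj2 (e n)) = 1 by rewrite det_adj2.
have mphi n := measurable_moebius (map_mx s2 (e n)).
have mpsi n := measurable_moebius (map_mx s2 (adj2 (e n))).
have phiW n p : HH p -> HH (act2 (e n) p) by exact: act2_HH.
have psiW n p : HH p -> HH (act2 (adj2 (e n)) p) by exact: act2_HH.
have phiK n p : HH p -> act2 (adj2 (e n)) (act2 (e n) p) = p.
  by move=> Hp; rewrite -act2M// adj2_mul de act2_1.
have psiK n p : HH p -> act2 (e n) (act2 (adj2 (e n)) p) = p.
  by move=> Hp; rewrite -act2M// mul_adj2 de act2_1.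
have orb_phi n p : HH p -> orbs A (act2 (e n) p) = orbs A p by exact: orbs_act.
have orbP p q : HH p -> orbs A p = orbs A q -> exists n, q = act2 (e n) p.
  by move=> _ /orbs_eqP[M /eS[n <-] ->]; exists n.
have mo := @measurable_order_real R.
have mo2 := @measurable_order_lex _ _ RR RR _ _ mo mo.
have mB k : measurable (@box R k) by exact: measurable_box.
have coverB (p : RR * RR) : HH p -> exists k, @box R k p.
  by move=> /box_cover[k1 k1P]; exists k1; exact: k1P.
have finB k (p : RR * RR) : HH p -> finite_set [set y | @box R k y /\ exists n, y = act2 (e n) p].
  move=> Hp.
  apply: sub_finite_set (finite_image (fun M => act2 M p) (stab_discrete iota quadK conjN1 ib ida k dA Hp)).
  by move=> y [By [n yE]]; exists (e n) => //; split => //; rewrite -yE.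
have [F [mF FW injF covF]] := @measurable_section _ (RR * RR)%type _ (orbs A) (@HH R) (@measurable_HH R) (fun n => act2 (e n)) mphi phiW orb_phi orbP (@box R) mB coverB finB _ mo2.
have inv n (f : RR * RR -> \bar R) (mf : measurable_fun setT f) (f0 : (forall x, 0 <= f x)%E) :=
  integral_eta_moebius (det_map_mx1 s2 (de n)) mf f0.
exists F; split => //.
  by move=> p /covF[n Fn]; exists (e n).
have pX : orbs A @^-1` (orbs A @` @HH R) = @HH R.
  exact: (@preimage_orbits _ _ _ (orbs A) (@HH R) (fun n => act2 (e n)) phiW orbP).
rewrite /volT_A /vol_quotient (quotient_measureE (@measurable_HH R) mphi mpsi psiW phiK psiK
  inv orb_phi mF injF covF) pX ?(setIidl FW)//.
exact: measurable_HH.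
Qed.
End orbits.

(** * The function g *)

Section invariant_g.
Variables (R : realType) (K : fieldExtType rat).
Variables (iota : {rmorphism K -> R}) (conj : {rmorphism K -> K}).
Local Notation s1 := iota.
Local Notation s2 := (iota2 iota conj).
Local Notation RR := (measurableTypeR R).
Local Notation H2T := ((RR * RR) * (RR * RR))%type.
Implicit Types (z : H2T) (M A : 'M[K]_2).
Local Notation act := (hilbert_act iota conj).
Local Notation form := (Defs.form iota).
Local Notation g := (Defs.g iota).
Local Notation eta := (@Defs.eta R).

Definition sqnorm (w : R[i]) : R := complex.Re w ^+ 2 + complex.Im w ^+ 2.

Lemma sqnormM (u v : R[i]) : sqnorm (u * v) = sqnorm u * sqnorm v.
Proof. by case: u => a b; case: v => c d; rewrite /sqnorm/=; ring. Qed.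

(** The automorphy factor c z + d. *)
Definition autj (M : 'M[R]_2) (p : RR * RR) : R[i] := (M 1 0)%:C * toC p + (M 1 1)%:C.

Lemma sqnorm_autj (M : 'M[R]_2) p : sqnorm (autj M p) = cofac M p.
Proof. by rewrite /sqnorm /autj /cofac /toC/=; ring. Qed.

Lemma autj_neq0 (M : 'M[R]_2) p : \det M = 1 -> HH p -> autj M p != 0.
Proof.
move=> d Hp; have := cofac_gt0 d Hp; rewrite -sqnorm_autj.
by apply: contraTneq => ->; rewrite /sqnorm/= !expr0n/= addr0 ltxx.
Qed.

Lemma toC_moebius (M : 'M[R]_2) p :
  toC (moebius M p) = ((M 0 0)%:C * toC p + (M 0 1)%:C) / autj M p.
Proof. by rewrite /moebius /autj; case: (_ / _). Qed.

(** The identity behind [form_act], over any field. *)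
Lemma form_transform (F : fieldType) (p q r s p' q' r' s' A00 A01 A10 A11 z1 z2 : F) :
  r * z1 + s != 0 -> r' * z2 + s' != 0 -> p * s - q * r = 1 -> p' * s' - q' * r' = 1 ->
  (((r * A00 + s * A10) * r' + (r * A01 + s * A11) * s') *
      ((p * z1 + q) / (r * z1 + s)) * ((p' * z2 + q') / (r' * z2 + s'))
   - ((r * A00 + s * A10) * p' + (r * A01 + s * A11) * q') * ((p * z1 + q) / (r * z1 + s))
   - ((p * A00 + q * A10) * r' + (p * A01 + q * A11) * s') * ((p' * z2 + q') / (r' * z2 + s'))
   + ((p * A00 + q * A10) * p' + (p * A01 + q * A11) * q'))
   * ((r * z1 + s) * (r' * z2 + s')) = A11 * z1 * z2 - A10 * z1 - A01 * z2 + A00.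
Proof.
move=> j1 j2 d1 d2.
transitivity ((p * s - q * r) * (p' * s' - q' * r') * (A11 * z1 * z2 - A10 * z1 - A01 * z2 + A00)).
  by field; rewrite j1 j2.
by rewrite d1 d2 !mul1r.
Qed.

(** The form attached to A is a bilinear form in (z1, 1) and (z2, 1), and
these vectors are multiplied by M and conj(M) up to automorphy factors. *)
Lemma form_act M A z : \det M = 1 -> HH2 z ->
  form (lact conj M A) (act M z) * (autj (map_mx s1 M) z.1 * autj (map_mx s2 M) z.2) = form A z.
Proof.
move=> d [H1 H2]; have d1 := det_map_mx1 s1 d; have d2 := det_map_mx1 s2 d.
have j1 := autj_neq0 d1 H1; have j2 := autj_neq0 d2 H2.
rewrite /Defs.form /hilbert_act /= !toC_moebius !lactE.
have E (k l : 'I_2) : (iota ((M k 0 * A 0 0 + M k 1 * A 1 0) * conj (M l 0) +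
    (M k 0 * A 0 1 + M k 1 * A 1 1) * conj (M l 1)))%:C =
  ((s1 (M k 0))%:C * (s1 (A 0 0))%:C + (s1 (M k 1))%:C * (s1 (A 1 0))%:C) * (s2 (M l 0))%:C +
    ((s1 (M k 0))%:C * (s1 (A 0 1))%:C + (s1 (M k 1))%:C * (s1 (A 1 1))%:C) * (s2 (M l 1))%:C.
  by rewrite !(rmorphD iota, rmorphM iota) !(rmorphD (real_complex R), rmorphM (real_complex R)).
rewrite !E; move: j1 j2; rewrite /autj ![map_mx _ _ _ _]mxE => j1 j2.
apply: form_transform => //.
  move: d1; rewrite det2E !mxE => /(congr1 (fun x => x%:C)).
  by rewrite rmorphB !rmorphM rmorph1.
move: d2; rewrite det2E !mxE => /(congr1 (fun x => x%:C)).
by rewrite rmorphB !rmorphM rmorph1.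
Qed.

Lemma gE A z : g A z = sqnorm (form A z) / (4 * z.1.2 * z.2.2 * iota (\det A)).
Proof. by []. Qed.

Lemma g_act M A z : \det M = 1 -> HH2 z -> iota (\det A) != 0 -> g (lact conj M A) (act M z) = g A z.
Proof.
move=> d Hz dA; have [H1 H2] := Hz.
have d1 := det_map_mx1 s1 d; have d2 := det_map_mx1 s2 d.
rewrite !gE -(form_act A d Hz) !sqnormM !sqnorm_autj det_lact//.
have /gt_eqF/negbT c1 := cofac_gt0 d1 H1; have /gt_eqF/negbT c2 := cofac_gt0 d2 H2.
rewrite [(act M z).1.2](_ : _ = (moebius (map_mx s1 M) z.1).2)//.
rewrite [(act M z).2.2](_ : _ = (moebius (map_mx s2 M) z.2).2)//.
rewrite [moebius (map_mx s1 M) z.1]moebiusE [moebius (map_mx s2 M) z.2]moebiusE [X in X / _]/=.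
rewrite d1 d2 !mul1r.
rewrite /HH/= in H1 H2; have /negbT y1 := gt_eqF H1; have /negbT y2 := gt_eqF H2.
move: (sqnorm _) (cofac _ _) (cofac _ _) c1 c2 z.1.2 z.2.2 y1 y2 (iota _) dA => n c c' c0 c'0 u v u0 v0 e e0 /=.
by field; rewrite c0 c'0 u0 v0 e0.
Qed.

Lemma gN A z : g (- A) z = g A z.
Proof.
rewrite !gE; have -> : form (- A) z = - form A z.
  by rewrite /Defs.form !mxE !(rmorphN iota) !(rmorphN (real_complex R)); ring.
have -> : \det (- A) = \det A by rewrite !det2E !mxE; ring.
by rewrite /sqnorm; case: (form A z) => x y /=; rewrite !sqrrN.
Qed.

Lemma measurable_g A : measurable_fun setT (g A).
Proof.
have m11 : measurable_fun setT (fun z : H2T => z.1.1 : R) by exact: (measurableT_comp measurable_fst measurable_fst).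
have m12 : measurable_fun setT (fun z : H2T => z.1.2 : R) by exact: (measurableT_comp measurable_snd measurable_fst).
have m21 : measurable_fun setT (fun z : H2T => z.2.1 : R) by exact: (measurableT_comp measurable_fst measurable_snd).
have m22 : measurable_fun setT (fun z : H2T => z.2.2 : R) by exact: (measurableT_comp measurable_snd measurable_snd).
rewrite (_ : g A = fun z =>
  ((iota (A 1 1) * (z.1.1 * z.2.1 - z.1.2 * z.2.2) - iota (A 1 0) * z.1.1 - iota (A 0 1) * z.2.1 + iota (A 0 0)) ^+ 2 +
   (iota (A 1 1) * (z.1.1 * z.2.2 + z.1.2 * z.2.1) - iota (A 1 0) * z.1.2 - iota (A 0 1) * z.2.2) ^+ 2) *
   (4 * z.1.2 * z.2.2 * iota (\det A))^-1).
  by mreal.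
apply/funext => -[[x1 y1] [x2 y2]]; rewrite gE; congr (_ / _).
by rewrite /sqnorm /Defs.form /toC/=; congr (_ ^+ 2 + _ ^+ 2); ring.
Qed.

(** For fixed w the function 1 + 2 g(A, (v, w)) is the hyperbolic cosine of
the distance from v to the point (x0, y0), where v is such that (v, w) is on
T_A. *)
Lemma g_cosh A (w : RR * RR) : HH w -> 0 < iota (\det A) ->
  exists (x0 y0 : R), 0 < y0 /\ forall v : RR * RR, HH v ->
    1 + 2 * g A (v, w) = (((v.1 : R) - x0) ^+ 2 + (v.2 : R) ^+ 2 + y0 ^+ 2) / (2 * (v.2 : R) * y0).
Proof.
case: w => x2 y2; rewrite /HH/= => y20 dA.
have dE : iota (\det A) = iota (A 0 0) * iota (A 1 1) - iota (A 0 1) * iota (A 1 0).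
  by rewrite det2E rmorphB !(rmorphM iota).
set b := iota (A 1 1) in dE *; set l := iota (A 1 0) in dE *.
set l' := iota (A 0 1) in dE *; set a0 := iota (A 0 0) in dE *.
(* P + i Q is b w - lambda, the coefficient of v in the form; it does not
   vanish, since w is not real. *)
pose P := b * x2 - l; pose Q := b * y2; pose S := P ^+ 2 + Q ^+ 2.
have S0 : 0 < S.
  rewrite lt_neqAle eq_sym addr_ge0 ?sqr_ge0// andbT; apply/eqP => /eqP.
  rewrite /S paddr_eq0 ?sqr_ge0// !sqrf_eq0 /P /Q mulf_eq0 [y2 == 0]gt_eqF// orbF => /andP[/eqP E /eqP b0].
  move: E; rewrite b0 mul0r sub0r => /eqP; rewrite oppr_eq0 => /eqP l0.
  by move: dA; rewrite dE b0 l0 !mulr0 subrr ltxx.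
exists (((l' * x2 - a0) * P + l' * y2 * Q) / S), (iota (\det A) * y2 / S); split.
  by rewrite !mulr_gt0// invr_gt0.
move=> [x1 y1] /= y10; rewrite gE /sqnorm /Defs.form /toC/= -/b -/l -/l' -/a0.
have {}S0 : S != 0 by rewrite gt_eqF.
have {}dA : iota (\det A) != 0 by rewrite gt_eqF.
have /negbT {}y10 := gt_eqF y10; have /negbT {}y20 := gt_eqF y20.
rewrite dE in dA *; rewrite /S /P /Q in S0 *.
by field; rewrite S0 y10 y20 dA.
Qed.

(** By invariance under affine maps the point at which the distance of
[g_cosh] vanishes may be taken to be i. *)
Lemma integral_cosh_g A (w : RR * RR) (k : R -> \bar R) : HH w -> 0 < iota (\det A) ->
  measurable_fun setT k -> (forall x, 0 <= k x)%E ->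
  (\int[eta]_(v in @HH R) k (1 + 2 * g A (v, w))%R =
   (2^-1)%R%:E * \int[@lebesgue_measure R]_(q in `]1%R, +oo[) k q)%E.
Proof.
move=> Hw dA mk k0; have [x0 [y0 [y00 gv]]] := g_cosh Hw dA.
have mg : measurable_fun setT (fun v : RR * RR => k (1 + 2 * g A (v, w))%R).
  apply: (measurableT_comp mk); apply: measurable_funD => //; apply: measurable_funM => //.
  exact: (measurableT_comp (measurable_g A) (measurable_pair2 w)).
rewrite integral_eta//.
pose f (p : RR * RR) := k ((((p.1 : R) - x0) ^+ 2 + (p.2 : R) ^+ 2 + y0 ^+ 2) / (2 * (p.2 : R) * y0)).
have E1 : polar_int (fun v : RR * RR => k (1 + 2 * g A (v, w))%R) = polar_int f.
  by apply: eq_polar_int => p Hp; rewrite gv.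
have mf : measurable_fun setT f.
  apply: (measurableT_comp mk).
  rewrite (_ : (fun p => _) = (fun p : RR * RR => (((p.1 : R) - x0) ^+ 2 + (p.2 : R) ^+ 2 + y0 ^+ 2) * (2 * (p.2 : R) * y0)^-1)) //.
  by mreal.
rewrite E1 -(polar_int_affine x0 y00 mf (fun p => k0 _)).
have E2 : polar_int (fun p : RR * RR => f (y0 * p.1 + x0, y0 * p.2)%R) =
    polar_int (fun p : RR * RR => k ((p.1 ^+ 2 + p.2 ^+ 2 + 1) / (2 * p.2))%R).
  apply: eq_polar_int => -[x y]; rewrite /HH/= => Hy; rewrite /f/=; congr k.
  by field; rewrite !gt_eqF.
rewrite E2 polar_int_cosh_dist// muleA -EFinM; congr (_%:E * _)%E.
have := gt_eqF (pi_gt0 R); move: (pi : R) => q /negbT q0.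
by field.
Qed.
End invariant_g.

(** * Bounds for matrices that meet a Siegel set *)

Section strip.
Variable R : realType.
Local Notation leb := (@lebesgue_measure R).
Local Notation RR := (measurableTypeR R).
Local Notation eta := (@Defs.eta R).
Local Notation ind := (@ind R).

Definition strip (C : R) : set (RR * RR) := [set p | `|p.1 : R| <= C /\ C^-1 <= (p.2 : R)].

Lemma measurable_strip C : measurable (strip C).
Proof.
have m1 : measurable_fun setT (fun p : RR * RR => p.1 : R) by exact: measurable_fst.
have m2 : measurable_fun setT (fun p : RR * RR => p.2 : R) by exact: measurable_snd.
rewrite (_ : strip C = [set p : RR * RR | (`|p.1 : R| <= C)] `&` [set p : RR * RR | (C^-1 <= (p.2 : R))])//.
apply: measurableI.
- rewrite -[X in measurable X]setTI; apply: measurable_fun_le => //.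
  exact: (measurableT_comp (@normr_measurable R setT)).
- by rewrite -[X in measurable X]setTI; apply: measurable_fun_le.
Qed.

(** At height y = e^r the coordinate t of [polar_int] runs over an interval of
length 2 C e^(-r), which is integrable as r tends to infinity. *)
Lemma eta_strip C : 0 < C -> (eta (strip C) < +oo)%E.
Proof.
move=> C0; have mS := measurable_strip C; have Ci0 : 0 < C^-1 by rewrite invr_gt0.
have SH : strip C `<=` @HH R by move=> p [_ h]; rewrite /HH/= (lt_le_trans Ci0).
have -> : eta (strip C) = (\int[eta]_(p in @HH R) (\1_(strip C) p)%:E)%E.
  by rewrite integral_indic//; [rewrite (setIidl SH)|exact: measurable_HH].
have mi : measurable_fun setT (fun p => (\1_(strip C) p)%:E : \bar R).
  by apply/measurable_EFinP; exact: measurable_indic.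
have i0 (p : RR * RR) : (0 <= (\1_(strip C) p)%:E :> \bar R)%E by rewrite lee_fin.
rewrite (integral_eta mi i0).
apply: lte_mul_pinfty; [by rewrite lee_fin invr_ge0 mulr_ge0// pi_ge0|by []|].
have me : measurable_fun setT (fun r : R => (2 * C * expR (- r))%:E).
  by apply/measurable_EFinP; mreal.
apply: (@le_lt_trans _ _ (\int[leb]_(r in `[(- ln C)%R, +oo[) (2 * C * expR (- r))%:E)%E).
  rewrite [leRHS]integral_mkcond; apply: ge0_le_integral => //.
  - by move=> r _; apply: integral_ge0 => t _; rewrite lee_fin.
  - apply: (measurable_fun_fubini_tonelli_F (m2 := leb)
      (fun z : RR * RR => (\1_(strip C) ((expR (z.1 : R) * (z.2 : R))%R : RR, (expR (z.1 : R)) : RR))%:E)) => //.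
      by apply: (measurableT_comp mi); apply: measurable_fun_pair; mreal.
  - apply/(measurable_restrictT _ (measurable_itv _)); exact: measurable_funTS.
  move=> r _; rewrite patchE; have er := expR_gt0 r.
  have rE : (r \in (`[(- ln C)%R, +oo[%classic : set R)) = (C^-1 <= expR r).
    by rewrite mem_setE in_itv/= andbT -ler_expR expRN lnK.
  rewrite rE; case: ifPn => h; last first.
    rewrite integral0_eq// => t _; rewrite indicE memNset// => -[_ /=].
    exact/negP.
  apply: (@le_trans _ _ (\int[leb]_(t in `[(- (C * expR (- r)))%R, (C * expR (- r))%R]) (cst 1%E t))%E).
    rewrite [leRHS]integral_mkcond; apply: ge0_le_integral => //.
    + by apply: (measurableT_comp mi); apply: measurable_fun_pair; mreal.
    + by apply/(measurable_restrictT _ (measurable_itv _)).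
    move=> t _; rewrite patchE indicE; case: (boolP (_ \in strip C)) => [/set_mem[/= h1 _]|_].
      rewrite mem_setE in_itv/= -ler_norml ifT//.
      by move: h1; rewrite normrM gtr0_norm// mulrC expRN ler_pdivlMr.
    by case: ifP => _; rewrite lee_fin.
  rewrite integral_cst//= mul1e lebesgue_measure_itv/= lte_fin.
  have p0 : 0 < C * expR (- r) by rewrite mulr_gt0// expR_gt0.
  rewrite ifT; last by rewrite (lt_trans _ p0)// oppr_lt0.
  by rewrite -EFinD lee_fin le_eqVlt; apply/orP; left; apply/eqP; ring.
rewrite (@ge0_continuous_FTC2y _ (fun r => 2 * C * expR (- r)) (fun r => - (2 * C * expR (- r))) _ 0) ?ltry//.
- by move=> r _; rewrite !mulr_ge0 ?expR_ge0// ltW.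
- apply: continuous_subspaceT => r; apply: cvgM; first exact: cvg_cst.
  apply: (@continuous_comp _ _ _ (fun r => - r) (@expR R)); last exact: continuous_expR.
  by apply: cvgN; exact: cvg_id.
- rewrite -oppr0 -[in X in - X](mulr0 (2 * C)); apply: cvgN; apply: cvgM; first exact: cvg_cst.
  exact: cvgr_expR.
- apply: cvg_at_right_filter; apply: cvgN; apply: cvgM; first exact: cvg_cst.
  apply: (@continuous_comp _ _ _ (fun r => - r) (@expR R)); last exact: continuous_expR.
  by apply: cvgN; exact: cvg_id.
- move=> x _; have D : is_derive x (1 : R) (fun r => - (2 * C * expR (- r))) (2 * C * expR (- x)).
    by apply: is_derive_eq; rewrite /GRing.scale/=; ring.
  by rewrite derive1E; have [_ ->] := D.
Qed.
End strip.

Section finiteness.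
Variables (R : realType) (K : fieldExtType rat).
Variables (iota : {rmorphism K -> R}) (conj : {rmorphism K -> K}) (D : int).
Hypotheses (quadK : \dim {:K} = 2%N) (conjN1 : exists x, conj x != x).
Variables (b1 b2 : K).
Hypotheses (ib : integral_basis b1 b2)
  (DE : D%:~R = (b1 * conj b2 - b2 * conj b1) ^+ 2).
Variable a : set K.
Hypothesis ida : fractional_ideal a.
Local Notation OK := (@OK K).
Local Notation ofQ := (ofQ K).
Local Notation N := (ofQ (ideal_norm a)).
Local Notation delta := (wedge conj b1 b2).
Local Notation s1 := iota.
Local Notation s2 := (iota2 iota conj).
Local Notation RR := (measurableTypeR R).
Local Notation H2T := ((RR * RR) * (RR * RR))%type.
Implicit Types (z : H2T) (M A B : 'M[K]_2).
Let conjK : involutive conj := conjK quadK conjN1.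
Local Notation act := (hilbert_act iota conj).
Local Notation form := (Defs.form iota).
Local Notation L := (dual_lattice iota conj D a).

Lemma scaled_fractional (I : set K) (c : K) : c != 0 -> fractional_ideal I ->
  fractional_ideal [set x | I (c * x)].
Proof.
move=> c0 [[v Iv v0] IB IM [e e0 eP]]; split.
- by exists (c^-1 * v); [rewrite /= mulVKf|rewrite mulf_neq0// invr_eq0].
- by move=> x y Ix Iy; rewrite /= mulrBr; exact: IB.
- by move=> r x Or Ix; rewrite /= mulrCA; exact: IM.
- by exists (e * c); [rewrite mulf_neq0|move=> x Ix; rewrite -mulrA; exact: eP].
Qed.

(** The conditions that the lattice and its translates under matrices outside
the group have in common; for such matrices the two embeddings of an entry are
embeddings of entries at the first place. *)
Definition self_adjoint A := [/\ conj (A 0 0) = A 0 0, conj (A 1 1) = A 1 1 & A 0 1 = conj (A 1 0)].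

Lemma lattice_self_adjoint A : L A -> self_adjoint A.
Proof.
have N0 := norm_neq0 quadK conjN1 ib ida.
move=> /(dual_latticeP iota quadK conjN1 ib DE ida)[[i iE] [j jE] _ E01]; split => //.
- apply: (mulfI N0); rewrite -{1}(conj_ofQ conj (ideal_norm a)) -(rmorphM conj) iE.
  by rewrite rmorph_int.
- by rewrite jE rmorph_int.
Qed.

Lemma lact_self_adjoint M A : self_adjoint A -> self_adjoint (lact conj M A).
Proof.
move=> [h00 h11 h01]; split; rewrite !lactE !(rmorphD conj, rmorphM conj) !conjK h00 ?h11 h01 ?conjK; ring.
Qed.

Lemma lattice_denom : exists2 n, (0 < n)%N & forall A, L A -> forall i j, OK (n%:R * A i j).
Proof.
have N0 := norm_neq0 quadK conjN1 ib ida.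
have d0 := delta_neq0 quadK conjN1 ib.
have dN0 : delta * N != 0 by rewrite mulf_neq0.
have [n n0 nP] := ideal_denom quadK conjN1 (scaled_fractional dN0 ida).
have [n' n'0 n'P] := ideal_denom quadK conjN1 (scaled_fractional N0 (OK_fractional K)).
have On := OK_nat K.
exists (n * n')%N; first by rewrite muln_gt0 n0.
move=> A /(dual_latticeP iota quadK conjN1 ib DE ida)[[i iE] [j jE] aA E01] k l; rewrite natrM.
have O10 : OK (n%:R * n'%:R * A 1 0).
  by rewrite mulrAC; apply: OKM => //; apply: nP; rewrite /= -mulrA.
have [->|->] := ord2 k; have [->|->] := ord2 l => //.
- by rewrite -mulrA; apply: OKM => //; apply: n'P; rewrite /= iE; exact: OK_int.
- have -> : n%:R * n'%:R * A 0 1 = conj (n%:R * n'%:R * A 1 0).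
    by rewrite E01 !(rmorphM conj) !(rmorph_nat conj).
  exact: OK_conj.
- by rewrite jE; apply: OKM; [exact: OKM|exact: OK_int].
Qed.

Lemma near_denom n : (0 < n)%N -> exists2 k, (0 < k)%N &
  forall M, near_Gamma a n M -> forall i j, OK (k%:R * M i j).
Proof.
move=> n0; have [na na0 naP] := ideal_denom quadK conjN1 ida.
have [nV nV0 nVP] := ideal_denom quadK conjN1 (idealV_fractional quadK conjN1 ida).
have On := OK_nat K.
exists (n * (na * nV))%N; first by rewrite !muln_gt0 n0 na0.
move=> M [M00 M01 a10 M11 _] i j; rewrite !natrM.
have [->|->] := ord2 i; have [->|->] := ord2 j.
- rewrite (_ : _ * _ = na%:R * nV%:R * (n%:R * M 0 0)); last by ring.
  by apply: OKM => //; exact: OKM.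
- rewrite (_ : _ * _ = na%:R * (nV%:R * (n%:R * M 0 1))); last by ring.
  by apply: OKM => //; exact: nVP.
- rewrite (_ : _ * _ = n%:R * nV%:R * (na%:R * M 1 0)); last by ring.
  by apply: OKM; [exact: OKM|exact: naP].
- by apply: OKM => //; apply: OKM => //; exact: OKM.
Qed.

(** At a zero the imaginary part of the form gives det A y2 = |b z2 -
lambda|^2 y1. As y2 / y1 is bounded, so are b z2 - lambda and its imaginary
part b y2, hence b and lambda; conj lambda is bounded by symmetry, and for b =
0 the real part of the form bounds the remaining entry. *)
Lemma form_zero_bounds A z (C e : R) : e = 1 + C * iota (\det A) -> HH2 z -> 0 < C -> siegel C z ->
  form A z = 0 -> 0 < iota (\det A) ->
  [/\ `|iota (A 1 1)| <= C * e, `|iota (A 1 0)| <= C * (C * e) + e,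
      `|iota (A 0 1)| <= C * (C * e) + e * C &
      A 1 1 = 0 -> `|iota (A 0 0)| <= (C * (C * e) + e) * C + (C * (C * e) + e * C) * C].
Proof.
case: z => [[x1 y1] [x2 y2]] eE [/= H1 H2] C0 [/= x1C x2C y1C y2C [y12 y21]] fz dA.
rewrite /HH/= in H1 H2.
have dE : iota (\det A) = iota (A 0 0) * iota (A 1 1) - iota (A 0 1) * iota (A 1 0).
  by rewrite det2E rmorphB !(rmorphM iota).
have b0 : A 1 1 = 0 -> iota (A 1 1) = 0 by move=> ->; rewrite rmorph0.
move: fz; rewrite /Defs.form /toC/= => /eqP; rewrite eq_complex/= => /andP[/eqP Re0 /eqP Im0].
move: (iota (\det A)) eE dA dE => d eE dA dE.
move: (iota (A 1 1)) b0 dE Re0 Im0 => b b0 dE Re0 Im0.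
move: (iota (A 1 0)) (iota (A 0 1)) (iota (A 0 0)) dE Re0 Im0 => l l' a0 dE Re0 Im0.
have {}Re0 : b * (x1 * x2 - y1 * y2) - l * x1 - l' * x2 + a0 = 0 by rewrite -Re0; ring.
have {}Im0 : b * (x1 * y2 + x2 * y1) - l * y1 - l' * y2 = 0 by rewrite -Im0; ring.
pose P := b * x2 - l; pose Q := b * y2.
have P' : (b * x1 - l') * y2 = - (P * y1) by rewrite /P; apply/eqP; rewrite -subr_eq0 -Im0; apply/eqP; ring.
(* The imaginary part of the equation, with its real part used to introduce
   the determinant. *)
have key : d * y2 = (P ^+ 2 + Q ^+ 2) * y1.
  have E : (b * x1 - l') * P = Q * b * y1 - d.
    rewrite /P /Q dE; apply/eqP; rewrite -subr_eq0; apply/eqP.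
    transitivity (b * (b * (x1 * x2 - y1 * y2) - l * x1 - l' * x2 + a0)); first by ring.
    by rewrite Re0 mulr0.
  have : (b * x1 - l') * y2 * P = (Q * b * y1 - d) * y2 by rewrite mulrAC E.
  by rewrite P' /Q => h; rewrite expr2 /Q; lra.
have S0 : P ^+ 2 + Q ^+ 2 <= C * d.
  rewrite -(ler_pM2r H1) -key mulrAC [C * y1 * d]mulrC ler_pM2l// .
have sq (t : R) : t ^+ 2 <= C * d -> `|t| <= e.
  move=> tB; have [t1|t1] := leP `|t| 1; first by rewrite (le_trans t1)// eE lerDl (le_trans _ tB)// sqr_ge0.
  rewrite eE ler_wpDl// (le_trans _ tB)// -real_normK ?num_real// expr2 ler_peMl//.
  exact: ltW.
have Pe : `|P| <= e by apply: sq; apply: le_trans S0; rewrite lerDl sqr_ge0.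
have Qe : `|Q| <= e by apply: sq; apply: le_trans S0; rewrite lerDr sqr_ge0.
have e0 : 0 <= e by exact: le_trans Qe.
have bC : `|b| <= C * e.
  have : `|b| * y2 <= e by rewrite -[y2]gtr0_norm// -normrM.
  move=> h; rewrite -ler_pdivrMl//; apply: le_trans h; rewrite mulrC; exact: ler_wpM2l.
have lC : `|l| <= C * (C * e) + e.
  have -> : l = b * x2 - P by rewrite /P; ring.
  rewrite (le_trans (ler_normB _ _))// lerD// normrM mulrC; exact: ler_pM.
have l'C : `|l'| <= C * (C * e) + e * C.
  have -> : l' = b * x1 + P * (y1 / y2).
    apply: (mulIf (lt0r_neq0 H2)); rewrite mulrDl -[P * _ * y2]mulrA divfK ?gt_eqF//.
    by move: P'; rewrite mulrBl => P''; rewrite -[P * y1]opprK -P''; ring.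
  rewrite (le_trans (ler_normD _ _))// lerD// normrM; first by rewrite mulrC; exact: ler_pM.
  apply: ler_pM => //; rewrite gtr0_norm ?divr_gt0// ler_pdivrMr//.
split => // /b0 bz.
have -> : a0 = l * x1 + l' * x2 by move: Re0; rewrite bz mul0r; lra.
by rewrite (le_trans (ler_normD _ _))// !normrM lerD//; apply: ler_pM.
Qed.
End finiteness.

(** * Classes of matrices and the finiteness of the volume *)

Section classes.
Variables (R : realType) (K : fieldExtType rat).
Variables (iota : {rmorphism K -> R}) (conj : {rmorphism K -> K}) (D : int).
Hypotheses (quadK : \dim {:K} = 2%N) (conjN1 : exists x, conj x != x).
Variables (b1 b2 : K).
Hypotheses (ib : integral_basis b1 b2)
  (DE : D%:~R = (b1 * conj b2 - b2 * conj b1) ^+ 2).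
Variable a : set K.
Hypothesis ida : fractional_ideal a.
Variable m : nat.
Hypothesis m_gt0 : (0 < m)%N.
Local Notation OK := (@OK K).
Local Notation ofQ := (ofQ K).
Local Notation N := (ofQ (ideal_norm a)).
Local Notation s1 := iota.
Local Notation s2 := (iota2 iota conj).
Local Notation RR := (measurableTypeR R).
Local Notation H2T := ((RR * RR) * (RR * RR))%type.
Implicit Types (z : H2T) (M A B : 'M[K]_2).
Let conjK : involutive conj := conjK quadK conjN1.
Local Notation act := (hilbert_act iota conj).
Local Notation act2 M := (moebius (map_mx s2 M)).
Local Notation form := (Defs.form iota).
Local Notation L := (dual_lattice iota conj D a).
Local Notation Lm := (lattice_det iota conj D a m).
Local Notation eta := (@Defs.eta R).
Local Notation volT_A := (volT_A iota conj a).

Definition meets (n : nat) (dK : K) (C : R) : set 'M[K]_2 :=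
  [set B : 'M[K]_2 | [/\ forall i j, OK (n%:R * B i j), self_adjoint conj B, \det B = dK &
     exists z, [/\ HH2 z, siegel C z & form B z = 0]]].

(** By [form_zero_bounds] the entries b and lambda are bounded at both places.
The remaining entry is determined by the determinant, or bounded when b = 0.
*)
Lemma meets_finite n dK C : (0 < n)%N -> 0 < C -> 0 < iota dK -> finite_set (meets n dK C).
Proof.
move=> n0 C0 dK0; pose e := 1 + C * iota dK.
have e0 : 0 <= e by rewrite addr_ge0// mulr_ge0// ltW.
pose B1 := C * e; pose B2 := C * (C * e) + e; pose B3 := C * (C * e) + e * C.
pose B4 := B2 * C + B3 * C.
have C0' := ltW C0.
have B10 : 0 <= B1 by rewrite mulr_ge0.
have B20 : 0 <= B2 by rewrite addr_ge0// !mulr_ge0.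
have B30 : 0 <= B3 by rewrite addr_ge0// !mulr_ge0.
have B40 : 0 <= B4 by rewrite addr_ge0// mulr_ge0.
pose B' := B1 + B2 + B3 + B4.
have [le1 le2 le3 le4] : [/\ B1 <= B', B2 <= B', B3 <= B' & B4 <= B'].
  move: B10 B20 B30 B40; rewrite /B'; move: (B1) (B2) (B3) (B4) => x y u t.
  by move=> x0 y0 u0 t0; split; lra.
pose S := [set x | [/\ OK (n%:R * x), `|s1 x| <= B' & `|s2 x| <= B']].
have Sfin : finite_set S by exact: (bounded_finite iota quadK conjN1 ib B' n0).
apply: (@sub_finite_set _ _ ((fun q : K * (K * K) =>
  mx2 (if q.1 == 0 then q.2.2 else (dK + conj q.2.1 * q.2.1) / q.1) (conj q.2.1) q.2.1 q.1) @`
   (S `*` (S `*` S)))); last first.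
  by apply: finite_image; apply: finite_setX => //; exact: finite_setX.
move=> B [OB [h00 h11 h01] dB [z [Hz sz fz]]].
have [||bd1 bd2 bd3 bd4] := @form_zero_bounds R K iota B z C e _ Hz C0 sz fz; rewrite ?dB//.
have S11 : S (B 1 1).
  by split; [exact: OB|exact: le_trans le1|rewrite /iota2/= h11; exact: le_trans le1].
have S10 : S (B 1 0).
  by split; [exact: OB|exact: le_trans le2|rewrite /iota2/= -h01; exact: le_trans le3].
have det : B 0 0 * B 1 1 = dK + conj (B 1 0) * B 1 0 by rewrite -dB det2E h01 subrK.
have [b0|b0] := eqVneq (B 1 1) 0.
  have S00 : S (B 0 0).
    by split; [exact: OB|apply: le_trans le4; exact: bd4|rewrite /iota2/= h00; apply: le_trans le4; exact: bd4].
  exists (B 1 1, (B 1 0, B 0 0)) => //=.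
  by apply: eq_mx2; rewrite !mxE/= ?b0 ?eqxx.
exists (B 1 1, (B 1 0, B 1 1)) => //=.
by apply: eq_mx2; rewrite !mxE/= ?(negbTE b0) -?det ?mulfK.
Qed.

Lemma Lm_det A : Lm A -> \det A != 0.
Proof.
move=> LA; have := lattice_det_gt0 quadK conjN1 ib DE ida m_gt0 LA.
by apply: contraTneq => ->; rewrite rmorph0 ltxx.
Qed.

Lemma Lm_gt0 A : Lm A -> 0 < iota (\det A).
Proof. exact: (lattice_det_gt0 quadK conjN1 ib DE ida m_gt0). Qed.

Lemma Lm_lact M A : Gamma a M -> Lm A -> Lm (lact conj M A).
Proof. exact: (lattice_det_lact quadK conjN1 ib DE ida). Qed.

Lemma Lm_opp A : Lm A -> Lm (- A).
Proof. exact: (lattice_detN quadK conjN1 ib DE ida). Qed.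

(** Matrices in the same class modulo the group and sign. *)
Definition related A B := exists2 M, Gamma a M & B = lact conj M A \/ B = - lact conj M A.

Lemma related_refl A : related A A.
Proof. by exists 1%:M; [exact: (Gamma1 ida)|left; rewrite lact1]. Qed.

Lemma related_sym A B : related A B -> related B A.
Proof.
move=> [M GM BE]; have d := Gamma_det GM; exists (adj2 M); first exact: (GammaV ida).
by case: BE => ->; rewrite ?lactN (lactK conj A d); [left|right; rewrite opprK].
Qed.

Lemma related_trans A B C : related A B -> related B C -> related A C.
Proof.
move=> [M GM BE] [M' GM' CE]; exists (M' *m M); first exact: (GammaM ida).
rewrite lact_mul; case: BE CE => -> [->|->]; rewrite ?lactN ?opprK; by [left|right].
Qed.

Lemma lclass_eq A B : related A B -> lclass conj a A = lclass conj a B.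
Proof.
move=> AB; apply/seteqP; split => C; first by apply: related_trans; exact: related_sym.
exact: related_trans.
Qed.

(** The volume of T is a sum over classes; it is rewritten as a sum over a set
of matrices so that fundamental domains can be attached to its terms. *)
Lemma representatives : exists T : set 'M[K]_2,
  [/\ T `<=` Lm, forall A, Lm A -> exists2 A0, T A0 & related A A0,
      forall A B, T A -> T B -> related A B -> A = B &
      volT iota conj D a m = (\esum_(A in T) volT_A A)%E].
Proof.
pose rep (C : set 'M[K]_2) := xget 0 C.
pose Cl := [set lclass conj a A | A in Lm].
have repP A : related A (rep (lclass conj a A)).
  have ex : exists B, lclass conj a A B by exists A; exact: related_refl.
  exact: (xgetPex 0 ex).
exists (rep @` Cl); split.
- move=> _ [_ [A LA <-] <-]; have [M GM [->|->]] := repP A; last apply: Lm_opp; exact: Lm_lact.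
- by move=> A LA; exists (rep (lclass conj a A)) => //; exists (lclass conj a A) => //; exists A.
- move=> _ _ [_ [A LA <-] <-] [_ [B LB <-] <-] h; congr rep; apply: lclass_eq.
  apply: related_trans (repP A) _; apply: related_trans h _; exact: related_sym.
- apply/esym/(@reindex_esum _ _ _ _ _ rep); split.
  + by move=> C HC; exists C.
  + move=> C C'; rewrite !inE => -[A LA <-] [B LB <-] E; apply: lclass_eq.
    by apply: related_trans (repP A) _; rewrite -/(rep _) E; exact: related_sym.
  + by move=> _ [C HC <-]; exists C.
Qed.

Lemma stab_domains : exists F : 'M[K]_2 -> set (RR * RR), forall A, \det A != 0 ->
  [/\ measurable (F A), F A `<=` @HH R, set_inj (F A) (orbitH (stab' iota conj a A)),
      forall p, HH p -> exists2 M, stab conj a A M & F A (act2 M p) &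
      volT_A A = eta (F A)].
Proof.
have H A : exists F : set (RR * RR), \det A != 0 -> [/\ measurable F, F `<=` @HH R, set_inj F (orbitH (stab' iota conj a A)),
      forall p, HH p -> exists2 M, stab conj a A M & F (act2 M p) &
      volT_A A = eta F].
  have [dA|dA] := boolP (\det A != 0); last by exists set0.
  by have [F FP] := stab_domain iota quadK conjN1 ib ida dA; exists F.
by have [F FP] := boolp.choice H; exists F.
Qed.

(** The curve T_A is a graph over the second half plane: the point is the one
of [g_cosh]. *)
Lemma zero_point A w : 0 < iota (\det A) -> HH w -> exists2 v, HH v & form A (v, w) = 0.
Proof.
move=> dA Hw; have [x0 [y0 [y00 gv]]] := g_cosh Hw dA.
exists (x0, y0); first by [].
have /(gv (x0, y0)) E : HH ((x0, y0) : RR * RR) by [].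
have g0 : Defs.g iota A ((x0, y0), w) = 0.
  have : 2 * Defs.g iota A ((x0, y0), w) = 0.
    apply: (addrI 1); rewrite E addr0/= subrr; field; by rewrite gt_eqF.
  by move/eqP; rewrite mulf_eq0 pnatr_eq0/= => /eqP.
move: g0; rewrite gE => /eqP; rewrite mulf_eq0 invr_eq0 !mulf_eq0 /= pnatr_eq0/=.
rewrite /HH/= in Hw.
rewrite (gt_eqF y00) (gt_eqF Hw) (gt_eqF dA) !orbF /sqnorm paddr_eq0 ?sqr_ge0// !sqrf_eq0.
by case: (form A _) => x y /= /andP[/eqP -> /eqP ->].
Qed.

(** [transfer] is applied to the pairs (A, w) and the constant function 1.
Every point w is the second coordinate of a point of T_A, which an element of
the group moves into a translate of a Siegel set by one of the finitely many
g; then A is moved into the finite set of matrices that meet the Siegel set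
after application of g, and w into a preimage of a strip. *)
Lemma volT_lty : (volT iota conj D a m < +oo)%E.
Proof.
have [T [TL Tcov Tinj ->]] := representatives.
have [F FP] := stab_domains.
have [n [G [C [n0 Gfin C0 Gn red]]]] := siegel_reduction iota quadK conjN1 ib ida.
have [k k0 kP] := near_denom quadK conjN1 ida n0.
have [k' k'0 k'P] := lattice_denom iota quadK conjN1 ib DE ida.
have [e [Ge eG]] := Gamma_enum ida.
pose dK : K := m%:R / (ratr (ideal_norm a) * D%:~R).
pose H := meets (k * k * k') dK C.
have [T0|/set0P[A0 TA0]] := eqVneq T set0.
  by rewrite T0 esum_set0 ltry.
have dK0 : 0 < iota dK.
  by have [_ E] := TL _ TA0; rewrite /dK -E; exact: Lm_gt0 (TL _ TA0).
have Hfin : finite_set H by apply: meets_finite => //; rewrite !muln_gt0 k0.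
(* The matrices that meet the Siegel set after a reduction by some g of the
   finite set G. *)
pose H' := [set A | exists2 g, G g & H (lact conj g A)].
have dG g : G g -> \det g = 1 by move=> /Gn[].
have H'fin : finite_set H'.
  apply: (@sub_finite_set _ _ ((fun q : 'M[K]_2 * 'M[K]_2 => lact conj (adj2 q.1) q.2) @` (G `*` H))).
    move=> A [g Gg HA]; exists (g, lact conj g A) => //=; rewrite lactK//; exact: dG.
  by apply: finite_image; exact: finite_setX.
pose St g : set (RR * RR) := @HH R `&` act2 g @^-1` strip C.
have mSt g : measurable (St g).
  apply: measurableI; first exact: measurable_HH.
  rewrite -[X in measurable X]setTI; apply: measurable_moebius => //; exact: measurable_strip.
have etaSt g : G g -> (eta (St g) < +oo)%E.
  move=> /dG dg; have mS := @measurable_strip R C.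
  apply: le_lt_trans (eta_strip C0).
  have E (X : set (RR * RR)) : measurable X -> eta (@HH R `&` X) = (\int[eta]_(p in @HH R) (\1_X p)%:E)%E.
    by move=> mX; rewrite setIC integral_indic; [|exact: measurable_HH|exact: mX].
  have mpre : measurable (act2 g @^-1` strip C).
    by rewrite -[X in measurable X]setTI; apply: measurable_moebius.
  have -> : eta (St g) = eta (@HH R `&` strip C).
    rewrite /St !E//.
    rewrite -(@integral_eta_moebius _ (map_mx s2 g) (fun p => (\1_(strip C) p)%:E)) ?det_map_mx1//.
    by apply/measurable_EFinP; exact: measurable_indic.
  by apply: le_measure; rewrite ?inE//; apply: measurableI => //; exact: measurable_HH.
pose E' := \bigcup_(g in G) St g.
have mE' : measurable E' by apply: fin_bigcup_measurable.
have etaE' : (eta E' < +oo)%E.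
  apply: (@le_lt_trans _ _ (\sum_(g \in G) eta (St g))%E).
    by apply: content_sub_fsum.
  rewrite fsbig_finite//= big_seq_cond; apply: lte_sum_pinfty => g /andP[+ _].
  by rewrite in_fset_set// => /set_mem; exact: etaSt.
pose EA A := if `[< T A >] then F A else set0.
pose EA' A := if `[< H' A >] then E' else set0.
have mEA A : measurable (EA A).
  rewrite /EA; case: asboolP => // /TL/Lm_det dA; by have [] := FP A dA.
have mEA' A : measurable (EA' A) by rewrite /EA'; case: asboolP.
have de i := Gamma_det (Ge i).
have mE : forall i, measurable_fun setT (act2 (e i)) by move=> i; exact: measurable_moebius.
have mV : forall i, measurable_fun setT (act2 (adj2 (e i))) by move=> i; exact: measurable_moebius.
have psiW i p : HH p -> HH (act2 (adj2 (e i)) p) by apply: act2_HH; rewrite det_adj2.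
have phiK i p : HH p -> act2 (adj2 (e i)) (act2 (e i) p) = p.
  by move=> Hp; rewrite -act2M ?det_adj2// adj2_mul de act2_1.
have psiK i p : HH p -> act2 (e i) (act2 (adj2 (e i)) p) = p.
  by move=> Hp; rewrite -act2M ?det_adj2// mul_adj2 de act2_1.
have alC i A : Lm A -> Lm (lact conj (e i) A) by exact: Lm_lact.
have beC i A : Lm A -> Lm (lact conj (adj2 (e i)) A) by apply: Lm_lact; exact: (GammaV ida).
have alK i A : Lm A -> lact conj (adj2 (e i)) (lact conj (e i) A) = A by move=> _; exact: lactK.
have beK i A : Lm A -> lact conj (e i) (lact conj (adj2 (e i)) A) = A by move=> _; exact: lactVK.
have inv i (f : RR * RR -> \bar R) (mf : measurable_fun setT f) (f0 : (forall x, 0 <= f x)%E) :=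
  integral_eta_moebius (det_map_mx1 s2 (de i)) mf f0.
have tr := @transfer _ _ R eta (@HH R) (@measurable_HH R) _ Lm
  (fun i => act2 (e i)) (fun i => act2 (adj2 (e i))) (fun i => lact conj (e i)) (fun i => lact conj (adj2 (e i)))
  mE mV psiW phiK psiK alC beC alK beK inv (fun _ => cst 1%E) EA EA'.
apply: (@le_lt_trans _ _ (\esum_(A in Lm) \int[eta]_(x in EA A) cst 1%E x)%E).
  rewrite -(setIidr TL) esum_mkcondr; apply: le_esum => A LA.
  rewrite integral_cst// mul1e; case: ifPn => [/set_mem TA|_]; last exact: measure_ge0.
  rewrite /EA asboolT//; have [_ _ _ _ ->] := FP A (Lm_det (TL _ TA)); exact: lexx.
apply: le_lt_trans (tr _ _ _ _ _ _ _ _) _ => //.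
- by move=> A LA p; rewrite /EA; case: asboolP => // TA; have [_ FW _ _ _] := FP A (Lm_det LA); exact: FW.
- move=> i i' A A' p p' LA LA'; rewrite /EA; case: asboolP => // TA; case: asboolP => // TA' Fp Fp' lE pE.
  have relA : related A A'.
    exists (adj2 (e i') *m e i); first by apply: (GammaM ida) => //; exact: (GammaV ida).
    by left; rewrite lact_mul lE lactK.
  have AA := Tinj _ _ TA TA' relA; rewrite -AA in Fp' lE LA'; split => //.
  have [_ FW injF _ _] := FP A (Lm_det LA).
  have [Hp Hp'] := (FW _ Fp, FW _ Fp').
  have dV : \det (adj2 (e i')) = 1 by rewrite det_adj2.
  have p'E : p' = act2 (adj2 (e i') *m e i) p by rewrite act2M// pE phiK.
  apply: injF; rewrite ?inE// p'E (orbs_act iota ida)//.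
  by split; [apply: (GammaM ida) => //; exact: (GammaV ida)|left; rewrite lact_mul lE lactK].
- move=> A p LA; rewrite /EA; case: asboolP => // TA Fp.
  have [_ FW _ _ _] := FP A (Lm_det LA); have Hp := FW _ Fp.
  (* Reduce the point of T_A above p. *)
  have [v Hv fv] := zero_point (Lm_gt0 LA) Hp.
  have Hz : HH2 (v, p) by [].
  have [g [gam [Gg Ggam Sz]]] := red _ Hz.
  have [i iE] := eG _ Ggam; exists i.
  have dg := dG _ Gg; have dgam := Gamma_det Ggam.
  have dgg : \det (g *m gam) = 1 by rewrite det_mulmx dg dgam mulr1.
  have HA : H (lact conj g (lact conj gam A)).
    rewrite -lact_mul; split.
    + have Oe := Gamma_denom; move=> r c.
      have Lg : L (lact conj gam A) by have [] := Lm_lact Ggam LA.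
      rewrite lact_mul lactE.
      have Ok := kP _ (Gn _ Gg); have Ok' := k'P _ Lg.
      have Okc r' c' : OK (k%:R * conj (g r' c')).
        by rewrite -(rmorph_nat conj) -(rmorphM conj); exact: OK_conj.
      rewrite !natrM (_ : _ * _ =
        ((k%:R * g r 0) * (k'%:R * lact conj gam A 0 0) + (k%:R * g r 1) * (k'%:R * lact conj gam A 1 0)) * (k%:R * conj (g c 0)) +
        ((k%:R * g r 0) * (k'%:R * lact conj gam A 0 1) + (k%:R * g r 1) * (k'%:R * lact conj gam A 1 1)) * (k%:R * conj (g c 1))); last by ring.
      by apply: OKD; apply: OKM => //; apply: OKD; exact: OKM.
    + have [LLA _] := LA.
      exact: (lact_self_adjoint quadK conjN1 (g *m gam) (lattice_self_adjoint quadK conjN1 ib DE ida LLA)).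
    + by rewrite det_lact//; case: LA.
    + exists (act (g *m gam) (v, p)); split => //; first exact: act_HH2.
      have := form_act iota conj A dgg Hz; rewrite fv => /eqP; rewrite mulf_eq0 => /orP[/eqP//|].
      have [j1 j2] : autj (map_mx s1 (g *m gam)) v != 0 /\ autj (map_mx s2 (g *m gam)) p != 0.
        by split; apply: autj_neq0 => //; exact: det_map_mx1.
      by rewrite mulf_eq0 (negbTE j1) (negbTE j2).
  rewrite /EA' asboolT; last by exists g; rewrite // iE.
  exists g => //; split; first by rewrite iE; exact: act2_HH.
  rewrite /= iE -act2M//; have [? ? ? ? _] := Sz; by split.
- rewrite (eq_esum (b := fun A => if A \in H' then eta E' else 0%E)); last first.
    move=> A LA; rewrite integral_cst// mul1e /EA'; case: asboolP => HA.
      by rewrite mem_set.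
    by rewrite memNset// measure0.
  rewrite -(esum_mkcondr Lm H' (fun=> eta E')) esum_fset.
  + rewrite fsbig_finite/=; last exact: finite_setIr.
    by apply: lte_sum_pinfty => A _.
  + exact: finite_setIr.
  + by move=> A _; exact: measure_ge0.
Qed.

Lemma volT_fin_num : volT iota conj D a m \is a fin_num.
Proof.
rewrite ge0_fin_numE; first exact: volT_lty.
by apply: esum_ge0 => C _; exact: measure_ge0.
Qed.
End classes.

(** * Unfolding *)

Section unfolding.
Variables (R : realType) (K : fieldExtType rat).
Variables (iota : {rmorphism K -> R}) (conj : {rmorphism K -> K}) (D : int).
Hypotheses (quadK : \dim {:K} = 2%N) (conjN1 : exists x, conj x != x).
Variables (b1 b2 : K).
Hypotheses (ib : integral_basis b1 b2)
  (DE : D%:~R = (b1 * conj b2 - b2 * conj b1) ^+ 2).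
Variable a : set K.
Hypothesis ida : fractional_ideal a.
Variable m : nat.
Hypothesis m_gt0 : (0 < m)%N.
Local Notation s1 := iota.
Local Notation s2 := (iota2 iota conj).
Local Notation RR := (measurableTypeR R).
Local Notation H2T := ((RR * RR) * (RR * RR))%type.
Implicit Types (z : H2T) (M A B : 'M[K]_2).
Local Notation act := (hilbert_act iota conj).
Local Notation act2 M := (moebius (map_mx s2 M)).
Local Notation Lm := (lattice_det iota conj D a m).
Local Notation eta := (@Defs.eta R).
Local Notation omega2 := (@omega2 R).
Local Notation leb := (@lebesgue_measure R).
Local Notation volT_A := (volT_A iota conj a).
Local Notation orb := (orbitH2 iota conj a).
Local Notation stab := (stab conj a).
Local Notation related := (related conj a).

(** Away from these points the second coordinate alone determines the group
element up to sign, so that fundamental domains for pairs are strict. *)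
Definition elliptic : set (RR * RR) :=
  [set w | HH w /\ exists M, [/\ Gamma a M, M != 1%:M, M != - 1%:M & act2 M w = w]].

Lemma s2_map_inj : injective (map_mx s2 : 'M[K]_2 -> 'M[R]_2).
Proof.
move=> A B /matrixP E; apply/matrixP => i j; have := E i j; rewrite !mxE.
exact: (fmorph_inj s2).
Qed.

Lemma measurable_point (w : RR * RR) : measurable [set w].
Proof.
case: w => x y; rewrite (_ : [set _] = [set x] `*` [set y]).
  by apply: measurableX; exact: measurable_set1.
by apply/seteqP; split => [_ ->//|[x' y'] [/= -> ->]].
Qed.

Lemma eta_point (w : RR * RR) : eta [set w] = 0%E.
Proof.
have l0 : @lebesgue2 R [set w] = 0%E.
  case: w => x y; rewrite (_ : [set _] = [set x] `*` [set y]).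
    rewrite /lebesgue2 [LHS]product_measure1E; [|exact: measurable_set1|exact: measurable_set1].
    by rewrite /= lebesgue_measure_set1 mul0e.
  by apply/seteqP; split => [_ ->//|[x' y'] [/= -> ->]].
rewrite /Defs.eta/= /density_measure; apply: null_set_integral => //.
- exact: measurable_point.
- apply/measurable_EFinP; apply: measurable_funTS; exact: measurable_eta_density.
Qed.

(** There are countably many matrices, and each has at most one fixed point.
*)
Lemma elliptic_negligible : measurable elliptic /\ eta elliptic = 0%E.
Proof.
have [e [Ge eG]] := Gamma_enum ida.
pose Z n := [set w : RR * RR | [/\ HH w, e n != 1%:M, e n != - 1%:M & act2 (e n) w = w]].
have ZE : elliptic = \bigcup_n Z n.
  apply/seteqP; split.
    move=> w [Hw [M [GM M1 MN fM]]]; have [n nM] := eG _ GM; exists n => //.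
    by rewrite /Z/= nM.
  by move=> w [n _ [Hw M1 MN fM]]; split => //; exists (e n).
have Zn n : Z n = set0 \/ exists w, Z n = [set w].
  have [Z0|/set0P[w Zw]] := eqVneq (Z n) set0; [by left|right].
  exists w; apply/seteqP; split => [w' [Hw' /eqP M1 /eqP MN fM']|_ ->//].
  have [Hw _ _ fM] := Zw.
  apply: (@moebius_fixed_unique _ (map_mx s2 (e n))) => //.
  - exact: det_map_mx1 (Gamma_det (Ge n)).
  - by rewrite -(map_mx1 s2) => /s2_map_inj.
  - by rewrite -(map_mx1 s2) -map_mxN => /s2_map_inj.
have mZ n : measurable (Z n).
  by have [->|[w ->]] := Zn n; [exact: measurable0|exact: measurable_point].
have eZ n : eta (Z n) = 0%E.
  by have [->|[w ->]] := Zn n; [exact: measure0|exact: eta_point].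
rewrite ZE; split; first exact: bigcupT_measurable.
apply/eqP; rewrite eq_le measure_ge0 andbT.
apply: (@le_trans _ _ (\sum_(n <oo) eta (Z n))%E).
  by apply: measure_sigma_subadditive => //; exact: bigcupT_measurable.
by rewrite eseries0// => n _ _; exact: eZ.
Qed.

Lemma elliptic_act M w : Gamma a M -> HH w -> elliptic (act2 M w) -> elliptic w.
Proof.
move=> GM Hw [_ [B [GB B1 BN fB]]]; have d := Gamma_det GM; have dB := Gamma_det GB.
have GV := GammaV ida GM; have dV := Gamma_det GV.
split => //; exists (adj2 M *m (B *m M)).
have key (u : K) : adj2 M *m (B *m M) = u%:M -> B = u%:M.
  move=> E; have : M *m (adj2 M *m (B *m M)) *m adj2 M = M *m u%:M *m adj2 M by rewrite E.
  by rewrite !mulmxA mul_adj2 d mul1mx -mulmxA mul_adj2 d mulmx1 mul_mx_scalar -scalemxAl mul_adj2 d scale_scalar_mx mulr1.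
split.
- by do 2 apply: (GammaM ida) => //.
- by apply: contra B1 => /eqP/key ->.
- apply: contra BN => /eqP; have -> : - 1%:M = (-1)%:M :> 'M[K]_2 by rewrite raddfN.
  by move=> /key ->; rewrite raddfN.
- rewrite !act2M ?det_mulmx ?dB ?d ?mulr1// fB -act2M//.
  by rewrite adj2_mul d act2_1.
Qed.

Lemma not_elliptic M w : Gamma a M -> HH w -> ~ elliptic w -> act2 M w = w -> M = 1%:M \/ M = - 1%:M.
Proof.
move=> GM Hw nE fM; have [->|M1] := eqVneq M 1%:M; first by left.
have [->|MN] := eqVneq M (- 1%:M); first by right.
by case: nE; split => //; exists M.
Qed.

Lemma esumZl (c : R) (S : set 'M[K]_2) (u : 'M[K]_2 -> \bar R) : 0 <= c ->
  (forall i, 0 <= u i)%E -> (\esum_(i in S) (c%:E * u i) = c%:E * \esum_(i in S) u i)%E.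
Proof.
move=> c0 u0; have [e einj] := matrix_inj_nat K.
rewrite !(esum_series 0 einj)//; last by move=> i; apply: mule_ge0 => //; rewrite lee_fin.
rewrite -nneseriesZl//; last by move=> n _; case: ifP.
by apply: eq_eseriesr => n _; case: ifP => // _; rewrite mule0.
Qed.

Definition cosh_dist A z : R := 1 + 2 * Defs.g iota A z.

Lemma measurable_cosh_dist A : measurable_fun setT (cosh_dist A).
Proof. by apply: measurable_funD => //; apply: measurable_funM => //; exact: measurable_g. Qed.

Lemma lact_N1 A : lact conj (- 1%:M) A = A.
Proof. by rewrite lact_oppl lact1. Qed.

Lemma act_N1 z : act (- 1%:M) z = z.
Proof. by case: z => z1 z2; rewrite /hilbert_act !map_mxN !map_mx1 !moebiusN !moebius1. Qed.

Variable k : R -> \bar R.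
Hypotheses (mk : measurable_fun setT k) (k0 : forall x, (0 <= k x)%E).
Let kappa : \bar R := (\int[leb]_(q in `]1%R, +oo[) k q)%E.

(** The factor 2 in omega^2 cancels the factor 1/2 of [integral_cosh_g]. *)
Lemma integral_over_TA A (B : set (RR * RR)) : measurable B -> B `<=` @HH R -> 0 < iota (\det A) ->
  (\int[omega2]_(z in @HH R `*` B) k (cosh_dist A z) = kappa * eta B)%E.
Proof.
move=> mB BH dA; have mf : measurable_fun setT (fun z : H2T => k (cosh_dist A z)).
  by apply: (measurableT_comp mk); exact: measurable_cosh_dist.
rewrite (integral_omega2 (@measurable_HH R) mB mf (fun z => k0 _)).
rewrite (@eq_integral _ _ _ eta B (cst ((2^-1)%:E * kappa)%E)); last first.
  by move=> w /set_mem Bw; rewrite integral_cosh_g//; exact: BH.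
by rewrite integral_cst// !muleA -EFinM divff ?pnatr_eq0// mul1e.
Qed.

Variable F : set H2T.
Hypotheses (mF : measurable F) (FW : F `<=` @HH2 R) (injF : set_inj F orb)
  (covF : forall z, HH2 z -> exists2 M, Gamma a M & F (act M z)).

Lemma omega2_elliptic : omega2 (@HH R `*` elliptic) = 0%E.
Proof.
have [mZ Z0] := elliptic_negligible.
have mHZ := measurableX (@measurable_HH R) mZ.
rewrite -[LHS]mul1e -integral_cst//.
rewrite (integral_omega2 (@measurable_HH R) mZ (@measurable_cst _ _ _ _ _ 1%E))//.
rewrite null_set_integral ?mule0//.
by apply: measurable_funTS; apply: (@measurable_inner_integral R (@HH R) (fun=> 1%E)) => //; exact: measurable_HH.
Qed.

(** Both domains of pairs (A, z), namely all A with z in F and the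
representatives with both signs over the fundamental domains of their
stabilizers, are strict once elliptic points are removed; [transfer] gives the
inequality in each direction. *)
Lemma unfolding : kappa \is a fin_num ->
  (\int[omega2]_(z in F) (\esum_(A in Lm) k (cosh_dist A z)) =
   2%:E * kappa * volT iota conj D a m)%E.
Proof.
move=> kfin; have [T [TL Tcov Tinj ->]] := representatives iota quadK conjN1 ib DE ida m.
have [Fd FdP] := stab_domains iota quadK conjN1 ib ida.
have [mZ Z0] := elliptic_negligible.
have [e [Ge eG]] := Gamma_enum ida.
have [c cinj] := matrix_inj_nat K.
have Ldet A : Lm A -> \det A != 0 by exact: (Lm_det quadK conjN1 ib DE ida m_gt0).
have Lgt A : Lm A -> 0 < iota (\det A) by exact: (Lm_gt0 quadK conjN1 ib DE ida m_gt0).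
have Llact M A : Gamma a M -> Lm A -> Lm (lact conj M A) by exact: (Lm_lact quadK conjN1 ib DE ida).
have Lopp A : Lm A -> Lm (- A) by exact: (Lm_opp quadK conjN1 ib DE ida).
pose f A z := k (cosh_dist A z).
have mf A : measurable_fun setT (f A).
  by apply: (measurableT_comp mk); exact: measurable_cosh_dist.
have f0 A z : (0 <= f A z)%E by exact: k0.
rewrite (ge0_integral_esum 0 cinj omega2 Lm mF mf f0).
have fN A z : f (- A) z = f A z by rewrite /f /cosh_dist gN.
have flact M A z : Gamma a M -> Lm A -> HH2 z -> f (lact conj M A) (act M z) = f A z.
  move=> GM LA Hz; rewrite /f /cosh_dist g_act//; first exact: Gamma_det GM.
  by rewrite gt_eqF// Lgt.
pose HZ : set H2T := @HH R `*` elliptic.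
have mHZ : measurable HZ by apply: measurableX => //; exact: measurable_HH.
pose E A : set H2T := F `\` HZ.
pose P A : set H2T := @HH R `*` (Fd A `\` elliptic).
pose E' A : set H2T := (if `[< T A >] then P A else set0) `|` (if `[< T (- A) >] then P (- A) else set0).
have mP A : Lm A -> measurable (P A).
  move=> LA; have [mFd _ _ _ _] := FdP A (Ldet _ LA).
  by apply: measurableX; [exact: measurable_HH|exact: measurableD].
have mE A : measurable (E A) by exact: measurableD.
have mE' A : Lm A -> measurable (E' A).
  move=> LA; apply: measurableU; case: asboolP => // _; apply: mP => //; exact: Lopp.
have EW A : E A `<=` @HH2 R by move=> z [/FW].
have PW A : Lm A -> P A `<=` @HH2 R.
  move=> LA z [Hz1 [Fz _]]; split => //; have [_ FdW _ _ _] := FdP A (Ldet _ LA); exact: FdW.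
have E'W A : Lm A -> E' A `<=` @HH2 R.
  move=> LA z []; case: asboolP => // _; apply: PW => //; exact: Lopp.
have E'P A z : Lm A -> E' A z -> exists A0, [/\ T A0, A = A0 \/ A = - A0 & P A0 z].
  move=> LA []; case: asboolP => // TA Pz; first by exists A; split => //; left.
  by exists (- A); split => //; right; rewrite opprK.
have step1 : (\esum_(A in Lm) \int[omega2]_(z in F) f A z = \esum_(A in Lm) \int[omega2]_(z in E A) f A z)%E.
  apply: eq_esum => A LA; apply: ge0_negligible_integral => //; last exact: omega2_elliptic.
  exact: measurable_funTS.
rewrite step1.
have de i := Gamma_det (Ge i).
have dV i : \det (adj2 (e i)) = 1 by rewrite det_adj2.
have mphi : forall i, measurable_fun setT (act (e i)) by move=> i; exact: measurable_act.
have mpsi : forall i, measurable_fun setT (act (adj2 (e i))) by move=> i; exact: measurable_act.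
have psiW i z : HH2 z -> HH2 (act (adj2 (e i)) z) by apply: act_HH2; rewrite det_adj2.
have phiK i z : HH2 z -> act (adj2 (e i)) (act (e i) z) = z by exact: actK.
have psiK i z : HH2 z -> act (e i) (act (adj2 (e i)) z) = z by exact: actVK.
have alC i A : Lm A -> Lm (lact conj (e i) A) by exact: Llact.
have beC i A : Lm A -> Lm (lact conj (adj2 (e i)) A) by apply: Llact; exact: (GammaV ida).
have alK i A : Lm A -> lact conj (adj2 (e i)) (lact conj (e i) A) = A by move=> _; exact: lactK.
have beK i A : Lm A -> lact conj (e i) (lact conj (adj2 (e i)) A) = A by move=> _; exact: lactVK.
have inv i (h : H2T -> \bar R) (mh : measurable_fun setT h) (h0 : (forall x, 0 <= h x)%E) :=
  integral_act iota conj (de i) mh h0.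
have tr := @transfer _ H2T R omega2 (@HH2 R) (@measurable_HH2 R) _ Lm
  (fun i => act (e i)) (fun i => act (adj2 (e i))) (fun i => lact conj (e i)) (fun i => lact conj (adj2 (e i)))
  mphi mpsi psiW phiK psiK alC beC alK beK inv f.
have fe i A z : Lm A -> HH2 z -> f (lact conj (e i) A) (act (e i) z) = f A z by exact: flact.
(* Two pairs with a common image differ by one element of the group *)
have link i i' A A' z z' : Lm A -> Lm A' -> HH2 z -> HH2 z' ->
    lact conj (e i) A = lact conj (e i') A' -> act (e i) z = act (e i') z' ->
    exists2 M, Gamma a M & A' = lact conj M A /\ z' = act M z.
  move=> LA LA' Hz Hz' lE zE; exists (adj2 (e i') *m e i).
    by apply: (GammaM ida) => //; exact: (GammaV ida).
  by rewrite lact_mul actM// lE zE lactK// actK.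
(* Off the elliptic points only 1 and -1 can fix the second coordinate, and
   both act trivially on pairs. *)
have triv M A z : Gamma a M -> HH2 z -> ~ elliptic z.2 -> act2 M z.2 = z.2 ->
    lact conj M A = A /\ act M z = z.
  move=> GM [_ Hz2] nZ fM; have [->|->] := not_elliptic GM Hz2 nZ fM.
    by rewrite lact1 act1T.
  by rewrite lact_N1 act_N1.
have le1 : (\esum_(A in Lm) \int[omega2]_(z in E A) f A z <= \esum_(A in Lm) \int[omega2]_(z in E' A) f A z)%E.
  apply: tr => //.
  - move=> i i' A A' z z' LA LA' [Fz nZ] [Fz' nZ'] lE zE.
    have Hz := FW Fz; have Hz' := FW Fz'.
    have [M GM [A'E z'E]] := link _ _ _ _ _ _ LA LA' Hz Hz' lE zE.
    have zz : z = z' by apply: injF; rewrite ?inE// z'E (orb_act iota conj ida GM Hz).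
    have nell : ~ elliptic z.2 by move=> Zz; apply: nZ; split => //; case: Hz.
    have fM : act2 M z.2 = z.2 by have := congr1 snd z'E; rewrite -zz => {2}->.
    by have [lA _] := triv M A z GM Hz nell fM; rewrite A'E lA.
  - move=> A z LA [Fz nZ]; have Hz := FW Fz; have [A0 TA0 [M GM MA]] := Tcov A LA.
    have LA0 := TL _ TA0; have [mFd FdW injFd covFd _] := FdP A0 (Ldet _ LA0).
    have dM := Gamma_det GM; have [Hz1 Hz2] := Hz.
    have Hw : HH (act2 M z.2) by exact: act2_HH.
    have [M' SM' FM'] := covFd _ Hw; have [GM' M'A0] := SM'; have dM' := Gamma_det GM'.
    have G' : Gamma a (M' *m M) by exact: (GammaM ida).
    have [i iE] := eG _ G'; exists i; rewrite iE.
    have Pz : P A0 (act (M' *m M) z).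
      split; first by apply: moebius_HH => //; exact: det_map_mx1 (Gamma_det G').
      split; first by rewrite /= act2M.
      move=> Zz; apply: nZ; split => //; exact: (elliptic_act G' Hz2 Zz).
    have lM : lact conj (M' *m M) A = A0 \/ lact conj (M' *m M) A = - A0.
      rewrite lact_mul; case: MA => AE.
        by rewrite -AE.
      rewrite -[lact conj M A]opprK -AE lactN.
      by case: M'A0 => ->; [right|left; rewrite opprK].
    by case: lM => ->; [left|right]; rewrite ?opprK asboolT.
have le2 : (\esum_(A in Lm) \int[omega2]_(z in E' A) f A z <= \esum_(A in Lm) \int[omega2]_(z in E A) f A z)%E.
  apply: tr => //.
  - move=> i i' A A' z z' LA LA' E'z E'z' lE zE.
    have Hz := E'W _ LA _ E'z; have Hz' := E'W _ LA' _ E'z'.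
    have [M GM [A'E z'E]] := link _ _ _ _ _ _ LA LA' Hz Hz' lE zE.
    have [A0 [TA0 AA0 PA0]] := E'P A z LA E'z; have [A1 [TA1 AA1 PA1]] := E'P A' z' LA' E'z'.
    have MA01 : A1 = lact conj M A0 \/ A1 = - lact conj M A0.
      by move: A'E; case: AA0 => ->; case: AA1 => ->; rewrite ?lactN => E0;
        [left|right; rewrite -E0 opprK|right|left; exact: oppr_inj].
    have A01 : A0 = A1 by apply: Tinj => //; exists M.
    rewrite -A01 in MA01 PA1.
    have SM : stab A0 M by split => //; case: MA01 => E0; [left|right]; rewrite [in RHS]E0 ?opprK.
    have [_ [Fz nZ]] := PA0; have [_ [Fz' nZ']] := PA1; have [Hz1 Hz2] := Hz.
    have [_ _ injFd _ _] := FdP A0 (Ldet _ (TL _ TA0)).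
    have z2E : z'.2 = act2 M z.2 by rewrite z'E.
    have zz : z.2 = z'.2 by apply: injFd; rewrite ?inE// z2E (orbs_act iota ida SM Hz2).
    have [lA aM] := triv M A z GM Hz nZ (etrans (esym z2E) (esym zz)).
    by rewrite A'E z'E lA aM.
  - move=> A z LA E'z; have Hz := E'W _ LA _ E'z; have [Hz1 Hz2] := Hz.
    have [A0 [_ _ [_ [_ nZ]]]] := E'P A z LA E'z.
    have [M GM FM] := covF Hz; have [i iE] := eG _ GM; exists i; rewrite iE; split => //.
    by move=> [_ /= Zz]; apply: nZ; exact: (elliptic_act GM Hz2 Zz).
have -> : (\esum_(A in Lm) \int[omega2]_(z in E A) f A z = \esum_(A in Lm) \int[omega2]_(z in E' A) f A z)%E.
  by apply/eqP; rewrite eq_le le1 le2.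
pose q A : \bar R := (kappa * eta (Fd A))%E.
have kappa0 : (0 <= kappa)%E by apply: integral_ge0.
have q0 A : (0 <= q A)%E by apply: mule_ge0.
have PE A : Lm A -> (\int[omega2]_(z in P A) f A z = q A)%E.
  move=> LA; have [mFd FdW _ _ _] := FdP A (Ldet _ LA).
  rewrite integral_over_TA; [|exact: measurableD|by move=> w [/FdW]|exact: Lgt].
  have mI0 : eta (Fd A `&` elliptic) = 0%E.
    apply/eqP; rewrite eq_le measure_ge0 andbT -Z0.
    by apply: le_measure; rewrite ?inE//; exact: measurableI.
  congr (_ * _)%E; transitivity (eta (Fd A `\` elliptic) + 0)%E; first by rewrite adde0.
  by rewrite -mI0; exact/esym/(measureDI eta mFd mZ).
(* At most one of A and -A is a representative, so the union that defines E'
   has at most one nonempty part. *)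
have notboth A : Lm A -> T A -> ~ T (- A).
  move=> LA TA TNA; have AN : A = - A.
    by apply: Tinj => //; exists 1%:M; [exact: (Gamma1 ida)|right; rewrite lact1].
  have A0 i j : A i j = 0.
    have : A i j + A i j = 0 by rewrite {2}AN mxE subrr.
    rewrite -mulr2n -mulr_natr => /eqP; rewrite mulf_eq0 natrK_eq0 orbF => /eqP.
    by [].
  by have := Ldet _ LA; rewrite det2E !A0 mulr0 subrr eqxx.
have E'E A : Lm A -> (\int[omega2]_(z in E' A) f A z =
    (if A \in T then q A else 0) + (if (- A)%R \in T then q (- A)%R else 0))%E.
  move=> LA; have LNA := Lopp _ LA; rewrite /E'; case: asboolP => TA.
    rewrite mem_set// asboolF ?memNset ?setU0 ?adde0 ?PE//; exact: notboth.
  rewrite memNset// set0U add0e; case: asboolP => TNA.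
    rewrite mem_set// -PE//; apply: eq_integral => z _; by rewrite fN.
  by rewrite memNset// integral_set0.
rewrite (eq_esum E'E) esumD; [|by move=> A _; case: ifP|by move=> A _; case: ifP].
have -> : (\esum_(A in Lm) (if (- A)%R \in T then q (- A)%R else 0) = \esum_(A in Lm) (if A \in T then q A else 0))%E.
  apply/esym/(@reindex_esum _ _ _ Lm Lm -%R); split => //.
    by move=> A B _ _; exact: oppr_inj.
  by move=> A LA; exists (- A); [exact: Lopp|exact: opprK].
rewrite -(esum_mkcondr Lm T q) (setIidr TL).
have -> : (\esum_(A in T) q A = kappa * \esum_(A in T) volT_A A)%E.
  rewrite -(fineK kfin) -esumZl ?fine_ge0//; apply: eq_esum => A TA.
  by have [_ _ _ _ ->] := FdP A (Ldet _ (TL _ TA)); rewrite /q fineK.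
by rewrite -muleA -mule2n -mule_natl.
Qed.
End unfolding.

(** * The integral over the quotient *)

Section final.
Variables (R : realType) (K : fieldExtType rat).
Variables (iota : {rmorphism K -> R}) (conj : {rmorphism K -> K}) (D : int).
Hypotheses (quadK : \dim {:K} = 2%N) (conjN1 : exists x, conj x != x).
Variables (b1 b2 : K).
Hypotheses (ib : integral_basis b1 b2)
  (DE : D%:~R = (b1 * conj b2 - b2 * conj b1) ^+ 2).
Variable a : set K.
Hypothesis ida : fractional_ideal a.
Variable m : nat.
Hypothesis m_gt0 : (0 < m)%N.
Variables (sigma tau p q : R).
Hypotheses (sigma1 : 1 < sigma) (bo : bounded_osc p q).
Local Notation RR := (measurableTypeR R).
Local Notation H2T := ((RR * RR) * (RR * RR))%type.
Implicit Types (z : H2T) (M A B : 'M[K]_2).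
Local Notation act := (hilbert_act iota conj).
Local Notation Lm := (lattice_det iota conj D a m).
Local Notation omega2 := (@omega2 R).
Local Notation leb := (@lebesgue_measure R).
Local Notation orb := (orbitH2 iota conj a).
Local Notation Q := (Losc sigma tau p q).
Local Notation V := (volT iota conj D a m).
Local Notation cosh_dist := (cosh_dist iota).

(** A real component of Phi, with p and q as in [osc]. *)
Definition orbit_sum z : R := rsum Lm (fun A => Q (1 + 2 * Defs.g iota A z)).

Let kp : R -> \bar R := (EFin \o Q)^\+%E.
Let kn : R -> \bar R := (EFin \o Q)^\-%E.
Let S (k : R -> \bar R) z := (\esum_(A in Lm) k (cosh_dist A z))%E.

Lemma orbit_sumE z : orbit_sum z = fine (S kp z - S kn z)%E.
Proof.
rewrite /orbit_sum /rsum /S; congr (fine (_ - _)%E); apply: eq_esum => A _.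
  by rewrite /kp !funeposE.
by rewrite /kn !funenegE.
Qed.

Lemma abse_fineB (x y : \bar R) : (0 <= x)%E -> (0 <= y)%E -> (`|fine (x - y)|%:E <= x + y)%E.
Proof.
case: x => [x| |]//; case: y => [y| |]//=; rewrite ?lee_fin ?normr0 ?leey// => x0 y0.
by rewrite (le_trans (ler_normB _ _))// !ger0_norm.
Qed.

Let mQ : measurable_fun setT (EFin \o Q).
Proof. by apply/measurable_EFinP; exact: measurable_Losc. Qed.

Let mkp : measurable_fun setT kp. Proof. exact: measurable_funepos. Qed.
Let mkn : measurable_fun setT kn. Proof. exact: measurable_funeneg. Qed.
Let kp0 x : (0 <= kp x)%E. Proof. exact: funepos_ge0. Qed.
Let kn0 x : (0 <= kn x)%E. Proof. exact: funeneg_ge0. Qed.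

Let mS k : measurable_fun setT k -> (forall x, 0 <= k x)%E -> measurable_fun setT (S k).
Proof.
move=> mk k0; have [c cinj] := matrix_inj_nat K.
apply: (measurable_esum 0 cinj) => [A|A z]; last exact: k0.
by apply: (measurableT_comp mk); exact: measurable_cosh_dist.
Qed.

Let S0 k z : (forall x, 0 <= k x)%E -> (0 <= S k z)%E.
Proof. by move=> k0; apply: esum_ge0. Qed.

Let S_act k M z : Gamma a M -> HH2 z -> S k (act M z) = S k z.
Proof.
move=> GM Hz; rewrite /S.
have dM := Gamma_det GM.
rewrite (@reindex_esum _ _ _ Lm Lm (lact conj M)).
  apply: eq_esum => A LA; rewrite /cosh_dist g_act//.
  by rewrite gt_eqF// (Lm_gt0 quadK conjN1 ib DE ida m_gt0 LA).
split.
- by move=> A; exact: (Lm_lact quadK conjN1 ib DE ida GM).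
- by move=> A B _ _ E; rewrite -(lactK conj A dM) E lactK.
- move=> A LA; exists (lact conj (adj2 M) A); last exact: lactVK.
  by apply: (Lm_lact quadK conjN1 ib DE ida) => //; exact: (GammaV ida).
Qed.

Lemma orbit_sum_act M z : Gamma a M -> HH2 z -> orbit_sum (act M z) = orbit_sum z.
Proof. by move=> GM Hz; rewrite !orbit_sumE !S_act. Qed.

(** The integrand on the quotient evaluates Phi at a chosen point of the
orbit. *)
Lemma orbit_sum_get z : HH2 z -> orbit_sum (get (orb z)) = orbit_sum z.
Proof.
move=> Hz; have : orb z (get (orb z)) by apply: getPex; exists z; exact: orb_self.
by rewrite [X in X _ -> _]orbitH2E => -[M GM <-]; exact: orbit_sum_act.
Qed.

Lemma measurable_orbit_sum : measurable_fun setT orbit_sum.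
Proof.
rewrite (_ : orbit_sum = fun z => fine (S kp z - S kn z)%E); last by apply/funext => z; exact: orbit_sumE.
apply: (measurableT_comp (@measurable_fun_fine R)).
by apply: emeasurable_funB; exact: mS.
Qed.

Let kfin k : (k = kp) \/ (k = kn) -> (\int[leb]_(x in `]1%R, +oo[) k x)%E \is a fin_num.
Proof.
have iQ := integrable_Losc tau sigma1 bo.
have mD : measurable (`]1%R, +oo[%classic : set RR) by exact: measurable_itv.
by case=> ->; apply: integrable_fin_num => //; [exact: integrable_funepos|exact: integrable_funeneg].
Qed.

(** The sum over A is, by its definition, the difference of the sums of the
positive and negative parts of the Legendre function. [unfolding] applies to
each; both integrals are finite, so the two sums are finite almost everywhere
and the difference may be integrated termwise. *)
Lemma integral_component (h := fun O : set H2T => orbit_sum (get O)) :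
  (omega2X iota conj a).-integrable (X iota conj a) (EFin \o h) /\
  \int[omega2X iota conj a]_(O in X iota conj a) h O =
    2 * fine V * (legJ sigma tau p q - legJ sigma tau 0 0).
Proof.
have [F [mF FW injF covF dom]] := Gamma_domain iota quadK conjN1 ib ida.
have Vfin := volT_fin_num iota quadK conjN1 ib DE ida m_gt0.
have hE z : HH2 z -> h (orb z) = orbit_sum z by exact: orbit_sum_get.
have mh (G : R -> \bar R) : measurable_fun setT G ->
    measurable_fun (@HH2 R) ((fun O => G (h O)) \o orb).
  move=> mG; apply: (eq_measurable_fun (fun z => G (orbit_sum z))).
    by move=> z /set_mem Hz /=; rewrite hE.
  by apply: measurable_funTS; apply: (measurableT_comp mG); exact: measurable_orbit_sum.
have mE : measurable_fun setT (EFin : R -> \bar R) by apply/measurable_EFinP; exact: measurable_id.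
pose hp O : \bar R := (EFin : R -> \bar R)^\+%E (h O); pose hn O : \bar R := (EFin : R -> \bar R)^\-%E (h O).
have hpE : (EFin \o h)^\+%E = hp by apply/funext => O; rewrite /hp !funeposE.
have hnE : (EFin \o h)^\-%E = hn by apply/funext => O; rewrite /hn !funenegE.
have [mX1 iX1] := dom hp (mh _ (measurable_funepos mE)) (fun O => funepos_ge0 _ _).
have [mX2 iX2] := dom hn (mh _ (measurable_funeneg mE)) (fun O => funeneg_ge0 _ _).
have mabs : measurable_fun setT (fun x : R => `|x%:E|%E) by exact: measurableT_comp.
have [mX3 iX3] := dom (fun O => `|(EFin \o h) O|)%E (mh _ mabs) (fun O => abse_ge0 _).
(* F is strict, so [unfolding] turns each part into a multiple of the volume.
   *)
have unf k : k = kp \/ k = kn -> (\int[omega2]_(z in F) S k z = 2%:E * (\int[leb]_(x in `]1%R, +oo[) k x) * V)%E.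
  move=> kE; have kf := kfin kE.
  by case: kE kf => -> kf; apply: (unfolding quadK conjN1 ib DE ida m_gt0 _ _ mF FW injF covF) => //.
have iS k : k = kp \/ k = kn -> omega2.-integrable F (S k).
  move=> kE; have [mk k0] : measurable_fun setT k /\ (forall x, 0 <= k x)%E by case: kE => ->.
  apply/integrableP; split; first by apply: measurable_funTS; exact: mS.
  under eq_integral => z _ do rewrite gee0_abs ?S0//.
  by rewrite unf// ltey_eq !fin_numM// kfin.
have iSp := iS kp (or_introl erefl); have iSn := iS kn (or_intror erefl).
split.
  apply/integrableP; split.
    rewrite (_ : EFin \o h = (fun O => hp O - hn O)%E); last by rewrite -hpE -hnE; exact: funeposneg.
    exact: emeasurable_funB.
  rewrite iX3.
  apply: (@le_lt_trans _ _ (\int[omega2]_(z in F) (S kp z + S kn z))%E).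
    apply: ge0_le_integral => //.
    - by apply: measurable_funS (mh _ mabs) => //; exact: measurable_HH2.
    - by apply: measurable_funTS; apply: emeasurable_funD; exact: mS.
    - by move=> z Fz; rewrite /= hE ?orbit_sumE ?abse_fineB ?S0//; exact: FW.
  rewrite ge0_integralD//; last 4 first.
  - by move=> z _; exact: S0.
  - by apply: measurable_funTS; exact: mS.
  - by move=> z _; exact: S0.
  - by apply: measurable_funTS; exact: mS.
  by rewrite lte_add_pinfty// ltey_eq integrable_fin_num.
rewrite /Rintegral.
have -> : (\int[omega2X iota conj a]_(O in X iota conj a) (h O)%:E = \int[omega2]_(z in F) (S kp z - S kn z))%E.
  rewrite integralE hpE hnE iX1 iX2.
  transitivity (\int[omega2]_(z in F) (orbit_sum z)%:E)%E.
    rewrite [RHS]integralE; congr (_ - _)%E; apply: eq_integral => z /set_mem /FW Hz.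
      by rewrite /hp !funeposE /= hE.
    by rewrite /hn !funenegE /= hE.
  apply: ae_eq_integral => //.
  - by apply: measurable_funTS; apply/measurable_EFinP; exact: measurable_orbit_sum.
  - by apply: measurable_funTS; apply: emeasurable_funB; exact: mS.
  have a1 := integrable_ae mF iSp; have a2 := integrable_ae mF iSn.
  apply: filterS2 a1 a2 => z h1 h2 Fz; rewrite orbit_sumE fineK//.
  by rewrite fin_numB h1// h2.
rewrite integralB// !unf; [|by right|by left].
have kfp := kfin (or_introl erefl); have kfn := kfin (or_intror erefl).
have kappa : fine (\int[leb]_(x in `]1%R, +oo[) kp x)%E - fine (\int[leb]_(x in `]1%R, +oo[) kn x)%E =
    legJ sigma tau p q - legJ sigma tau 0 0.
  by apply: EFin_inj; rewrite EFinB !fineK// -(integral_Losc tau sigma1 bo) [RHS]integralE.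
rewrite -kappa -(fineK kfp) -(fineK kfn) -{1 2}(fineK Vfin) /=.
by ring.
Qed.
End final.

Theorem theorem5p3 (R : realType) (K : fieldExtType rat)
    (iota : {rmorphism K -> R}) (conj : {rmorphism K -> K}) (D : int)
    (quadK : \dim {:K} = 2%N) (conjN1 : exists x, conj x != x)
    (discD : is_discriminant conj D)
    (a : set K) (ida : fractional_ideal a) (m : nat) (m_gt0 : (0 < m)%N)
    (s : R[i]) (s_gt1 : 1 < complex.Re s) :
  [/\ volT iota conj D a m \is a fin_num,
      cintegrable (omega2X iota conj a) (X iota conj a)
        (on_orbits (Phi iota conj D a m s))
    & cintegral (omega2X iota conj a) (X iota conj a)
        (on_orbits (Phi iota conj D a m s)) =
      2 * (fine (volT iota conj D a m))%:C / (s * (s - 1))].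
Proof.
have [b1 [b2 [ib DE]]] := discD.
have ReE O : complex.Re (on_orbits (Phi iota conj D a m s) O) =
    orbit_sum iota conj D a m (complex.Re s) (- complex.Im s) 1 0 (get O).
  transitivity (rsum (lattice_det iota conj D a m)
      (fun A => complex.Re (legendreQ s (1 + 2 * Defs.g iota A (get O))))); first by [].
  by congr (rsum _ _); apply/funext => A; rewrite Re_legendreQ.
have ImE O : complex.Im (on_orbits (Phi iota conj D a m s) O) =
    orbit_sum iota conj D a m (complex.Re s) (- complex.Im s) 0 1 (get O).
  transitivity (rsum (lattice_det iota conj D a m)
      (fun A => complex.Im (legendreQ s (1 + 2 * Defs.g iota A (get O))))); first by [].
  by congr (rsum _ _); apply/funext => A; rewrite Im_legendreQ.
have [i1 e1] := integral_component iota quadK conjN1 ib DE ida m_gt0 (- complex.Im s) s_gt1 (@bounded_cos R).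
have [i2 e2] := integral_component iota quadK conjN1 ib DE ida m_gt0 (- complex.Im s) s_gt1 (@bounded_sin R).
split.
- exact: (volT_fin_num iota quadK conjN1 ib DE ida m_gt0).
- by split; [move: i1; rewrite -(funext ReE)|move: i2; rewrite -(funext ImE)].
- rewrite -(funext ReE) in e1; rewrite -(funext ImE) in e2.
  rewrite /cintegral -(legJ_value s_gt1).
  apply/eqP; rewrite eq_complex; apply/andP; split; apply/eqP.
    by apply: (etrans e1); rewrite /=; ring.
  by apply: (etrans e2); rewrite /=; ring.
Qed.
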